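(* Let $T>0$ and let $a,b_1,b_2,b_3\in B^\infty(\mathbb{R})$ be real-valued with $a\ge 0$, and suppose there is $M_2>0$ with $b_1(x)^2\le M_2\,a(x)$ for all $x\in\mathbb{R}$. Assume that $g_0,g_1\in C_c^\infty(\mathbb{R})$ and $f\in C([0,T],C_c^\infty(\mathbb{R}))$. Then the Cauchy problem $$\partial_t^2u-a(x)\partial_x^2u+b_1(x)\partial_xu+b_2(x)\partial_tu+b_3(x)u=f(t,x),\quad t\in[0,T],\ x\in\mathbb{R},$$ $$u(0,x)=g_0(x),\qquad \partial_tu(0,x)=g_1(x),$$ is well-posed (existence and uniqueness of the solution $u$) in every Sobolev space $H^k$, $k\in\mathbb{N}_0$, and for all $k\in\mathbb{N}_0$ there exists a constant $C_k>0$, depending on $T$, $M_2$ and the $L^\infty$-norms of the derivatives of the coefficients up to order $k+1$, such that $$\|u(t)\|_{H^{k+1}}^2\le C_k\Big(\|g_0\|_{H^{k+2}}^2+\|g_1\|_{H^{k+1}}^2+\int_0^t\|f(s)\|_{H^{k+1}}^2\,ds\Big)$$ for all $t\in[0,T]$.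
   Context: $B^\infty(\mathbb{R})$ denotes the space of smooth functions on $\mathbb{R}$ that are bounded together with all their derivatives. $H^k=H^k(\mathbb{R})$ is the usual $L^2$-based Sobolev space in the variable $x$. All functions are real-valued. *)

(* Defs.v *)
From mathcomp Require Import all_boot all_order all_algebra.
From mathcomp Require Import all_classical all_reals all_analysis.

Set Implicit Arguments.
Unset Strict Implicit.
Unset Printing Implicit Defensive.
Import Order.TTheory GRing.Theory Num.Theory.
Import numFieldNormedType.Exports.

Local Open Scope ring_scope.
Local Open Scope classical_set_scope.

Section FunctionSpaces.
Context {R : realType}.
Local Notation mu := (@lebesgue_measure R).

Definition smooth (f : R -> R) : Prop :=
  forall (n : nat) (x : R), derivable (derive1n n f) x 1.

Definition Binfty (f : R -> R) : Prop :=
  smooth f /\ forall n : nat, exists M : R, forall x : R, `|derive1n n f x| <= M.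

Definition Ccinfty (f : R -> R) : Prop :=
  smooth f /\ compact (closure [set x | f x != 0]).

(* Convergence of sequences in the usual (LF) topology of C_c^oo(R): supports
   in a common compact set, and uniform convergence of every derivative. *)
Definition Ccinfty_cvg (phi_ : nat -> R -> R) (phi : R -> R) : Prop :=
  (exists K : set R, compact K /\ forall n, [set x | phi_ n x != 0] `<=` K) /\
  forall (j : nat) (e : R), 0 < e ->
    \forall n \near \oo, forall x : R, `|derive1n j (phi_ n) x - derive1n j phi x| < e.

(* f \in C([0,T], C_c^oo(R)); as [0,T] is metrizable, continuity is sequential
   continuity.  The values of f t for t outside [0,T] are irrelevant. *)
Definition continuous_Ccinfty (T : R) (f : R -> R -> R) : Prop :=
  (forall t : R, 0 <= t <= T -> Ccinfty (f t)) /\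
  forall (s_ : nat -> R) (t : R), (forall n, 0 <= s_ n <= T) -> 0 <= t <= T ->
    s_ @ \oo --> t -> Ccinfty_cvg (fun n => f (s_ n)) (f t).

Definition L2 : set (R -> R) := [set u | u \in Lfun mu 2%:E].

Definition weak_derivative (j : nat) (u v : R -> R) : Prop :=
  forall phi : R -> R, Ccinfty phi ->
    \int[mu]_x (u x * derive1n j phi x) = (-1) ^+ j * \int[mu]_x (v x * phi x).

(* Elements of H^k are represented by functions, to be identified when they are
   equal almost everywhere. *)
Definition sobolev (k : nat) : set (R -> R) :=
  [set u | L2 u /\ forall j : nat, (j <= k)%N ->
             exists v : R -> R, L2 v /\ weak_derivative j u v].

Definition weakD (j : nat) (u : R -> R) : R -> R :=
  xget (cst 0) [set v | L2 v /\ weak_derivative j u v].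

(* The square of the H^k norm; +oo outside H^k. *)
Definition sobolev_norm2 (k : nat) (u : R -> R) : \bar R :=
  if `[< sobolev k u >] then
    (\sum_(j < k.+1) 'N[mu]_2%:E [EFin \o weakD j u] ^+ 2)%E
  else +oo%E.

Definition continuous_sobolev (T : R) (k : nat) (u : R -> R -> R) : Prop :=
  forall t : R, 0 <= t <= T -> sobolev k (u t) /\
    sobolev_norm2 k (u s \- u t) @[s --> within `[0, T] (nbhs t)] --> 0%E.

(* v is the derivative of u : [0,T] -> H^k for the norm of H^k, one-sided at
   the endpoints. *)
Definition sobolev_derivative (T : R) (k : nat) (u v : R -> R -> R) : Prop :=
  forall t : R, 0 <= t <= T ->
    sobolev_norm2 k (fun x => (s - t)^-1 * (u s x - u t x) - v t x)
      @[s --> within `[0, T] t^'] --> 0%E.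

Definition Linfty_norms (n : nat) (c : R -> R) : 'rV[R]_n.+1 :=
  \row_(j < n.+1) fine ('N[mu]_+oo [EFin \o derive1n j c])%E.

End FunctionSpaces.

Section CauchyProblem.
Context {R : realType}.
Local Notation mu := (@lebesgue_measure R).
Variables (T : R) (a b1 b2 b3 g0 g1 : R -> R) (f : R -> R -> R).

(* u \in C^2([0,T], H^k), with d_t u = ut and d_t^2 u = utt.  For k < 2 the
   term a d_x^2 u need not be a function, so at each time the equation holds in
   the sense of distributions in x, where <c d_x^j u, phi> is, by definition,
   (-1)^j <u, d_x^j (c phi)>. *)
Definition solution (k : nat) (u : R -> R -> R) : Prop :=
  exists ut utt : R -> R -> R,
  [/\ [/\ continuous_sobolev T k u, continuous_sobolev T k ut &
          continuous_sobolev T k utt],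
      sobolev_derivative T k u ut /\ sobolev_derivative T k ut utt,
      forall t : R, 0 <= t <= T -> forall phi : R -> R, Ccinfty phi ->
        \int[mu]_x (utt t x * phi x
                    - u t x * derive1n 2 (a \* phi) x
                    - u t x * derive1n 1 (b1 \* phi) x
                    + b2 x * ut t x * phi x
                    + b3 x * u t x * phi x)
        = \int[mu]_x (f t x * phi x),
      {ae mu, forall x, u 0 x = g0 x} &
      {ae mu, forall x, ut 0 x = g1 x}].

Definition well_posed (k : nat) : Prop :=
  (exists u, solution k u) /\
  forall u v, solution k u -> solution k v ->
    forall t : R, 0 <= t <= T -> {ae mu, forall x, u t x = v t x}.

End CauchyProblem.

(* Main.v *)
(* Write the equation as u_tt = A(u, u_t) + f with A(U, V) = a U'' - b1 U' - b2 V - b3 U.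

   Energy estimate: the sum over j <= N of |D^j u_t|^2 + |D^j u|^2 + a |D^(j+1) u|^2 has a time
   derivative which, up to the divergence of the flux 2 a D^(j+1) u D^j u_t, is bounded by the sum
   itself.  The critical commutator terms are b1 D^(j+1) u, absorbed because b1^2 <= M2 a, and
   (j - 1) a' D^(j+1) u, absorbed by Glaeser's inequality a'^2 <= 4 |a''|_oo a; the latter only
   occurs for N > 1, where a'' is one of the derivatives that the constant may depend on.

   Existence: when the coefficients have compact support, A(u, v) is replaced by S A(S u, S v) for
   the square S of a box average.  This is a bounded operator, so Picard iteration applies, the
   energy estimate is uniform in the width of the box, and the regularized solutions are Cauchy.
   General coefficients are cut off outside a large interval: with the weight (|x| - R - c t)_+^2
   the energy estimate gives finite speed of propagation, so that the cutoff is not seen before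
   time T.

   Uniqueness: the adjoint problem is of the same type, and pairing a solution of low regularity
   with a smooth solution of the adjoint problem run backwards from time t determines the integral
   of u(t) psi for every test function psi. *)

(* Where [a] vanishes, the energy of order [N] says nothing about [D^(N+1) u], so every commutator
   term of that order must carry a factor dominated by [sqrt a]. At [j = 0] the term [- a' D u] is
   harmless without such a factor, since [D u] belongs to the energy as soon as [N >= 1]; this is
   why the estimates start in [H^1] and why the constant for [H^(k+1)] involves no derivative of
   order above [k + 1]. A solution in [H^k] with small [k] is too rough to be inserted into the
   energy. Energies are therefore computed for smooth compactly supported functions only; uniqueness
   then identifies any given solution, whatever its order, with the smooth one, and the estimates of
   all orders pass to it. Averaging loses three derivatives in its error term. Smooth data pay for
   them, because the bounds that are uniform in the width hold at every order. Glaeser's inequality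
   serves a second time for the adjoint problem: its first-order coefficient [- (2 a' + b1)] must
   again have a square dominated by a multiple of [a]. *)
Require Import Defs.
From mathcomp Require Import all_boot all_order all_algebra.
From mathcomp Require Import all_classical all_reals all_analysis.
From mathcomp Require Import measurable_realfun ess_sup_inf.
From mathcomp Require Import ring lra.

Set Implicit Arguments.
Unset Strict Implicit.
Unset Printing Implicit Defensive.
Import Order.TTheory GRing.Theory Num.Theory.
Import numFieldNormedType.Exports.

Local Open Scope ring_scope.
Local Open Scope classical_set_scope.

(** * Derivatives and smooth functions *)

Section Derivatives.
Context {R : realType}.
Implicit Types (f g u v : R -> R) (x y : R).

(* An opaque copy of [is_derive]: unification otherwise unfolds it down to filters. *)
Definition der f x (l : R) := is_derive (x : R^o) (1 : R^o) (f : R^o -> R^o) l.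

Lemma der_is_derive f x l : der f x l <-> is_derive (x : R^o) (1 : R^o) (f : R^o -> R^o) l.
Proof. exact: iff_refl. Qed.

Lemma derP f x : derivable f x 1 -> der f x (derive1 f x).
Proof. by move=> h; rewrite /der derive1E; exact: derivableP. Qed.

Lemma der_derivable f x l : der f x l -> derivable f x 1.
Proof. by case. Qed.

Lemma der_val f x l : der f x l -> derive1 f x = l.
Proof. by case=> _ <-; rewrite derive1E. Qed.

Lemma der_eq f g x l l' : der f x l -> f =1 g -> l = l' -> der g x l'.
Proof. by move=> h /funext <- <-. Qed.

Lemma derD f g x a b : der f x a -> der g x b -> der (fun y => f y + g y) x (a + b).
Proof. exact: is_deriveD. Qed.

Lemma derN f x a : der f x a -> der (fun y => - f y) x (- a).
Proof. exact: is_deriveN. Qed.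

Lemma derB f g x a b : der f x a -> der g x b -> der (fun y => f y - g y) x (a - b).
Proof. by move=> h k; apply: derD => //; apply: derN. Qed.

Lemma derM f g x a b : der f x a -> der g x b ->
  der (fun y => f y * g y) x (a * g x + f x * b).
Proof.
move=> h k; have := is_deriveM h k => /der_eq; apply => //.
by rewrite addrC /GRing.scale /= [g x * a]mulrC.
Qed.

Lemma der_cst (c : R) x : der (fun=> c) x 0.
Proof. exact: is_derive_cst. Qed.

Lemma der_id x : der id x 1.
Proof. exact: is_derive_id. Qed.

Lemma derZ f x (c a : R) : der f x a -> der (fun y => c * f y) x (c * a).
Proof. by move=> /(derM (der_cst c x)) /der_eq; apply => //; rewrite mul0r add0r. Qed.

Lemma der_comp f g x a b : der f (g x) a -> der g x b ->
  der (fun y => f (g y)) x (a * b).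
Proof. by move=> h k; have := is_derive1_comp h k. Qed.

Lemma der_aff f (s h : R) x a : der f (s * x + h) a ->
  der (fun y => f (s * y + h)) x (s * a).
Proof.
move=> hf; rewrite mulrC; apply: der_comp => //.
have := derD (derZ s (der_id x)) (der_cst h x) => /der_eq; apply => //.
by rewrite mulr1 addr0.
Qed.

Lemma der_sum n (F : nat -> R -> R) (dF : nat -> R) x :
  (forall i, (i < n)%N -> der (F i) x (dF i)) ->
  der (fun y => \sum_(i < n) F i y) x (\sum_(i < n) dF i).
Proof.
elim: n => [_|n IH h].
  by apply: (der_eq (der_cst 0 x)) => [y|]; rewrite big_ord0.
have h1 : der (F n) x (dF n) by apply: h.
have h2 := IH (fun i hi => h i (ltnW hi)).
by apply: (der_eq (derD h2 h1)) => [y|]; rewrite big_ord_recr.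
Qed.

Lemma der_continuous f : (forall x, exists l, der f x l) -> continuous f.
Proof.
move=> h x; have [l hl] := h x.
by apply: differentiable_continuous; apply/derivable1_diffP; apply: der_derivable hl.
Qed.

Lemma der_cont f (f' : R -> R) : (forall x, der f x (f' x)) -> continuous f.
Proof. by move=> h; apply: der_continuous => x; exists (f' x). Qed.

Lemma cont_within f a b : continuous f -> {within `[a, b], continuous f}.
Proof. exact: continuous_subspaceT. Qed.

Lemma mvt f (f' : R -> R) x y : x <= y -> (forall z, x < z < y -> der f z (f' z)) ->
  continuous f ->
  exists2 z, x <= z <= y & f y - f x = f' z * (y - x).
Proof.
move=> xy h cf.
have h' z : z \in `]x, y[%R -> is_derive z 1 f (f' z) by rewrite in_itv => /h.
have [z hz e] := MVT_segment xy h' (cont_within cf).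
by exists z => //; move: hz; rewrite in_itv.
Qed.

Lemma mvt_der f (f' : R -> R) x y : (forall z, der f z (f' z)) ->
  exists2 z, Num.min x y <= z <= Num.max x y & f y - f x = f' z * (y - x).
Proof.
move=> h; have cf := der_cont h.
case: (leP x y) => xy.
  exact: mvt.
have [z hz e] := mvt (ltW xy) (fun z _ => h z) cf.
by exists z => //; rewrite -opprB e; ring.
Qed.

Lemma der_le f (f' : R -> R) x y : x <= y -> continuous f ->
  (forall z, x < z < y -> der f z (f' z)) ->
  (forall z, x <= z <= y -> f' z <= 0) -> f y <= f x.
Proof.
move=> xy cf h le0; have [z hz e] := mvt xy h cf.
by rewrite -subr_le0 e mulr_le0_ge0 ?le0 ?subr_ge0.
Qed.

Lemma der_bound f (f' : R -> R) (M : R) x y : (forall z, der f z (f' z)) ->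
  (forall z, `|f' z| <= M) -> `|f y - f x| <= M * `|y - x|.
Proof.
move=> h b; have [z _ ->] := mvt_der x y h.
by rewrite normrM ler_wpM2r.
Qed.

(** The mean value theorem twice, for [f] and then for [f']. The factor 1/2 of Taylor's formula is
    given up, which only enlarges constants such as the 4 in [glaeser]. *)
Lemma der_taylor f (f' f'' : R -> R) (M : R) x y : (forall z, der f z (f' z)) ->
  (forall z, der f' z (f'' z)) ->
  (forall z, `|f'' z| <= M) -> `|f y - f x - (y - x) * f' x| <= M * (y - x) ^+ 2.
Proof.
move=> h h' b; have [z hz ->] := mvt_der x y h.
rewrite [X in X - _]mulrC -mulrBr normrM -real_normK ?num_real//.
rewrite expr2 [X in _ <= X]mulrCA ler_wpM2l//.
apply: le_trans (der_bound x z h' b) _.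
rewrite ler_wpM2l ?(le_trans _ (b 0))//.
by move: hz; case: (leP x y) => xy /andP[h1 h2]; [rewrite !ger0_norm|rewrite !ler0_norm]; lra.
Qed.

Lemma der_cst_eq f x y : (forall z, der f z 0) -> f x = f y.
Proof.
move=> h; apply/eqP; rewrite -subr_eq0 -normr_le0.
by rewrite -(mul0r `|x - y|); apply: (der_bound (f' := fun=> 0)) => // z; rewrite normr0.
Qed.

Lemma der_unique f x l l' : der f x l -> der f x l' -> l = l'.
Proof. by move=> /der_val <- /der_val. Qed.

End Derivatives.
Global Opaque der.

Section Smooth.
Context {R : realType}.
Implicit Types (f g u v : R -> R) (x y : R).

Lemma smooth_der f n x : smooth f -> der (derive1n n f) x (derive1n n.+1 f x).
Proof. by move=> h; rewrite derive1nS; apply: derP. Qed.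

Lemma smooth_der0 f x : smooth f -> der f x (derive1n 1 f x).
Proof. exact: (@smooth_der f 0). Qed.

(** Smoothness is shown below by exhibiting all derivatives at once, as a sequence in which each
    member differentiates to the next. *)
Lemma family_derive1n (F : nat -> R -> R) n :
  (forall n x, der (F n) x (F n.+1 x)) -> derive1n n (F 0) = F n.
Proof.
move=> h; elim: n => // n IH; rewrite derive1nS IH.
by apply/funext => x; exact: der_val.
Qed.

Lemma family_smooth (F : nat -> R -> R) :
  (forall n x, der (F n) x (F n.+1 x)) -> smooth (F 0).
Proof. by move=> h n x; rewrite (family_derive1n n h); apply: der_derivable (h n x). Qed.

Lemma smooth_continuous f n : smooth f -> continuous (derive1n n f).
Proof. by move=> h; apply: der_cont => x; exact: smooth_der. Qed.

Lemma smooth_cont f : smooth f -> continuous f.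
Proof. exact: (@smooth_continuous f 0). Qed.

Lemma derive1nD f m n : derive1n m (derive1n n f) = derive1n (m + n) f.
Proof. by rewrite /derive1n iterD. Qed.

Lemma smooth_derive1n f n : smooth f -> smooth (derive1n n f).
Proof. by move=> h m x; rewrite derive1nD; apply: h. Qed.

Lemma der_smooth f g : (forall x, der f x (g x)) -> smooth g -> smooth f.
Proof.
move=> h hg; apply: (@family_smooth (fun n => if n is n'.+1 then derive1n n' g else f)).
case=> [|n] x.
  exact: (h x).
exact: (smooth_der n x hg).
Qed.

Lemma derive1n1E f g : (forall x, der f x (g x)) -> derive1n 1 f = g.
Proof. by move=> h; apply/funext => x; exact: der_val. Qed.

Definition leib f g n x : R :=
  \sum_(i < n.+1) 'C(n, i)%:R * (derive1n i f x * derive1n (n - i) g x).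

Lemma leib_der f g n x : smooth f -> smooth g -> der (leib f g n) x (leib f g n.+1 x).
Proof.
move=> sf sg.
have h1 : der (leib f g n) x (\sum_(i < n.+1) 'C(n, i)%:R *
   (derive1n i.+1 f x * derive1n (n - i) g x + derive1n i f x * derive1n (n - i).+1 g x)).
  apply: (der_sum (F := fun i x => 'C(n, i)%:R * (derive1n i f x * derive1n (n - i) g x))
   (dF := fun i => 'C(n, i)%:R *
   (derive1n i.+1 f x * derive1n (n - i) g x + derive1n i f x * derive1n (n - i).+1 g x))).
  by move=> i _; apply: derZ; apply: derM; apply: smooth_der.
apply: (der_eq h1) => //.
(* Pascal's rule: the terms with the new derivative on [f] are shifted by one index and merged with
   those that have it on [g]. *)
rewrite (eq_bigr (fun i : 'I__ => 'C(n, i)%:R * (derive1n i.+1 f x * derive1n (n.+1 - i.+1) g x)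
   + 'C(n, i)%:R * (derive1n i f x * derive1n (n.+1 - i) g x))); last first.
  by move=> i _; rewrite mulrDr subSS subSn// -ltnS.
rewrite big_split /= /leib [in RHS]big_ord_recl /= bin0 ?subn0.
under [in RHS]eq_bigr do rewrite /bump /= add1n binS natrD mulrDl.
rewrite big_split /= addrA addrC; congr (_ + _).
rewrite [in RHS]big_ord_recr /= bin_small// mul0r addr0 big_ord_recl bin0 ?subn0.
by congr (_ + _); apply: eq_bigr => i _; rewrite /bump /= add1n.
Qed.

Lemma leib0 f g : leib f g 0 = (fun x => f x * g x).
Proof. by apply/funext => x; rewrite /leib big_ord_recl big_ord0 bin0 mul1r addr0. Qed.

Lemma smoothM f g : smooth f -> smooth g -> smooth (fun x => f x * g x).
Proof. by move=> sf sg; rewrite -leib0; apply: family_smooth => n x; exact: leib_der. Qed.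

Lemma derive1nM f g n : smooth f -> smooth g ->
  derive1n n (fun x => f x * g x) = leib f g n.
Proof. by move=> sf sg; rewrite -leib0; apply: family_derive1n => m x; exact: leib_der. Qed.

Lemma derive1n_lin f g (a b : R) n : smooth f -> smooth g ->
  derive1n n (fun x => a * f x + b * g x) = (fun x => a * derive1n n f x + b * derive1n n g x).
Proof.
move=> sf sg; apply: (family_derive1n
  (F := fun n x => a * derive1n n f x + b * derive1n n g x)) => m x.
by apply: derD; apply: derZ; exact: smooth_der.
Qed.

Lemma smooth_lin f g (a b : R) : smooth f -> smooth g -> smooth (fun x => a * f x + b * g x).
Proof.
move=> sf sg; apply: (family_smooth
  (F := fun n x => a * derive1n n f x + b * derive1n n g x)) => m x.
by apply: derD; apply: derZ; exact: smooth_der.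
Qed.

Lemma smoothD f g : smooth f -> smooth g -> smooth (fun x => f x + g x).
Proof.
move=> sf sg; rewrite (_ : (fun x => _) = (fun x => 1 * f x + 1 * g x)); first exact: smooth_lin.
by apply/funext => x; rewrite !mul1r.
Qed.

Lemma derive1n_D f g n : smooth f -> smooth g ->
  derive1n n (fun x => f x + g x) = (fun x => derive1n n f x + derive1n n g x).
Proof.
move=> sf sg; rewrite (_ : (fun x => _) = (fun x => 1 * f x + 1 * g x)); last first.
  by apply/funext => x; rewrite !mul1r.
by rewrite derive1n_lin//; apply/funext => x; rewrite !mul1r.
Qed.

Lemma smoothB f g : smooth f -> smooth g -> smooth (fun x => f x - g x).
Proof.
move=> sf sg; rewrite (_ : (fun x => _) = (fun x => 1 * f x + -1 * g x)); first exact: smooth_lin.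
by apply/funext => x; rewrite mul1r mulN1r.
Qed.

Lemma derive1n_B f g n : smooth f -> smooth g ->
  derive1n n (fun x => f x - g x) = (fun x => derive1n n f x - derive1n n g x).
Proof.
move=> sf sg; rewrite (_ : (fun x => _) = (fun x => 1 * f x + -1 * g x)); last first.
  by apply/funext => x; rewrite mul1r mulN1r.
by rewrite derive1n_lin//; apply/funext => x; rewrite mul1r mulN1r.
Qed.

Lemma smooth_cst (c : R) : smooth (fun=> c).
Proof.
apply: (family_smooth (F := fun n => if n is _.+1 then fun=> 0 else fun=> c)) => -[|n] x;
  exact: der_cst.
Qed.

Lemma smoothZ f (c : R) : smooth f -> smooth (fun x => c * f x).
Proof. by move=> sf; apply: smoothM sf; exact: smooth_cst. Qed.

Lemma derive1nZ f (c : R) n : smooth f ->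
  derive1n n (fun x => c * f x) = (fun x => c * derive1n n f x).
Proof.
move=> sf; apply: (family_derive1n (F := fun n x => c * derive1n n f x)) => m x.
by apply: derZ; exact: smooth_der.
Qed.

Lemma smoothN f : smooth f -> smooth (fun x => - f x).
Proof.
move=> sf; rewrite (_ : (fun x => _) = (fun x => -1 * f x)); first exact: smoothZ.
by apply/funext => x; rewrite mulN1r.
Qed.

Lemma smooth_aff f (s h : R) : smooth f -> smooth (fun x => f (s * x + h)).
Proof.
move=> sf; rewrite (_ : (fun x => _) = (fun x => s ^+ 0 * derive1n 0 f (s * x + h))).
  apply: (family_smooth (F := fun n x => s ^+ n * derive1n n f (s * x + h))) => m x.
  rewrite exprSr -mulrA; apply: derZ.
  by apply: der_aff; exact: smooth_der.
by apply/funext => x; rewrite mul1r.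
Qed.

Lemma derive1n_cst0 n : derive1n n (fun=> 0 : R) = (fun=> 0).
Proof. by apply: (family_derive1n (F := fun n => fun=> 0)) => m x; exact: der_cst. Qed.

(** The support is recorded by the radius of a centred interval, so that its growth can be followed
    quantitatively. The condition bears on an open set of points and hence passes to derivatives. *)
Definition supp (K : R) f := forall x, K < `|x| -> f x = 0.

Lemma supp_le K L f : K <= L -> supp K f -> supp L f.
Proof. by move=> KL h x Lx; apply: h; apply: le_lt_trans Lx. Qed.

Lemma supp_derive1n K f n : supp K f -> supp K (derive1n n f).
Proof.
move=> h; elim: n => // n IH x Kx.
rewrite derive1nS; apply: der_val; apply/der_is_derive.
apply: (@near_eq_is_derive _ _ _ (fun=> 0)).
near=> y; apply/esym/IH; near: y.
have : (fun y : R => `|y|) @ x --> `|x| by apply: norm_continuous.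
by move/cvgr_gt; apply.
Unshelve. all: by end_near. Qed.

Lemma suppM K f g : supp K g -> supp K (fun x => f x * g x).
Proof. by move=> h x Kx; rewrite h// mulr0. Qed.

Lemma cont_seg_bound f K : continuous f -> exists M : R, forall x, `|x| <= K -> `|f x| <= M.
Proof.
move=> cf.
have : compact (f @` `[-K, K]).
  apply: continuous_compact; last exact: segment_compact.
  exact: cont_within.
move=> /compact_bounded [M [_ hM]]; exists (M + 1) => x Kx.
apply: (hM (M + 1)); first by rewrite ltrDl.
by exists x => //=; rewrite in_itv /= -ler_norml.
Qed.

Lemma cont_supp_bound f K : continuous f -> supp K f -> exists M : R, forall x, `|f x| <= M.
Proof.
move=> cf sf; have [M hM] := cont_seg_bound K cf.
exists (Num.max M 0) => x; case: (leP `|x| K) => xK.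
  by rewrite le_max hM.
by rewrite sf// normr0 le_max lexx orbT.
Qed.

Lemma CcinftyP f : Ccinfty f <-> smooth f /\ exists2 K : R, 0 <= K & supp K f.
Proof.
split=> -[sf h]; split=> //.
  have /compact_bounded [M [_ hM]] := h.
  exists (`|M| + 1); first exact: addr_ge0.
  move=> x hx; apply/eqP/negPn/negP => fx; move: hx; apply/negP; rewrite -leNgt.
  apply: hM; first by rewrite (le_lt_trans (ler_norm M))// ltrDl.
  exact: subset_closure.
have [K _ sK] := h.
have sub : closure [set x | f x != 0] `<=` `[-K, K].
  apply: (@subset_trans _ (closure `[-K, K])).
    apply: closureS => x /= /eqP fx; rewrite in_itv /= -ler_norml leNgt.
    by apply/negP => /sK.
  by rewrite -(proj1 (closure_id _) _)//; exact: itv_closed.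
exact: subclosed_compact (@closed_closure _ _) (@segment_compact _ _ _) sub.
Qed.

End Smooth.
Global Opaque smooth.

(** * Primitives and integrals over [-K, K] *)

Section Primitive.
Context {R : realType}.
Local Notation mu := (@lebesgue_measure R).
Implicit Types (f g u v phi : R -> R) (x y a b : R).

Lemma cont_integrable g a b : continuous g -> mu.-integrable `[a, b] (EFin \o g).
Proof.
move=> cg; apply: continuous_compact_integrable; first exact: segment_compact.
exact: cont_within.
Qed.

(** The oriented integral from 0 to [x]: for either sign of [x] one of the two integrals is over an
    empty or degenerate interval. *)
Definition prim : (R -> R) -> R -> R :=
  locked (fun g x => \int[mu]_(t in `[0, x]) g t - \int[mu]_(t in `[x, 0]) g t).

Lemma primE g x : prim g x = \int[mu]_(t in `[0, x]) g t - \int[mu]_(t in `[x, 0]) g t.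
Proof. by rewrite /prim -lock. Qed.

(** A base point [a] to the left of both 0 and [x] removes the case distinction on the sign, so that
    [prim] is differentiated at 0 like anywhere else. *)
Lemma prim_from g a x : continuous g -> a < 0 -> a < x ->
  prim g x = \int[mu]_(t in `[a, x]) g t - \int[mu]_(t in `[a, 0]) g t.
Proof.
move=> cg a0 ax; have ci := cont_integrable _ _ cg; rewrite primE.
have z0 y z : z <= y -> \int[mu]_(t in `[y, z]) g t = 0.
  rewrite le_eqVlt => /predU1P[->|zy]; first by rewrite set_itv1 Rintegral_set1.
  by rewrite set_itv_ge ?Rintegral_set0// bnd_simp -ltNge.
have sub y z : mu.-integrable `]y, z] (EFin \o g).
  by apply: integrableS (ci y z) => //; exact: subset_itv_oc_cc.
case: (leP 0 x) => x0.
  rewrite (z0 x 0)// subr0 Rintegral_itvB ?bnd_simp//; last exact: ltW.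
  by rewrite Rintegral_itv_obnd_cbnd.
rewrite (z0 0 x) ?ltW// sub0r -opprB; congr (- _).
rewrite Rintegral_itvB ?bnd_simp//; [|exact: ltW|exact: ltW].
by rewrite Rintegral_itv_obnd_cbnd.
Qed.

Lemma prim_der g x : continuous g -> der (prim g) x (g x).
Proof.
move=> cg; set a := Num.min 0 x - 1.
have [m1 m2] : Num.min 0 x <= 0 /\ Num.min 0 x <= x by rewrite !ge_min !lexx orbT.
have a0 : a < 0 by rewrite /a; lra.
have ax : a < x by rewrite /a; lra.
have [df fE] := @continuous_FTC1_closed R g a x (x + 1) (ltr_pwDr ltr01 (lexx x))
  (cont_integrable _ _ cg) ax (cg x).
have h := derP df; rewrite fE in h.
have h2 := derB h (der_cst (\int[mu]_(t in `[a, 0]) g t) x).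
rewrite subr0 in h2; move/der_is_derive in h2; apply/der_is_derive.
apply: near_eq_is_derive h2; near=> y.
have ay : a < y by near: y; exact: lt_nbhsr.
by rewrite (prim_from cg a0 ay).
Unshelve. all: by end_near. Qed.

Lemma prim0 g : prim g 0 = 0.
Proof. by rewrite primE subrr. Qed.

Lemma prim_cont g : continuous g -> continuous (prim g).
Proof. by move=> cg; apply: (@der_cont _ _ g) => x; exact: prim_der. Qed.

Lemma prim_diff G g a b : continuous g -> (forall x, der G x (g x)) ->
  prim g b - prim g a = G b - G a.
Proof.
move=> cg h.
have : prim g b - G b = prim g a - G a.
  apply: (der_cst_eq (f := fun x => prim g x - G x)) => z.
  apply: (der_eq (derB (prim_der z cg) (h z))) => [y|]//.
  by rewrite subrr.
by lra.
Qed.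

(** The integral over [[-K, K]] as an increment of [prim]. Identities between integrals of
    continuous functions are then proved by differentiating a primitive ([Int_der]), without
    measurability or integrability conditions; [Rint_supp] and [int_supp] return to the Lebesgue
    integral. *)
Definition Int : R -> (R -> R) -> R := locked (fun K phi => prim phi K - prim phi (- K)).

Lemma IntE K phi : Int K phi = prim phi K - prim phi (- K).
Proof. by rewrite /Int -lock. Qed.

Lemma Int_der K G g : continuous g -> (forall x, der G x (g x)) -> Int K g = G K - G (- K).
Proof. by move=> cg h; rewrite IntE; exact: prim_diff. Qed.

Lemma contD f g : continuous f -> continuous g -> continuous (fun x => f x + g x).
Proof. by move=> cf cg x; apply: continuousD; [exact: cf|exact: cg]. Qed.
Lemma contN f : continuous f -> continuous (fun x => - f x).
Proof. by move=> cf x; apply: continuousN; exact: cf. Qed.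
Lemma contB f g : continuous f -> continuous g -> continuous (fun x => f x - g x).
Proof. by move=> cf cg x; apply: continuousB; [exact: cf|exact: cg]. Qed.
Lemma contM f g : continuous f -> continuous g -> continuous (fun x => f x * g x).
Proof. by move=> cf cg x; apply: continuousM; [exact: cf|exact: cg]. Qed.
Lemma cont_cst (c : R) : continuous (fun _ : R => c).
Proof. by move=> x; exact: cvg_cst. Qed.
Lemma cont_id : continuous (fun x : R => x).
Proof. by move=> x. Qed.
Lemma contX f n : continuous f -> continuous (fun x => f x ^+ n).
Proof.
move=> cf; elim: n => [|n IH].
  by rewrite (_ : (fun x => _) = fun=> 1); [exact: cont_cst|apply/funext => x].
by rewrite (_ : (fun x => _) = fun x => f x * f x ^+ n); [exact: contM|apply/funext => x; rewrite exprS].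
Qed.
Lemma cont_comp f g : continuous f -> continuous g -> continuous (fun x => f (g x)).
Proof. by move=> cf cg x; apply: (@continuous_comp _ _ _ g f); [exact: cg|exact: cf]. Qed.
Lemma cont_abs f : continuous f -> continuous (fun x => `|f x|).
Proof. by move=> cf x; apply: (@continuous_comp _ _ _ f (fun x : R => `|x|)); [exact: cf|exact: norm_continuous]. Qed.
Lemma cont_sum I (r : seq I) (P : pred I) (F : I -> R -> R) :
  (forall i, continuous (F i)) -> continuous (fun x => \sum_(i <- r | P i) F i x).
Proof.
move=> h; elim: r => [|i r IH].
  by rewrite (_ : (fun x => _) = fun=> 0); [exact: cont_cst|apply/funext => x; rewrite big_nil].
rewrite (_ : (fun x => _) = fun x => (if P i then F i x else 0) + \sum_(i <- r | P i) F i x).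
  by apply: contD => //; case: (P i); [exact: h|exact: cont_cst].
by apply/funext => x; rewrite big_cons; case: (P i); rewrite ?add0r.
Qed.

(** A copy of continuity, made opaque below, on which the tactic [contt] can recurse by the shape of
    the function alone. *)
Definition cts (f : R -> R) := continuous f.
Lemma ctsP f : cts f -> continuous f. Proof. by []. Qed.
Lemma ctsI f : continuous f -> cts f. Proof. by []. Qed.
Lemma ctsD f g : cts f -> cts g -> cts (fun x => f x + g x). Proof. exact: contD. Qed.
Lemma ctsB f g : cts f -> cts g -> cts (fun x => f x - g x). Proof. exact: contB. Qed.
Lemma ctsM f g : cts f -> cts g -> cts (fun x => f x * g x). Proof. exact: contM. Qed.
Lemma ctsN f : cts f -> cts (fun x => - f x). Proof. exact: contN. Qed.
Lemma ctsX f n : cts f -> cts (fun x => f x ^+ n). Proof. exact: contX. Qed.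
Lemma cts_abs f : cts f -> cts (fun x => `|f x|). Proof. exact: cont_abs. Qed.
Lemma cts_cst (c : R) : cts (fun=> c). Proof. exact: cont_cst. Qed.
Lemma cts_id : cts (fun x => x). Proof. exact: cont_id. Qed.
Lemma cts_prim f : cts f -> cts (prim f). Proof. exact: prim_cont. Qed.
Lemma cts_sum I (r : seq I) (P : pred I) (F : I -> R -> R) :
  (forall i, cts (F i)) -> cts (fun x => \sum_(i <- r | P i) F i x).
Proof. exact: cont_sum. Qed.
Lemma cts_smooth f : smooth f -> cts f. Proof. exact: smooth_cont. Qed.
End Primitive.
Global Opaque cts.

(** A hook that [smt1] falls back on; it is redefined once curves of smooth functions are
    available. *)
Ltac smt_ext := fail.
Ltac smt1 := lazymatch goal with
  | |- smooth (fun y => (@?f y - @?g y)%R) => apply: (@smoothB _ f g)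
  | |- smooth (fun y => (@?f y + @?g y)%R) => apply: (@smoothD _ f g)
  | |- smooth (fun y => (@?f y * @?g y)%R) => apply: (@smoothM _ f g)
  | |- smooth (fun y => (- @?f y)%R) => apply: (@smoothN _ f)
  | |- smooth (fun y => ?f y) => change (smooth f)
  | |- smooth (derive1n _ _) => apply: smooth_derive1n
  | H : smooth ?f |- smooth ?f => exact: H
  | H : forall t, smooth (?u t) |- smooth (?u ?t) => exact: (H t)
  | H : forall t, smooth (?S (?u t)) |- smooth (?S (?u ?t)) => exact: (H t)
  | H : forall t, smooth (?S (derive1n t ?u)) |- smooth (?S (derive1n ?t ?u)) => exact: (H t)
  | |- smooth (fun _ => _) => exact: smooth_cst
  | |- _ => smt_ext
  end.
Ltac smt := repeat smt1.
Ltac cts1 := lazymatch goal with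
  | |- cts (fun y => y) => exact: cts_id
  | |- cts (fun y => (@?f y - @?g y)%R) => apply: (@ctsB _ f g)
  | |- cts (fun y => (@?f y + @?g y)%R) => apply: (@ctsD _ f g)
  | |- cts (fun y => (@?f y * @?g y)%R) => apply: (@ctsM _ f g)
  | |- cts (fun y => (@?f y ^+ ?n)%R) => apply: (@ctsX _ f n)
  | |- cts (fun y => (- @?f y)%R) => apply: (@ctsN _ f)
  | |- cts (fun y => `|@?f y|%R) => apply: (@cts_abs _ f)
  | |- cts (fun y => \sum_(i <- ?r | @?P i) (@?F y i)) => apply: (@cts_sum _ _ r P (fun i y => F y i)) => ?
  | |- cts (fun y => ?f y) => change (cts f)
  | |- cts (prim ?f) => apply: cts_prim
  | H : context [@continuous_at _ _ _ ?f] |- cts ?f => exact: (ctsI H)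
  | H : cts ?f |- cts ?f => exact: H
  | |- cts (fun _ => ?c) => exact: cts_cst
  | |- cts _ => apply: cts_smooth; by smt
  end.
Ltac contt := lazymatch goal with |- cts _ => idtac | |- _ => apply: ctsP end; repeat cts1.

Section Integral.
Context {R : realType}.
Local Notation mu := (@lebesgue_measure R).
Implicit Types (f g u v phi : R -> R) (x y a b : R).

Lemma IntD K f g : continuous f -> continuous g ->
  Int K (fun x => f x + g x) = Int K f + Int K g.
Proof.
move=> cf cg; rewrite (@Int_der _ K (fun x => prim f x + prim g x)).
- by rewrite !IntE; ring.
- exact: contD.
- by move=> x; apply: derD; exact: prim_der.
Qed.

Lemma IntZ K f (c : R) : continuous f -> Int K (fun x => c * f x) = c * Int K f.
Proof.
move=> cf; rewrite (@Int_der _ K (fun x => c * prim f x)).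
- by rewrite !IntE; ring.
- by apply: contM => //; exact: cont_cst.
- by move=> x; apply: derZ; exact: prim_der.
Qed.

Lemma IntN K f : continuous f -> Int K (fun x => - f x) = - Int K f.
Proof.
move=> cf; rewrite -mulN1r -IntZ//; congr Int.
by apply/funext => x; rewrite mulN1r.
Qed.

Lemma IntB K f g : continuous f -> continuous g ->
  Int K (fun x => f x - g x) = Int K f - Int K g.
Proof. by move=> cf cg; rewrite -IntN// -IntD//; exact: contN. Qed.

Lemma Int_cst (K c : R) : Int K (fun=> c) = 2 * K * c.
Proof.
rewrite (@Int_der _ K (fun x => x * c)); first by ring.
  exact: cont_cst.
move=> x; apply: (der_eq (derM (der_id x) (der_cst c x))) => //=.
by rewrite mulr0 mul1r addr0.
Qed.

Lemma Int0 (K : R) : Int K (fun=> 0) = 0.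
Proof. by rewrite Int_cst mulr0. Qed.

Lemma Int_sum K n (F : nat -> R -> R) : (forall i, continuous (F i)) ->
  Int K (fun x => \sum_(i < n) F i x) = \sum_(i < n) Int K (F i).
Proof.
move=> cF; elim: n => [|n IH].
  rewrite big_ord0 (_ : (fun x => _) = fun=> 0) ?Int0//.
  by apply/funext => x; rewrite big_ord0.
rewrite big_ord_recr /= -IH -IntD//; last exact: cont_sum.
by congr Int; apply/funext => x; rewrite big_ord_recr.
Qed.

Lemma prim_mono g a b : continuous g -> a <= b -> (forall x, a <= x <= b -> 0 <= g x) ->
  prim g a <= prim g b.
Proof.
move=> cg ab h; rewrite -lerN2.
apply: (@der_le _ (fun x => - prim g x) (fun x => - g x)) => //.
- by apply: contN; exact: prim_cont.
- by move=> z _; apply: derN; exact: prim_der.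
- by move=> z hz; rewrite oppr_le0 h.
Qed.

Lemma Int_ge0 K f : continuous f -> 0 <= K -> (forall x, `|x| <= K -> 0 <= f x) -> 0 <= Int K f.
Proof.
move=> cf K0 h; rewrite IntE subr_ge0; apply: prim_mono => //; first by lra.
by move=> x hx; apply: h; rewrite ler_norml.
Qed.

Lemma Int_le K f g : continuous f -> continuous g -> 0 <= K ->
  (forall x, `|x| <= K -> f x <= g x) -> Int K f <= Int K g.
Proof.
move=> cf cg K0 h; rewrite -subr_ge0 -IntB//; apply: Int_ge0 => //; first exact: contB.
by move=> x hx; rewrite subr_ge0 h.
Qed.

Lemma Int_abs K f M : continuous f -> 0 <= K -> (forall x, `|x| <= K -> `|f x| <= M) ->
  `|Int K f| <= 2 * K * M.
Proof.
move=> cf K0 h; rewrite ler_norml; apply/andP; split.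
  rewrite -mulrN -Int_cst; apply: Int_le => //; first exact: cont_cst.
  by move=> x /h; rewrite ler_norml => /andP[].
rewrite -Int_cst; apply: Int_le => //; first exact: cont_cst.
by move=> x /h; rewrite ler_norml => /andP[].
Qed.

(* u^2 is the integral of 2 u u' from the left end of the support. *)
Lemma Int_sobolev K u x : smooth u -> supp K u -> 0 <= K ->
  u x ^+ 2 <= Int (K + 1) (fun y => u y ^+ 2) + Int (K + 1) (fun y => derive1n 1 u y ^+ 2).
Proof.
move=> su sK K0.
have cu := smooth_cont su; have cu1 := smooth_continuous (n := 1) su.
have c2 : continuous (fun y => u y ^+ 2 + derive1n 1 u y ^+ 2).
  by apply: contD; apply: contX.
rewrite -IntD; [|exact: contX|exact: contX].
case: (leP `|x| K) => xK; last first.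
  rewrite sK// expr0n; apply: Int_ge0 => // [|y _]; first by lra.
  by rewrite addr_ge0 ?sqr_ge0.
have {}xK : - (K + 1) <= x <= K + 1.
  by move: xK; rewrite ler_norml; lra.
have : u x ^+ 2 - u (- (K + 1)) ^+ 2 <=
    prim (fun y => u y ^+ 2 + derive1n 1 u y ^+ 2) x -
    prim (fun y => u y ^+ 2 + derive1n 1 u y ^+ 2) (- (K + 1)).
  set P := prim _; suff : u x ^+ 2 - P x <= u (- (K + 1)) ^+ 2 - P (- (K + 1)) by lra.
  apply: (@der_le _ (fun y => u y ^+ 2 - P y)
    (fun y => 2 * u y * derive1n 1 u y - (u y ^+ 2 + derive1n 1 u y ^+ 2))).
  - by lra.
  - by apply: contB; [exact: contX|exact: prim_cont].
  - move=> z _; apply: derB; last exact: prim_der.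
    apply: (der_eq (derM (smooth_der0 z su) (smooth_der0 z su))) => [y|].
      by rewrite expr2.
    by ring.
  - by move=> z _; have := sqr_ge0 (u z - derive1n 1 u z); nra.
have -> : u (- (K + 1)) = 0 by apply: sK; rewrite normrN ger0_norm; lra.
rewrite expr0n subr0 => /le_trans; apply; rewrite IntE.
rewrite lerD2r; apply: prim_mono => //; first by lra.
by move=> y _; rewrite addr_ge0 ?sqr_ge0.
Qed.

Lemma Int_parts K f g : smooth f -> smooth g -> f K * g K = f (- K) * g (- K) ->
  Int K (fun x => f x * derive1n 1 g x) = - Int K (fun x => derive1n 1 f x * g x).
Proof.
move=> sf sg e; apply/eqP; rewrite -addr_eq0.
rewrite -IntD; [|by contt|by contt].
rewrite (@Int_der _ K (fun x => f x * g x)) ?e ?subrr//.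
  by contt.
move=> x; rewrite addrC.
exact: derM (smooth_der0 x sf) (smooth_der0 x sg).
Qed.

Lemma Rint_seg f a b : continuous f -> a <= b -> \int[mu]_(x in `[a, b]) f x = prim f b - prim f a.
Proof.
move=> cf ab; set m := Num.min a 0 - 1.
have [m1 m2] : Num.min a 0 <= a /\ Num.min a 0 <= 0 by rewrite !ge_min !lexx orbT.
have m0 : m < 0 by rewrite /m; lra.
have ma : m < a by rewrite /m; lra.
rewrite !(prim_from cf m0)//; last exact: lt_le_trans ab.
rewrite -Rintegral_itv_obnd_cbnd; last first.
  by apply: integrableS (cont_integrable a b cf) => //; exact: subset_itv_oc_cc.
rewrite -(@Rintegral_itvB _ _ (BLeft m) (BRight b) a) ?bnd_simp//; last 2 first.
- exact: cont_integrable.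
- exact: ltW.
by ring.
Qed.

Lemma int_seg f a b : continuous f -> a <= b ->
  (\int[mu]_(x in `[a, b]) (f x)%:E = (prim f b - prim f a)%:E)%E.
Proof.
move=> cf ab; rewrite -Rint_seg//; apply/esym; apply: fineK.
by apply: integrable_fin_num => //; exact: cont_integrable.
Qed.

Lemma supp_restrict K f : supp K f -> f = f \_ `[- K, K].
Proof.
move=> h; apply/funext => x; rewrite patchE.
case: ifPn => // /negP xK; apply: h; rewrite ltNge; apply/negP => hx.
by apply: xK; rewrite inE /= in_itv /= -ler_norml.
Qed.

Lemma supp_integrable K f : continuous f -> supp K f -> mu.-integrable setT (EFin \o f).
Proof.
move=> cf sf; rewrite (supp_restrict sf) -restrict_EFin.
by apply/(integrable_restrict _ _ _) => //=; rewrite setTI; exact: cont_integrable.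
Qed.

Lemma Rint_supp K f : continuous f -> 0 <= K -> supp K f -> \int[mu]_x f x = Int K f.
Proof.
move=> cf K0 sf; rewrite {1}(supp_restrict sf) -Rintegral_mkcond Rint_seg// ?IntE//.
by lra.
Qed.

Lemma int_supp K f : continuous f -> 0 <= K -> supp K f ->
  (\int[mu]_x (f x)%:E = (Int K f)%:E)%E.
Proof.
move=> cf K0 sf; rewrite -(Rint_supp cf)//; apply/esym; apply: fineK.
by apply: integrable_fin_num => //; exact: supp_integrable sf.
Qed.

Lemma smooth_prim f : smooth f -> smooth (prim f).
Proof. by move=> sf; apply: (der_smooth _ sf) => x; exact/prim_der/smooth_cont. Qed.

End Integral.
Global Opaque prim Int.

(** * Curves of smooth functions *)

Section EpsDer.
Context {R : realType}.
Implicit Types (f g : R -> R) (x t : R).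

(** The derivative without a quotient: in this form remainders can be added, and integrated when
    they are uniform in a parameter. *)
Lemma der_eps f x l :
  (forall e : R, 0 < e -> \forall y \near x, `|f y - f x - (y - x) * l| <= e * `|y - x|) <->
  der f x l.
Proof.
split=> [h|hd].
  have hc : (fun y : R => y^-1 *: (f (y *: 1 + x) - f x)) @ (0 : R)^' --> l.
    apply/cvgrPdist_le => e e0.
    have /nbhs_ballP[d /= d0 hd] := h _ e0.
    rewrite near_withinE; apply/nbhs_ballP; exists d => //= y yd y0.
    have := hd (y + x).
    rewrite /ball /= opprD addrCA subrr addr0 addrK => /(_ _).
    move: yd; rewrite /ball /= sub0r => yd /(_ yd).
    move=> hh; rewrite -(ler_pM2r (x := `|y|)) ?normr_gt0//; apply: le_trans hh.
    rewrite -normrM /GRing.scale /= mulr1.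
    by have -> : f (y + x) - f x - y * l = - ((l - y^-1 * (f (y + x) - f x)) * y);
      [field|rewrite normrN].
  apply/der_is_derive; apply: DeriveDef.
    by apply/cvg_ex; exists l; exact: hc.
  by apply/cvg_lim.
move=> e e0.
have hder := der_derivable hd; have hv := der_val hd.
have : (fun y : R => y^-1 *: (f (y *: 1 + x) - f x)) @ (0 : R)^' --> l.
  by rewrite -hv derive1E; exact: hder.
move=> /cvgrPdist_le /(_ _ e0).
rewrite near_withinE => /nbhs_ballP[d /= d0 hn].
apply/nbhs_ballP; exists d => //= y; rewrite /ball /= => yd.
have [->|yx] := eqVneq y x; first by rewrite !subrr mul0r subr0 normr0 mulr0.
have yx0 : y - x != 0 by rewrite subr_eq0.
have := hn (y - x); rewrite /ball /= sub0r normrN distrC => /(_ yd yx0).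
rewrite /GRing.scale /= mulr1 subrK => he.
rewrite [`|x - y|]distrC; apply: le_trans (ler_wpM2r (normr_ge0 (y - x)) he).
have -> : f y - f x - (y - x) * l = - ((l - (y - x)^-1 * (f y - f x)) * (y - x)) by field.
by rewrite normrN normrM.
Qed.

(** A quadratic bound on the remainder is a closed condition with an explicit constant, so it
    survives integration in a parameter and passage to a limit. Derivatives of such integrals and
    limits are obtained in this way below. *)
Lemma der_quad f x l (C : R) :
  (forall y, `|f y - f x - (y - x) * l| <= C * (y - x) ^+ 2) -> der f x l.
Proof.
move=> h; apply/der_eps => e e0.
near=> y.
apply: le_trans (h y) _.
rewrite -[(y - x) ^+ 2]real_normK ?num_real// expr2 mulrA ler_wpM2r//.
apply: (@le_trans _ _ ((`|C| + 1) * `|y - x|)).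
  by rewrite ler_wpM2r// (le_trans (ler_norm C))// lerDl.
have C0 : 0 < `|C| + 1 by rewrite ltr_wpDl.
rewrite mulrC -ler_pdivlMr//.
near: y; apply/nbhs_ballP; exists (e / (`|C| + 1)) => /=; first exact: divr_gt0.
by move=> y /ltW; rewrite distrC.
Unshelve. all: by end_near. Qed.

End EpsDer.

Section Curves.
Context {R : realType}.
Implicit Types (u v w : R -> R -> R) (f g : R -> R) (K L t s x : R).

(* Continuous curves in the space of smooth functions supported in [-K, K]. *)
Definition ccurve K u := [/\ forall t, smooth (u t), forall t, supp K (u t) &
  forall j t (e : R), 0 < e -> \forall s \near t, forall x,
    `|derive1n j (u s) x - derive1n j (u t) x| <= e].

Lemma ccurve_smooth K u t : ccurve K u -> smooth (u t). Proof. by case. Qed.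
Lemma ccurve_supp K u t : ccurve K u -> supp K (u t). Proof. by case. Qed.
Lemma ccurve_near K u j t (e : R) : ccurve K u -> 0 < e -> \forall s \near t, forall x,
    `|derive1n j (u s) x - derive1n j (u t) x| <= e.
Proof. by case=> _ _; apply. Qed.

Arguments ccurve_smooth {K u} t _.
Arguments ccurve_supp {K u} t _.
Arguments ccurve_near {K u} j t {e} _ _.

Ltac smt_ext ::= match goal with
  | H : ccurve _ ?u |- smooth (?u ?t) => exact: (ccurve_smooth t H)
  end.

Lemma ccurve_le K L u : K <= L -> ccurve K u -> ccurve L u.
Proof. by move=> KL [h1 h2 h3]; split => // t; apply: supp_le (h2 t). Qed.

Lemma ccurve_time K u j x : ccurve K u -> continuous (fun s => derive1n j (u s) x).
Proof.
move=> hu t; apply/cvgrPdist_le => e e0.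
have := ccurve_near j t hu e0; apply: filterS => s hs.
by rewrite distrC.
Qed.

Arguments ccurve_time {K u} j x _.

(** The bound is uniform near each time, and [[-T, T]] is compact. *)
Lemma ccurve_bound K u j (T : R) : ccurve K u ->
  exists2 M : R, 0 <= M & forall t, `|t| <= T -> forall x, `|derive1n j (u t) x| <= M.
Proof.
move=> hu.
have /compact_near_coveringP/near_covering_withinP hc := @segment_compact R (- T) T.
have := hc R (pinfty_nbhs R) (fun M t => forall x, `|derive1n j (u t) x| <= M) _.
case=> [t _|M [_ hM]].
  have ct := smooth_continuous (n := j) (ccurve_smooth t hu).
  have [M hM] := cont_supp_bound ct (supp_derive1n j (ccurve_supp t hu)).
  have hn := ccurve_near j t hu ltr01.
  exists ([set s | forall x, `|derive1n j (u s) x - derive1n j (u t) x| <= 1],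
    [set N | M + 1 <= N]).
    split; [exact: hn|by apply: nbhs_pinfty_ge; exact: num_real].
  move=> [s N] /= [hs hN] _ x; apply: le_trans hN.
  by have := hs x; have := hM x; rewrite !ler_norml; lra.
exists (`|M| + 1) => [|t tT x]; first exact: addr_ge0.
apply: hM; first by rewrite (le_lt_trans (ler_norm M))// ltrDl.
by rewrite /= in_itv /= -ler_norml.
Qed.

Lemma ccurve_bounds K u n (T : R) : ccurve K u ->
  exists2 M : R, 0 <= M & forall j t x, (j <= n)%N -> `|t| <= T -> `|derive1n j (u t) x| <= M.
Proof.
move=> hu; elim: n => [|n [M M0 hM]].
  have [M M0 hM] := ccurve_bound 0 T hu; exists M => // j t x; rewrite leqn0 => /eqP -> tT.
  exact: hM.
have [N N0 hN] := ccurve_bound n.+1 T hu; exists (M + N); first exact: addr_ge0.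
move=> j t x; rewrite leq_eqVlt ltnS => /predU1P[->|jn] tT.
  by rewrite (le_trans (hN _ tT x))// lerDr.
by rewrite (le_trans (hM _ _ x jn tT))// lerDl.
Qed.

Lemma ccurve_cst K f : smooth f -> supp K f -> ccurve K (fun=> f).
Proof. by move=> sf kf; split => // j t e e0; near=> s => x; rewrite subrr normr0 ltW.
Unshelve. all: by end_near. Qed.

Lemma ccurve_lin K u v (a b : R) : ccurve K u -> ccurve K v ->
  ccurve K (fun t x => a * u t x + b * v t x).
Proof.
move=> hu hv; split=> [t|t|j t e e0].
- by smt.
- by move=> x hx; rewrite (ccurve_supp t hu) ?(ccurve_supp t hv)// !mulr0 addr0.
pose d := e / (`|a| + `|b| + 1).
have ab : 0 < `|a| + `|b| + 1 by rewrite ltr_wpDl// addr_ge0.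
have d0 : 0 < d by apply: divr_gt0.
have := ccurve_near j t hu d0; have := ccurve_near j t hv d0.
apply: filterS2 => s hs1 hs2 x.
rewrite !derive1n_lin; try by smt.
rewrite opprD addrACA -!mulrBr (le_trans (ler_normD _ _))// !normrM.
have : `|a| * d + `|b| * d <= e.
  by rewrite -mulrDl -[X in _ <= X](divfK (lt0r_neq0 ab)) mulrC ler_wpM2l ?(ltW d0)// lerDl.
apply: le_trans; apply: lerD; exact: ler_wpM2l.
Qed.

Lemma ccurveD K u v : ccurve K u -> ccurve K v -> ccurve K (fun t x => u t x + v t x).
Proof.
move=> hu hv; have := ccurve_lin 1 1 hu hv; congr ccurve.
by apply/funext => t; apply/funext => x; rewrite !mul1r.
Qed.

Lemma ccurveB K u v : ccurve K u -> ccurve K v -> ccurve K (fun t x => u t x - v t x).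
Proof.
move=> hu hv; have := ccurve_lin 1 (-1) hu hv; congr ccurve.
by apply/funext => t; apply/funext => x; rewrite mul1r mulN1r.
Qed.

(** Differentiability in time in all uniform norms, asked at positive times: the solution curves are
    frozen for [t <= 0] and in general have a corner at 0. *)
Definition dcurve u v := forall j t (e : R), 0 < t -> 0 < e -> \forall s \near t, forall x,
  `|derive1n j (u s) x - derive1n j (u t) x - (s - t) * derive1n j (v t) x| <= e * `|s - t|.

Lemma dcurve_lin u v u' v' (a b : R) :
  (forall t, smooth (u t)) -> (forall t, smooth (v t)) ->
  (forall t, smooth (u' t)) -> (forall t, smooth (v' t)) ->
  dcurve u u' -> dcurve v v' ->
  dcurve (fun t x => a * u t x + b * v t x) (fun t x => a * u' t x + b * v' t x).
Proof.
move=> su sv su' sv' hu hv j t e t0 e0.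
pose d := e / (`|a| + `|b| + 1).
have ab : 0 < `|a| + `|b| + 1 by rewrite ltr_wpDl// addr_ge0.
have d0 : 0 < d by apply: divr_gt0.
have := hu j t d t0 d0; have := hv j t d t0 d0.
apply: filterS2 => s hs1 hs2 x.
rewrite !derive1n_lin; try by smt.
set A := (X in `|X| <= _).
have -> : A = a * (derive1n j (u s) x - derive1n j (u t) x - (s - t) * derive1n j (u' t) x) +
  b * (derive1n j (v s) x - derive1n j (v t) x - (s - t) * derive1n j (v' t) x).
  by rewrite /A; ring.
rewrite (le_trans (ler_normD _ _))// !normrM.
have : `|a| * (d * `|s - t|) + `|b| * (d * `|s - t|) <= e * `|s - t|.
  rewrite -mulrDl mulrA ler_wpM2r// -[X in _ <= X](divfK (lt0r_neq0 ab)) mulrC.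
  by rewrite ler_wpM2l ?(ltW d0)// lerDl.
apply: le_trans; apply: lerD; exact: ler_wpM2l.
Qed.

(* Times t <= 0 are sent to 0, so that a curve solving an integrated equation is defined on R. *)
Definition It w t x : R := prim (fun s => w s x) (Num.max 0 t).

Lemma prim_lin f g (a b t : R) : continuous f -> continuous g ->
  prim (fun s => a * f s + b * g s) t = a * prim f t + b * prim g t.
Proof.
move=> cf cg; have h (z : R) : der (fun t => a * prim f t + b * prim g t) z (a * f z + b * g z).
  by apply: derD; apply: derZ; exact: prim_der.
have cc : continuous (fun s => a * f s + b * g s) by contt.
by have := prim_diff 0 t cc h; rewrite !prim0; lra.
Qed.

Lemma prim_le f g t : continuous f -> continuous g -> 0 <= t ->
  (forall s, 0 <= s <= t -> f s <= g s) -> prim f t <= prim g t.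
Proof.
move=> cf cg t0 h.
have cc : continuous (fun s => 1 * g s + -1 * f s) by contt.
have := prim_mono cc t0 _; rewrite !prim0 prim_lin// => hh.
suff : 0 <= 1 * prim g t + -1 * prim f t by lra.
by apply: hh => s /h; lra.
Qed.

Lemma prim_cst (c t : R) : prim (fun=> c) t = t * c.
Proof.
have h (z : R) : der (fun t => t * c) z c.
  by apply: (der_eq (derM (der_id z) (der_cst c z))) => //=; rewrite mulr0 mul1r addr0.
by have := prim_diff 0 t (@cont_cst _ c) h; rewrite !prim0 mul0r; lra.
Qed.

Lemma prim_abs f g t : continuous f -> continuous g -> 0 <= t ->
  (forall s, 0 <= s <= t -> `|f s| <= g s) -> `|prim f t| <= prim g t.
Proof.
move=> cf cg t0 h; rewrite ler_norml; apply/andP; split.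
  have -> : - prim g t = prim (fun s => - g s) t.
    have := prim_lin (-1) 0 t cg cg; rewrite mul0r addr0 mulN1r => <-.
    by congr (prim _ t); apply/funext => s; rewrite mul0r addr0 mulN1r.
  by apply: prim_le => //; [contt|move=> s /h; rewrite ler_norml => /andP[]].
by apply: prim_le => // s /h; rewrite ler_norml => /andP[].
Qed.

Lemma prim_abs_cst f t (M : R) : continuous f -> 0 <= t ->
  (forall s, 0 <= s <= t -> `|f s| <= M) -> `|prim f t| <= t * M.
Proof. by move=> cf t0 h; rewrite -prim_cst; apply: prim_abs => //; contt. Qed.

Lemma max0_ge t : 0 <= Num.max 0 t. Proof. by rewrite le_max lexx. Qed.
Lemma max0E t : 0 <= t -> Num.max 0 t = t. Proof. exact: max_r. Qed.

(** Differentiation under the integral sign. The Taylor remainder of each [w s] is at most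
    [M (y - x)^2] with [M] independent of [s], and this bound is integrated in time. *)
Lemma It_der K w j t x : ccurve K w ->
  der (fun x => prim (fun s => derive1n j (w s) x) (Num.max 0 t)) x
    (prim (fun s => derive1n j.+1 (w s) x) (Num.max 0 t)).
Proof.
move=> hw; set T := Num.max 0 t; have T0 : 0 <= T := max0_ge t.
have [M M0 hM] := ccurve_bound j.+2 T hw.
have ct i y : continuous (fun s => derive1n i (w s) y) by exact: ccurve_time hw.
apply: (@der_quad _ _ _ _ (T * M)) => y.
have := prim_lin 1 (-1) T (ct j y) (ct j x).
have c2 : continuous (fun s => 1 * derive1n j (w s) y + -1 * derive1n j (w s) x).
  by have := ct j x; have := ct j y => ? ?; contt.
move=> e1; have := prim_lin 1 (- (y - x)) T c2 (ct j.+1 x); rewrite e1 => e2.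
rewrite (_ : _ - _ - _ = prim (fun s => 1 * (1 * derive1n j (w s) y + -1 * derive1n j (w s) x) +
   - (y - x) * derive1n j.+1 (w s) x) T); last by rewrite e2; ring.
rewrite -mulrA; apply: prim_abs_cst => //.
  by have h1 := ct j.+1 x; have h2 := ct j x; have h3 := ct j y; contt.
move=> s hs.
rewrite (_ : _ + _ = derive1n j (w s) y - derive1n j (w s) x - (y - x) * derive1n j.+1 (w s) x);
  last by ring.
have sw := ccurve_smooth s hw.
apply: (@der_taylor _ _ (derive1n j.+1 (w s)) (derive1n j.+2 (w s))) => z; try exact: smooth_der.
by apply: hM; rewrite ger0_norm; lra.
Qed.

Lemma It_smooth K w t : ccurve K w -> smooth (It w t).
Proof.
move=> hw.
exact: (family_smooth (F := fun j x => prim (fun s => derive1n j (w s) x) (Num.max 0 t))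
  (fun j x => It_der j t x hw)).
Qed.

Lemma derive1n_It K w j t : ccurve K w ->
  derive1n j (It w t) = It (fun s => derive1n j (w s)) t.
Proof.
move=> hw.
exact: (family_derive1n j (F := fun j x => prim (fun s => derive1n j (w s) x) (Num.max 0 t))
  (fun j x => It_der j t x hw)).
Qed.

Lemma It_le0 w t : t <= 0 -> It w t = fun=> 0.
Proof. by move=> t0; apply/funext => x; rewrite /It max_l// prim0. Qed.

Lemma It_mvt K w j s t x : ccurve K w -> 0 <= s -> 0 <= t -> exists2 z,
  Num.min t s <= z <= Num.max t s &
  derive1n j (It w s) x - derive1n j (It w t) x = (s - t) * derive1n j (w z) x.
Proof.
move=> hw s0 t0; rewrite !(derive1n_It _ _ hw) /It !max0E//.
have ct := ccurve_time j x hw.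
have [z hz ->] := mvt_der t s (fun z => prim_der z ct).
by exists z => //; rewrite mulrC.
Qed.

(** For each [x] the mean value theorem gives an intermediate time depending on [x]; the continuity
    of [w], uniform in [x], absorbs this dependence. Restricting to [0 <= s] yields the one-sided
    derivative at [t = 0]. *)
Lemma It_dt K w j t (e : R) : ccurve K w -> 0 <= t -> 0 < e ->
  \forall s \near t, 0 <= s -> forall x,
  `|derive1n j (It w s) x - derive1n j (It w t) x - (s - t) * derive1n j (w t) x| <= e * `|s - t|.
Proof.
move=> hw t0 e0; have /nbhs_ballP[d /= d0 hd] := ccurve_near j t hw e0.
apply/nbhs_ballP; exists d => //= s sd s0 x.
have [z hz ->] := It_mvt j x hw s0 t0.
rewrite -mulrBr normrM mulrC ler_wpM2r//; apply: hd.
move: sd hz; rewrite /ball /=; case: (leP t s) => ts;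
  rewrite ?ltr_norml; by lra.
Qed.

Lemma It_ccurve K w : ccurve K w -> ccurve K (It w).
Proof.
move=> hw; split=> [t|t x Kx|j t e e0].
- exact: It_smooth hw.
- rewrite /It (_ : (fun s => _) = fun=> 0) ?prim_cst ?mulr0//.
  by apply/funext => s; exact: (ccurve_supp s hw).
have [M M0 hM] := ccurve_bound j (`|t| + 1) hw.
have M1 : 0 < M + 1 by rewrite ltr_wpDl.
apply/nbhs_ballP; exists (Num.min 1 (e / (M + 1))) => /=.
  by rewrite lt_min ltr01 divr_gt0.
move=> s; rewrite /ball /= lt_min => /andP[st1 st2] x.
rewrite !(derive1n_It _ _ hw) /It.
have ct := ccurve_time j x hw.
have [z hz ->] := mvt_der (Num.max 0 t) (Num.max 0 s) (fun z => prim_der z ct).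
have mm : `|Num.max 0 s - Num.max 0 t| <= `|s - t|.
  have l1 := ler_norm (s - t); have l2 := ler_norm (t - s); rewrite distrC in l2.
  by case: (leP 0 s); case: (leP 0 t) => h1 h2; rewrite ler_norml; apply/andP; split; lra.
rewrite normrM.
apply: (@le_trans _ _ (M * (e / (M + 1)))).
  apply: ler_pM => //; last by rewrite (le_trans mm)// distrC ltW.
  apply: hM; move: hz st1; have := max0_ge s; have := max0_ge t.
  have : Num.max 0 s <= `|s| by rewrite ge_max normr_ge0 ler_norm.
  have : Num.max 0 t <= `|t| by rewrite ge_max normr_ge0 ler_norm.
  move=> h1 h2 h3 h4 h5 h6.
  have h7 : `|s| <= `|t| + 1.
    by have := ler_normB t (t - s); rewrite opprB addrC subrK; lra.
  move: h1 h2 h3 h4 h5; set A := Num.max 0 t; set B := Num.max 0 s => h1 h2 h3 h4 h5.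
  have [z0 zAB] : 0 <= z /\ (z <= A \/ z <= B).
    move: h5; case: (leP A B) => AB /andP[u1 u2]; split; try lra; by [left|right].
  by rewrite ger0_norm//; case: zAB; lra.
by rewrite mulrCA ger_pMr// ler_pdivrMr// mul1r lerDl.
Qed.

Lemma dcurve_It K w g : smooth g -> ccurve K w ->
  dcurve (fun t x => g x + It w t x) w.
Proof.
move=> sg hw j t e t0 e0.
have h1 := It_dt j hw (ltW t0) e0.
near=> s => x.
have s0 : 0 <= s by apply: ltW; near: s; exact: lt_nbhsr.
have sI r : smooth (It w r) by exact: It_smooth hw.
rewrite (derive1n_D j sg (sI s)) (derive1n_D j sg (sI t)).
rewrite opprD addrACA subrr add0r; move: x; move: s0; near: s; exact: h1.
Unshelve. all: by end_near. Qed.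

Lemma ccurve_It K w g : smooth g -> supp K g -> ccurve K w ->
  ccurve K (fun t x => g x + It w t x).
Proof. by move=> sg kg hw; apply: ccurveD; [exact: ccurve_cst|exact: It_ccurve]. Qed.

End Curves.
Ltac smt_ext ::= match goal with
  | H : ccurve _ ?u |- smooth (?u ?t) => exact: (ccurve_smooth t H)
  end.

Arguments ccurve_smooth {R K u} t _.
Arguments ccurve_supp {R K u} t _.
Arguments ccurve_near {R K u} j t {e} _ _.
Arguments ccurve_time {R K u} j x _.

(** * Bounded operators, averaging, Volterra equations *)

Section Operators.
Context {R : realType}.
Implicit Types (u v w : R -> R -> R) (f g c : R -> R) (K L t s x : R) (P Q : (R -> R) -> R -> R).

(* Linear operators from functions supported in [-K, K] to functions supported in [-L, L] that
   lose at most d derivatives in the uniform norms. *)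
Definition bop K L d P := [/\
  forall f, smooth f -> supp K f -> smooth (P f),
  forall f, smooth f -> supp K f -> supp L (P f),
  forall f g (a b : R), smooth f -> supp K f -> smooth g -> supp K g ->
    P (fun x => a * f x + b * g x) = (fun x => a * P f x + b * P g x) &
  forall j, exists2 C : R, 0 <= C & forall f (M : R), smooth f -> supp K f ->
    (forall i x, (i <= j + d)%N -> `|derive1n i f x| <= M) ->
    forall x, `|derive1n j (P f) x| <= C * M].

Lemma supp_lin K f g (a b : R) : supp K f -> supp K g -> supp K (fun x => a * f x + b * g x).
Proof. by move=> h k x hx; rewrite h// k// !mulr0 addr0. Qed.

Lemma bop_ccurve K L d P u : bop K L d P -> ccurve K u -> ccurve L (fun t => P (u t)).
Proof.
move=> [h1 h2 h3 h4] hu; have su t := ccurve_smooth t hu; have ku t := ccurve_supp t hu.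
split=> [t|t|j t e e0]; [exact: h1|exact: h2|].
have [C C0 hC] := h4 j; have C1 : 0 < C + 1 by rewrite ltr_wpDl.
have e1 : 0 < e / (C + 1) by exact: divr_gt0.
have : \forall s \near t, forall i x, (i <= j + d)%N ->
    `|derive1n i (u s) x - derive1n i (u t) x| <= e / (C + 1).
  elim: (j + d)%N => [|n IH].
    have := ccurve_near 0 t hu e1; apply: filterS => s hs i x.
    by rewrite leqn0 => /eqP ->.
  have := ccurve_near n.+1 t hu e1; move: IH; apply: filterS2 => s hs1 hs2 i x.
  by rewrite leq_eqVlt ltnS => /predU1P[->|]; [exact: hs2|exact: hs1].
apply: filterS => s hs x.
have sP r : smooth (P (u r)) by exact: h1.
have -> : derive1n j (P (u s)) x - derive1n j (P (u t)) x =
    derive1n j (P (fun x => 1 * u s x + -1 * u t x)) x.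
  rewrite (h3 _ _ 1 (-1) (su s) (ku s) (su t) (ku t)) (derive1n_lin 1 (-1) j (sP s) (sP t)).
  by rewrite mul1r mulN1r.
apply: le_trans (hC _ (e / (C + 1)) _ _ _ x) _.
- by smt.
- by apply: supp_lin.
- by move=> i y ij; rewrite (derive1n_lin 1 (-1) i (su s) (su t)) mul1r mulN1r; exact: hs.
by rewrite mulrCA ger_pMr// ler_pdivrMr// mul1r lerDl.
Qed.

Lemma bop_dcurve K L d P u v : bop K L d P -> ccurve K u -> ccurve K v -> dcurve u v ->
  dcurve (fun t => P (u t)) (fun t => P (v t)).
Proof.
move=> [h1 h2 h3 h4] hu hv huv.
have su t := ccurve_smooth t hu; have ku t := ccurve_supp t hu.
have sv t := ccurve_smooth t hv; have kv t := ccurve_supp t hv.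
move=> j t e t0 e0.
have [C C0 hC] := h4 j; have C1 : 0 < C + 1 by rewrite ltr_wpDl.
have e1 : 0 < e / (C + 1) by exact: divr_gt0.
have : \forall s \near t, forall i x, (i <= j + d)%N ->
    `|derive1n i (u s) x - derive1n i (u t) x - (s - t) * derive1n i (v t) x| <=
      e / (C + 1) * `|s - t|.
  elim: (j + d)%N => [|n IH].
    have := huv 0 t _ t0 e1; apply: filterS => s hs i x.
    by rewrite leqn0 => /eqP ->.
  have := huv n.+1 t _ t0 e1; move: IH; apply: filterS2 => s hs1 hs2 i x.
  by rewrite leq_eqVlt ltnS => /predU1P[->|]; [exact: hs2|exact: hs1].
apply: filterS => s hs x.
have sP r : smooth (P (u r)) by exact: h1.
have sPv r : smooth (P (v r)) by exact: h1.
pose q := fun x => 1 * u s x + -1 * u t x.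
have sq : smooth q by apply: smooth_lin.
have kq : supp K q by apply: supp_lin.
have -> : derive1n j (P (u s)) x - derive1n j (P (u t)) x - (s - t) * derive1n j (P (v t)) x =
    derive1n j (P (fun x => 1 * q x + - (s - t) * v t x)) x.
  rewrite (h3 _ _ 1 (- (s - t)) sq kq (sv t) (kv t)).
  rewrite (derive1n_lin 1 (- (s - t)) j (h1 _ sq kq) (sPv t)).
  rewrite (h3 _ _ 1 (-1) (su s) (ku s) (su t) (ku t)) (derive1n_lin 1 (-1) j (sP s) (sP t)).
  by ring.
apply: le_trans (hC _ (e / (C + 1) * `|s - t|) _ _ _ x) _.
- by smt.
- by apply: supp_lin.
- move=> i y ij; rewrite (derive1n_lin 1 (- (s - t)) i sq (sv t)).
  rewrite (derive1n_lin 1 (-1) i (su s) (su t)).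
  have := hs i y ij; congr (`|_| <= _); ring.
by rewrite mulrA ler_wpM2r// mulrCA ger_pMr// ler_pdivrMr// mul1r lerDl.
Qed.

Lemma bop_comp K L N d d' P Q : bop K L d P -> bop L N d' Q ->
  bop K N (d' + d) (fun f => Q (P f)).
Proof.
move=> [h1 h2 h3 h4] [k1 k2 k3 k4]; split.
- by move=> f sf kf; apply: k1; [exact: h1|exact: h2].
- by move=> f sf kf; apply: k2; [exact: h1|exact: h2].
- move=> f g a b sf kf sg kg; rewrite (h3 _ _ a b sf kf sg kg).
  exact: k3 (h1 _ sf kf) (h2 _ sf kf) (h1 _ sg kg) (h2 _ sg kg).
move=> j; have [C C0 hC] := k4 j.
have : exists2 B : R, 0 <= B & forall i f (M : R), (i <= j + d')%N -> smooth f -> supp K f ->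
    (forall i x, (i <= j + (d' + d))%N -> `|derive1n i f x| <= M) ->
    forall x, `|derive1n i (P f) x| <= B * M.
  rewrite addnA; elim: (j + d')%N => [|n [B B0 hB]].
    have [B B0 hB] := h4 0; exists B => // i f M; rewrite leqn0 => /eqP ->.
    exact: hB.
  have [B1 B10 hB1] := h4 n.+1; exists (B + B1); first exact: addr_ge0.
  move=> i f M; rewrite leq_eqVlt ltnS => /predU1P[->|sn] sf kf hf x.
    rewrite (le_trans (hB1 f M sf kf hf x))// ler_wpM2r ?lerDr//.
    exact: le_trans (normr_ge0 _) (hf 0%N 0 isT).
  have hf' i' y : (i' <= n + d)%N -> `|derive1n i' f y| <= M.
    by move=> h; apply: hf; rewrite (leq_trans h)// leq_add2r.
  rewrite (le_trans (hB i f M sn sf kf hf' x))// ler_wpM2r ?lerDl//.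
  exact: le_trans (normr_ge0 _) (hf 0%N 0 isT).
move=> [B B0 hB]; exists (C * B); first exact: mulr_ge0.
move=> f M sf kf hf x; rewrite -mulrA; apply: hC; [exact: h1|exact: h2|].
by move=> i y ij; apply: hB.
Qed.

Lemma bop_lin K L d P Q (a b : R) : bop K L d P -> bop K L d Q ->
  bop K L d (fun f x => a * P f x + b * Q f x).
Proof.
move=> [h1 h2 h3 h4] [k1 k2 k3 k4]; split.
- by move=> f sf kf; apply: smooth_lin; [exact: h1|exact: k1].
- by move=> f sf kf; apply: supp_lin; [exact: h2|exact: k2].
- move=> f g a' b' sf kf sg kg; apply/funext => x.
  by rewrite (h3 _ _ a' b' sf kf sg kg) (k3 _ _ a' b' sf kf sg kg); ring.
move=> j; have [C C0 hC] := h4 j; have [B B0 hB] := k4 j.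
exists (`|a| * C + `|b| * B); first by rewrite addr_ge0// mulr_ge0.
move=> f M sf kf hf x.
rewrite (derive1n_lin a b j (h1 _ sf kf) (k1 _ sf kf)).
rewrite (le_trans (ler_normD _ _))// !normrM mulrDl -!mulrA.
by apply: lerD; apply: ler_wpM2l => //; [exact: hC|exact: hB].
Qed.

Lemma bop_sub K K' L L' d d' P : K' <= K -> L <= L' -> (d <= d')%N -> bop K L d P -> bop K' L' d' P.
Proof.
move=> KK LL dd [h1 h2 h3 h4].
have kk f : supp K' f -> supp K f by exact: supp_le.
split.
- by move=> f sf kf; exact: h1 sf (kk _ kf).
- by move=> f sf kf; apply: supp_le (h2 _ sf (kk _ kf)).
- by move=> f g a' b' sf kf sg kg; exact: h3 sf (kk _ kf) sg (kk _ kg).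
move=> j; have [C C0 hC] := h4 j; exists C => // f M sf kf hf.
apply: hC sf (kk _ kf) _.
by move=> i x ij; apply: hf; rewrite (leq_trans ij)// leq_add2l.
Qed.

Lemma bop_id K : bop K K 0 (fun f => f).
Proof.
split=> // j; exists 1 => // f M sf kf hf x; rewrite mul1r; apply: hf.
by rewrite addn0.
Qed.

Lemma bop_D K : bop K K 1 (derive1n 1).
Proof.
split.
- by move=> f sf _; smt.
- by move=> f sf kf; exact: supp_derive1n.
- by move=> f g a b sf kf sg kg; exact: derive1n_lin.
move=> j; exists 1 => // f M sf kf hf x; rewrite mul1r derive1nD; exact: hf.
Qed.

Lemma seg_bounds c n K : smooth c -> exists2 M : R, 0 <= M &
  forall j x, (j <= n)%N -> `|x| <= K -> `|derive1n j c x| <= M.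
Proof.
move=> sc; elim: n => [|n [M M0 hM]].
  have [M hM] := cont_seg_bound K (smooth_cont sc).
  exists `|M| => // j x; rewrite leqn0 => /eqP -> xK.
  by rewrite (le_trans (hM x xK))// ler_norm.
have [N hN] := cont_seg_bound K (smooth_continuous (n := n.+1) sc).
exists (M + `|N|); first exact: addr_ge0.
move=> j x; rewrite leq_eqVlt ltnS => /predU1P[->|jn] xK.
  by rewrite (le_trans (hN _ xK))// (le_trans (ler_norm N))// lerDr.
by rewrite (le_trans (hM _ _ jn xK))// lerDl.
Qed.

Lemma leib_bound (B M : R) f g n x :
  (forall i, (i <= n)%N -> `|derive1n i f x| <= B) ->
  (forall i, (i <= n)%N -> `|derive1n i g x| <= M) ->
  `|leib f g n x| <= 2 ^+ n * (B * M).
Proof.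
move=> hf hg.
apply: (@le_trans _ _ (\sum_(i < n.+1) 'C(n, i)%:R * (B * M))).
  rewrite /leib (le_trans (ler_norm_sum _ _ _))//; apply: ler_sum => i _.
  rewrite normrM ger0_norm// ler_wpM2l// normrM.
  by apply: ler_pM => //; [apply: hf; rewrite -ltnS|apply: hg; exact: leq_subr].
rewrite -mulr_suml -natr_sum le_eqVlt; apply/orP; left; apply/eqP.
have e := expnDn 1 1 n; rewrite [in (1 + 1)%N]addn1 in e.
have -> : (2 : R) ^+ n = ((2 ^ n)%N)%:R by rewrite natrX.
by rewrite e; congr ((_%:R) * _); apply: eq_bigr => i _; rewrite !exp1n !muln1.
Qed.

(** The function [c] may be unbounded: only its values on [[-K, K]] meet the support of [f]. *)
Lemma bop_mul K c : smooth c -> bop K K 0 (fun f x => c x * f x).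
Proof.
move=> sc; split.
- by move=> f sf _; exact: smoothM.
- by move=> f sf kf; exact: suppM.
- by move=> f g a b sf kf sg kg; apply/funext => x; ring.
move=> j; have [B B0 hB] := seg_bounds j K sc.
exists (2 ^+ j * B); first by rewrite mulr_ge0// exprn_ge0.
move=> f M sf kf hf x.
have M0 : 0 <= M by exact: le_trans (normr_ge0 _) (hf 0%N 0 isT).
case: (leP `|x| K) => xK; last first.
  rewrite (supp_derive1n (K := K))// ?normr0 ?mulr_ge0// ?exprn_ge0//.
  exact: suppM.
rewrite (derive1nM j sc sf) -mulrA; apply: leib_bound => i ij; first exact: hB.
by apply: hf; rewrite addn0.
Qed.

(** A compactly supported coefficient brings any support back into [[-L, L]]. This undoes the
    widening caused by averaging and lets the regularized operator act on one fixed space, as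
    iteration requires. *)
Lemma bop_mulK K L c : smooth c -> supp L c -> bop K L 0 (fun f x => c x * f x).
Proof.
move=> sc kc; have [h1 _ h3 h4] := bop_mul K sc; split => //.
by move=> f sf kf x xL; rewrite kc// mul0r.
Qed.

Lemma bop0 P K L d : bop K L d P -> P (fun=> 0) = (fun=> 0).
Proof.
move=> [_ _ h3 _]; have := h3 (fun=> 0) (fun=> 0) 0 0 (@smooth_cst _ 0) (fun _ _ => erefl)
  (@smooth_cst _ 0) (fun _ _ => erefl).
rewrite (_ : (fun x => _) = fun=> 0) => [->|]; first by apply/funext => x; rewrite !mul0r addr0.
by apply/funext => x; rewrite !mul0r addr0.
Qed.

End Operators.

(** * The box average *)

Section Averaging.
Context {R : realType}.
Implicit Types (f g v w : R -> R) (h K L x y : R).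

(** The mean over [[x - h, x + h]], a convolution with a box expressed through a primitive. The
    factor [1 *] gives the arguments the shape [s * x + h] of [der_aff] and [smooth_aff]. *)
Definition avg h v : R -> R :=
  fun x => (2 * h)^-1 * (prim v (1 * x + h) - prim v (1 * x + - h)).

Lemma avg_der h v x : continuous v ->
  der (avg h v) x ((2 * h)^-1 * (v (1 * x + h) - v (1 * x + - h))).
Proof.
move=> cv; apply: derZ; apply: derB.
- by have := der_aff (prim_der (1 * x + h) cv); rewrite mul1r.
- by have := der_aff (prim_der (1 * x + - h) cv); rewrite mul1r.
Qed.

Lemma avg_derive1 h v : continuous v ->
  derive1n 1 (avg h v) = fun x => (2 * h)^-1 * (v (1 * x + h) - v (1 * x + - h)).
Proof. by move=> cv; apply: derive1n1E => x; exact: avg_der. Qed.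

Lemma avg_derive1' h v : smooth v -> derive1n 1 (avg h v) = avg h (derive1n 1 v).
Proof.
move=> sv; rewrite avg_derive1; last exact: smooth_cont.
apply/funext => x; rewrite /avg; congr (_ * _); apply/esym.
by apply: prim_diff; [exact: smooth_continuous|move=> z; exact: smooth_der0].
Qed.

Lemma smooth_avg h v : smooth v -> smooth (avg h v).
Proof.
move=> sv; apply: smoothZ; apply: smoothB; apply: smooth_aff; exact: smooth_prim.
Qed.

Arguments smooth_avg h [v] _.

Lemma derive1n_avg h v j : smooth v -> derive1n j (avg h v) = avg h (derive1n j v).
Proof.
move=> sv; elim: j => // j IH.
have -> : derive1n j.+1 (avg h v) = derive1n 1 (derive1n j (avg h v)) by rewrite derive1nD.
rewrite IH avg_derive1'; last by smt.
by rewrite derive1nD.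
Qed.

(** An average is a value at a nearby point; bounds, supports and the averaging error all follow
    from this. *)
Lemma avg_mean h v x : 0 < h -> continuous v ->
  exists2 z : R, x - h <= z <= x + h & avg h v x = v z.
Proof.
move=> h0 cv.
have xh : x - h <= x + h by lra.
have [z hz e] := mvt xh (fun z _ => prim_der z cv) (prim_cont cv).
exists z => //; rewrite /avg mul1r e.
by field; rewrite lt0r_neq0.
Qed.

Lemma supp_avg h K v : 0 < h -> continuous v -> supp K v -> supp (K + h) (avg h v).
Proof.
move=> h0 cv kv x hx; have [z hz ->] := avg_mean x h0 cv; apply: kv.
move: hx; rewrite !ltNge; apply: contra; rewrite !ler_norml => /andP[? ?].
by apply/andP; split; lra.
Qed.

Lemma avg_bound h v (M : R) x : 0 < h -> continuous v -> (forall y, `|v y| <= M) ->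
  `|avg h v x| <= M.
Proof. by move=> h0 cv hM; have [z _ ->] := avg_mean x h0 cv. Qed.

Lemma avg_lin h f g (a b : R) : continuous f -> continuous g ->
  avg h (fun x => a * f x + b * g x) = fun x => a * avg h f x + b * avg h g x.
Proof. by move=> cf cg; apply/funext => x; rewrite /avg !prim_lin//; ring. Qed.

Lemma avg_cst h (c : R) x : 0 < h -> avg h (fun=> c) x = c.
Proof. by move=> h0; have [z _ ->] := avg_mean x h0 (@cont_cst _ c). Qed.

Lemma bop_avg h K : 0 < h -> bop K (K + h) 0 (avg h).
Proof.
move=> h0; split.
- by move=> f sf _; exact: smooth_avg.
- by move=> f sf kf; apply: supp_avg => //; exact: smooth_cont.
- by move=> f g a b sf _ sg _; apply: avg_lin; exact: smooth_cont.
move=> j; exists 1 => // f M sf kf hf x; rewrite mul1r (derive1n_avg _ _ sf).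
apply: avg_bound => //; first exact: smooth_continuous.
by move=> y; apply: hf; rewrite addn0.
Qed.

(** The derivative of an average is a difference quotient: it costs no derivative of [f], at the
    price of the factor [h^-1]. *)
Lemma bop_avgD h K : 0 < h -> bop K (K + h) 0 (fun f => derive1n 1 (avg h f)).
Proof.
move=> h0; have [b1 b2 b3 _] := bop_comp (bop_avg K h0) (bop_D (K + h)).
split => // j; exists h^-1 => [|f M sf kf hf x]; first by rewrite invr_ge0 ltW.
rewrite derive1nD addnC -derive1nD (derive1n_avg _ _ sf).
rewrite avg_derive1; last exact: smooth_continuous.
rewrite normrM ger0_norm; last by rewrite invr_ge0; lra.
rewrite invfM -mulrA mulrCA ler_wpM2l//; first by rewrite invr_ge0 ltW.
rewrite ler_pdivrMl//.
have h1 := hf j (1 * x + h); have h2 := hf j (1 * x - h).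
rewrite (le_trans (ler_normB _ _))//.
by have := h1 _; have := h2 _; rewrite addn0 leqnn => /(_ isT) ? /(_ isT) ?; lra.
Qed.

Lemma avg_error h v (M : R) x : 0 < h -> smooth v -> (forall y, `|derive1n 1 v y| <= M) ->
  `|avg h v x - v x| <= h * M.
Proof.
move=> h0 sv hM; have [z hz ->] := avg_mean x h0 (smooth_cont sv).
apply: le_trans (der_bound x z (fun y => smooth_der0 y sv) hM) _.
rewrite mulrC ler_wpM2r//; first exact: le_trans (hM 0).
by rewrite ler_norml; apply/andP; split; lra.
Qed.

Lemma cont_shift f (c : R) : continuous f -> continuous (fun x => f (1 * x + c)).
Proof.
move=> cf; have ci : continuous (fun x : R => 1 * x + c) by contt.
exact: (cont_comp cf ci).
Qed.

Arguments cont_shift [f] c _.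

Lemma Int_shift f h K L : continuous f -> supp K f -> 0 <= K -> K + `|h| < L ->
  Int L (fun x => f (1 * x + h)) = Int L f.
Proof.
move=> cf kf K0 KL.
have c1 : continuous (fun x => f (1 * x + h)) by exact: cont_shift.
rewrite (Int_der L (G := fun x => prim f (1 * x + h)) c1); last first.
  by move=> x; have := der_aff (prim_der (1 * x + h) cf); rewrite mul1r.
have flat y : (forall z, Num.min y (y + h) <= z <= Num.max y (y + h) -> f z = 0) ->
    prim f (1 * y + h) = prim f y.
  move=> hz; have [z z1 e] := mvt_der y (y + h) (fun z => prim_der z cf).
  by rewrite hz// mul0r in e; rewrite mul1r; apply/eqP; rewrite -subr_eq0 e.
rewrite !flat ?IntE//; last first.
  move=> z; have := ler_norm h; have := ler_norm (- h); rewrite normrN => h1 h2.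
  case: (leP L (L + h)) => h4 h3; apply: kf; rewrite ltr_normr; apply/orP; left; lra.
move=> z; have := ler_norm h; have := ler_norm (- h); rewrite normrN => h1 h2.
by case: (leP (- L) (- L + h)) => h4 h3; apply: kf; rewrite ltr_normr; apply/orP; right; lra.
Qed.

(** Self-adjointness without a double integral. With [w] the derivative of [prim w], integration by
    parts turns [avg h v] into a difference of translates of [v]; moving the translations onto
    [prim w] leaves the average of [w]. *)
Lemma Int_avg h K L v w : 0 < h -> 0 <= K -> smooth v -> supp K v -> smooth w -> K + h < L ->
  Int L (fun x => avg h v x * w x) = Int L (fun x => v x * avg h w x).
Proof.
move=> h0 K0 sv kv sw KL.
have L0 : K < `|L| by rewrite ger0_norm; lra.
have sW := smooth_prim sw; have sav := smooth_avg h sv.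
have kav := supp_avg h0 (smooth_cont sv) kv.
have cw := smooth_cont sw.
have wE : derive1n 1 (prim w) = w by apply: derive1n1E => x; exact: prim_der.
have cv := smooth_cont sv; have cW := smooth_cont sW.
have := Int_parts (K := L) sav sW; rewrite wE => ->; last first.
  by rewrite !kav ?mul0r// ?normrN ger0_norm; lra.
rewrite avg_derive1//.
have c1 := cont_shift h cv; have c2 := cont_shift (- h) cv.
have c3 := cont_shift h cW; have c4 := cont_shift (- h) cW.
have e1 : Int L (fun x => v (1 * x + h) * prim w x) = Int L (fun x => v x * prim w (1 * x + - h)).
  rewrite -(@Int_shift (fun x => v x * prim w (1 * x + - h)) h K L) //; last 3 first.
  - by contt.
  - by move=> x hx; rewrite kv// mul0r.
  - by rewrite gtr0_norm.
  by congr Int; apply/funext => x; rewrite !mul1r addrK.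
have e2 : Int L (fun x => v (1 * x + - h) * prim w x) = Int L (fun x => v x * prim w (1 * x + h)).
  rewrite -(@Int_shift (fun x => v x * prim w (1 * x + h)) (- h) K L) //; last 3 first.
  - by contt.
  - by move=> x hx; rewrite kv// mul0r.
  - by rewrite normrN gtr0_norm.
  by congr Int; apply/funext => x; rewrite !mul1r subrK.
rewrite -IntN; last by contt.
rewrite (_ : (fun x => - _) = fun x => (2 * h)^-1 * (v (1 * x + - h) * prim w x) -
   (2 * h)^-1 * (v (1 * x + h) * prim w x)); last by apply/funext => x; ring.
rewrite (_ : (fun x => v x * _) = fun x => (2 * h)^-1 * (v x * prim w (1 * x + h)) -
   (2 * h)^-1 * (v x * prim w (1 * x + - h))); last by apply/funext => x; rewrite /avg; ring.
by rewrite !IntB ?IntZ ?e1 ?e2//; contt.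
Qed.

(** Non-negativity of a variance: the average of [(v - c)^2], with [c] the average of [v], is itself
    a value of that function. *)
Lemma avg_sqr h v x : 0 < h -> continuous v -> avg h v x ^+ 2 <= avg h (fun y => v y ^+ 2) x.
Proof.
move=> h0 cv; set c := avg h v x.
have c2 : continuous (fun y => v y ^+ 2) by contt.
have ce : continuous (fun y => 1 * (1 * v y ^+ 2 + (- (2 * c)) * v y) + 1 * c ^+ 2) by contt.
have c3 : continuous (fun y => 1 * v y ^+ 2 + (- (2 * c)) * v y) by contt.
have [z _ e] := avg_mean x h0 ce; move: e.
rewrite avg_lin// ?avg_lin ?avg_cst//; last exact: cont_cst.
rewrite -/c => e.
have : 0 <= (v z - c) ^+ 2 by exact: sqr_ge0.
nra.
Qed.

(** The inequality holds pointwise up to averaging [v^2]; self-adjointness moves that average onto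
    the constant 1, which it fixes. *)
Lemma Int_avg_sqr h K L v : 0 < h -> 0 <= K -> smooth v -> supp K v -> K + h < L ->
  Int L (fun x => avg h v x ^+ 2) <= Int L (fun x => v x ^+ 2).
Proof.
move=> h0 K0 sv kv KL.
have sv2 : smooth (fun x => v x ^+ 2).
  by rewrite (_ : (fun x => _) = fun x => v x * v x); [smt|apply/funext => x; rewrite expr2].
have kv2 : supp K (fun x => v x ^+ 2) by move=> x hx; rewrite kv// expr0n.
have := Int_avg h0 K0 sv2 kv2 (@smooth_cst _ 1) KL.
rewrite (_ : (fun x => avg h _ x * 1) = avg h (fun x => v x ^+ 2)); last first.
  by apply/funext => x; rewrite mulr1.
rewrite (_ : (fun x => _ ^+ 2 * _) = fun x => v x ^+ 2); last first.
  by apply/funext => x; rewrite avg_cst// mulr1.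
move=> <-; have sa := smooth_avg h sv; have sa2 := smooth_avg h sv2.
apply: Int_le => [|||x _]; [contt|contt|lra|].
by apply: avg_sqr => //; exact: smooth_cont.
Qed.

End Averaging.
Arguments smooth_avg {R} h [v] _.

Arguments It_smooth {R K w} t _.

(** * Limits of sequences of curves *)

Section Limits.
Context {R : realType}.
Implicit Types (u v w : R -> R -> R) (f g : R -> R) (K L T t s x : R) (P Q : (R -> R) -> R -> R).

Lemma norm_tri1 (a b C D : R) : `|b| <= C -> `|a - b| <= D -> `|a| <= C + D.
Proof. by rewrite !ler_norml => /andP[? ?] /andP[? ?]; apply/andP; split; lra. Qed.

Lemma norm_tri2 (a b c C D : R) : `|a - b| <= C -> `|c - b| <= D -> `|a - c| <= C + D.
Proof. by rewrite !ler_norml => /andP[? ?] /andP[? ?]; apply/andP; split; lra. Qed.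

Lemma norm_tri4 (a b c C D : R) : `|b - a| <= C -> `|c - b| <= D -> `|c - a| <= C + D.
Proof. by rewrite !ler_norml => /andP[? ?] /andP[? ?]; apply/andP; split; lra. Qed.

Lemma norm_tri3 (a b c d C : R) : `|a - b| <= C / 3 -> `|c - d| <= C / 3 -> `|a - c| <= C / 3 ->
  `|b - d| <= C.
Proof. by rewrite !ler_norml => /andP[? ?] /andP[? ?] /andP[? ?]; apply/andP; split; lra. Qed.

Lemma norm_half (a b c e : R) : `|a - b| <= e / 2 -> `|c - b| <= e / 2 -> `|a - c| <= e.
Proof. by move=> h1 h2; rewrite [e]splitr; exact: norm_tri2 h1 h2. Qed.

Lemma real_cauchy (a : nat -> R) :
  (forall e : R, 0 < e -> exists N, forall n m, (N <= n)%N -> (N <= m)%N -> `|a n - a m| <= e) ->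
  exists l : R, forall e : R, 0 < e -> exists N, forall n, (N <= n)%N -> `|a n - l| <= e.
Proof.
move=> h.
have : cvg (a @ \oo).
  apply: cauchy_cvg; apply/cauchy_ballP => e e0.
  have e2 : 0 < e / 3 by lra.
  have [N hN] := h _ e2.
  exists ([set y | `|a N - y| <= e / 3], [set y | `|a N - y| <= e / 3]).
    by split; exists N => // n /= Nn; exact: hN.
  move=> [y z] /= [h1 h2]; rewrite /ball /=.
  apply: (@le_lt_trans _ _ (`|a N - z| + `|a N - y|)); last by lra.
  have -> : y - z = (a N - z) - (a N - y) by ring.
  exact: ler_normB.
move=> /cvg_ex [l /cvgrPdist_le hl]; exists l => e e0.
have [N _ hN] := hl _ e0; exists N => n Nn; rewrite distrC; exact: hN.
Qed.

Lemma le_eps (a b : R) : (forall e : R, 0 < e -> a <= b + e) -> a <= b.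
Proof. by move=> h; apply/ler_addgt0Pr => e; exact: h. Qed.

(** There is no lower bound on [t]: at negative times the approximations compared below differ no
    more than at time 0. *)
Definition ucauchy (u_ : nat -> R -> R -> R) := forall j T (e : R), 0 < e ->
  exists N, forall n m, (N <= n)%N -> (N <= m)%N -> forall t x, t <= T ->
  `|derive1n j (u_ n t) x - derive1n j (u_ m t) x| <= e.

Definition ucvg (u_ : nat -> R -> R -> R) u := forall j T (e : R), 0 < e ->
  exists N, forall n, (N <= n)%N -> forall t x, t <= T ->
  `|derive1n j (u_ n t) x - derive1n j (u t) x| <= e.

(** Completeness. Every derivative has a pointwise limit [U j]; the Taylor bound for order [j],
    whose constant bounds the derivatives of order [j.+2] along the sequence, passes to the limit
    and shows that [U j] has derivative [U j.+1]. *)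
Lemma ucauchy_cvg K (u_ : nat -> R -> R -> R) : (forall n, ccurve K (u_ n)) -> ucauchy u_ ->
  exists2 u, ccurve K u & ucvg u_ u.
Proof.
move=> hu hc.
have su n t := ccurve_smooth t (hu n).
have ex j t x : exists l : R, forall e : R, 0 < e ->
    exists N, forall n, (N <= n)%N -> `|derive1n j (u_ n t) x - l| <= e.
  apply: real_cauchy => e e0; have [N hN] := hc j t e e0.
  by exists N => n m Nn Nm; apply: hN.
pose U j t x := projT1 (cid (ex j t x)).
have hU j t x : forall e : R, 0 < e ->
    exists N, forall n, (N <= n)%N -> `|derive1n j (u_ n t) x - U j t x| <= e.
  exact: projT2 (cid (ex j t x)).
have cvU j T e : 0 < e -> exists N, forall n, (N <= n)%N -> forall t x, t <= T ->
    `|derive1n j (u_ n t) x - U j t x| <= e.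
  move=> e0; have [N hN] := hc j T e e0; exists N => n Nn t x tT.
  apply: le_eps => d d0; have [M hM] := hU j t x d d0.
  have -> : derive1n j (u_ n t) x - U j t x =
    (derive1n j (u_ n t) x - derive1n j (u_ (maxn N M) t) x) +
    (derive1n j (u_ (maxn N M) t) x - U j t x) by ring.
  by rewrite (le_trans (ler_normD _ _))// lerD// ?hN ?hM// ?leq_maxl ?leq_maxr.
have dU j t x : der (U j t) x (U j.+1 t x).
  have [N hN] := hc j.+2 t 1 ltr01.
  have [C hC] := cont_supp_bound (smooth_continuous (n := j.+2) (su N t))
    (supp_derive1n j.+2 (ccurve_supp t (hu N))).
  apply: (@der_quad _ _ _ _ (C + 1)) => y; apply: le_eps => e e0.
  have d0 : 0 < e / (2 + `|y - x|) by apply: divr_gt0 => //; rewrite ltr_wpDr.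
  set d := e / _ in d0.
  have [n1 h1] := hU j t y d d0; have [n2 h2] := hU j t x d d0.
  have [n3 h3] := hU j.+1 t x d d0.
  pose n := maxn N (maxn n1 (maxn n2 n3)).
  have {}h1 := h1 n; have {}h2 := h2 n; have {}h3 := h3 n.
  have nN : (N <= n)%N by rewrite leq_maxl.
  move: h1; rewrite leq_max leq_maxl orbT => /(_ isT) h1.
  move: h2; rewrite leq_max leq_max leq_max leqnn !orbT => /(_ isT) h2.
  move: h3; rewrite leq_max leq_max leq_max leqnn !orbT => /(_ isT) h3.
  have := @der_taylor _ (derive1n j (u_ n t)) (derive1n j.+1 (u_ n t)) (derive1n j.+2 (u_ n t))
    (C + 1) x y (fun z => smooth_der j z (su n t)) (fun z => smooth_der j.+1 z (su n t)).
  have bd z : `|derive1n j.+2 (u_ n t) z| <= C + 1.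
    exact: norm_tri1 (hC z) (hN n N nN (leqnn N) t z (lexx t)).
  move=> /(_ bd) q.
  have -> : U j t y - U j t x - (y - x) * U j.+1 t x =
    (derive1n j (u_ n t) y - derive1n j (u_ n t) x - (y - x) * derive1n j.+1 (u_ n t) x)
    + ((derive1n j (u_ n t) x - U j t x) + (y - x) * (derive1n j.+1 (u_ n t) x - U j.+1 t x)
    - (derive1n j (u_ n t) y - U j t y)) by ring.
  rewrite (le_trans (ler_normD _ _))// lerD//.
  rewrite (le_trans (ler_normB _ _))//.
  apply: (@le_trans _ _ ((d + `|y - x| * d) + d)).
    rewrite lerD// (le_trans (ler_normD _ _))// lerD// normrM ler_wpM2l//.
  have -> : d + `|y - x| * d + d = d * (2 + `|y - x|) by ring.
  by rewrite /d divfK// lt0r_neq0// ltr_wpDr.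
have DU j t : derive1n j (U 0 t) = U j t.
  exact: (family_derive1n j (F := fun j => U j t) (fun j x => dU j t x)).
have SU t : smooth (U 0 t).
  exact: (family_smooth (F := fun j => U j t) (fun j x => dU j t x)).
exists (U 0); last by move=> j T e e0; have [N hN] := cvU j T e e0; exists N => n Nn t x tT; rewrite DU hN.
split => // [t x xK|j t e e0].
  apply/eqP; rewrite -normr_le0; apply: le_eps => e e0.
  have [N hN] := hU 0 t x e e0; have := hN N (leqnn N).
  by rewrite /= (ccurve_supp t (hu N))// sub0r normrN add0r.
have e3 : 0 < e / 3 by lra.
have [N hN] := cvU j (t + 1) _ e3.
have h1 := ccurve_near j t (hu N) e3.
near=> s => x; rewrite !DU.
have st : s <= t + 1 by apply: ltW; near: s; apply: lt_nbhsl; lra.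
have tt : t <= t + 1 by lra.
apply: norm_tri3 (hN N (leqnn N) s x st) (hN N (leqnn N) t x tt) _.
by move: x; near: s; exact: h1.
Unshelve. all: by end_near. Qed.

Lemma bop_diff K L d P n : bop K L d P -> exists2 C : R, 0 <= C &
  forall f g (M : R), smooth f -> supp K f -> smooth g -> supp K g ->
  (forall i x, (i <= n + d)%N -> `|derive1n i f x - derive1n i g x| <= M) ->
  forall i x, (i <= n)%N -> `|derive1n i (P f) x - derive1n i (P g) x| <= C * M.
Proof.
move=> [h1 h2 h3 h4].
have {}h4 j : exists2 C : R, 0 <= C & forall f g (M : R),
    smooth f -> supp K f -> smooth g -> supp K g ->
    (forall i x, (i <= j + d)%N -> `|derive1n i f x - derive1n i g x| <= M) ->
    forall x, `|derive1n j (P f) x - derive1n j (P g) x| <= C * M.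
  have [C C0 hC] := h4 j; exists C; first exact: C0.
  move=> f g M sf kf sg kg hM x.
  have -> : derive1n j (P f) x - derive1n j (P g) x =
      derive1n j (P (fun x => 1 * f x + -1 * g x)) x.
    rewrite (h3 _ _ 1 (-1) sf kf sg kg) (derive1n_lin 1 (-1) j (h1 _ sf kf) (h1 _ sg kg)).
    by rewrite mul1r mulN1r.
  apply: hC; [exact: smooth_lin|exact: supp_lin|].
  by move=> i y ij; rewrite (derive1n_lin 1 (-1) i sf sg) mul1r mulN1r; exact: hM.
elim: n => [|n [B B0 hB]].
  have [C C0 hC] := h4 0; exists C => // f g M sf kf sg kg hM i x; rewrite leqn0 => /eqP ->.
  exact: hC.
have [C C0 hC] := h4 n.+1; exists (B + C); first exact: addr_ge0.
move=> f g M sf kf sg kg hM i x.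
have M0 : 0 <= M by exact: le_trans (normr_ge0 _) (hM 0%N 0 isT).
rewrite leq_eqVlt ltnS => /predU1P[->|ij].
  by rewrite (le_trans (hC f g M sf kf sg kg hM x))// ler_wpM2r// lerDr.
have hM' i' y : (i' <= n + d)%N -> `|derive1n i' f y - derive1n i' g y| <= M.
  by move=> h; apply: hM; rewrite (leq_trans h)// leq_add2r.
by rewrite (le_trans (hB f g M sf kf sg kg hM' i x ij))// ler_wpM2r// lerDl.
Qed.

Lemma It_diff K w w' (g : R -> R) j t x : ccurve K w -> ccurve K w' -> continuous g ->
  (forall s, 0 <= s <= Num.max 0 t -> `|derive1n j (w s) x - derive1n j (w' s) x| <= g s) ->
  `|derive1n j (It w t) x - derive1n j (It w' t) x| <= prim g (Num.max 0 t).
Proof.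
move=> hw hw' cg h; rewrite (derive1n_It _ _ hw) (derive1n_It _ _ hw').
have c1 := ccurve_time j x hw; have c2 := ccurve_time j x hw'.
have -> : It (fun s => derive1n j (w s)) t x - It (fun s => derive1n j (w' s)) t x =
    prim (fun s => 1 * derive1n j (w s) x + -1 * derive1n j (w' s) x) (Num.max 0 t).
  by rewrite prim_lin// mul1r mulN1r.
apply: prim_abs => //; [contt|exact: max0_ge|].
by move=> s hs; rewrite mul1r mulN1r; exact: h.
Qed.

Lemma It_diff_cst K w w' (M : R) j t x : ccurve K w -> ccurve K w' ->
  (forall s, 0 <= s <= Num.max 0 t -> `|derive1n j (w s) x - derive1n j (w' s) x| <= M) ->
  `|derive1n j (It w t) x - derive1n j (It w' t) x| <= Num.max 0 t * M.
Proof. by move=> hw hw' h; rewrite -prim_cst; apply: It_diff hw hw' _ h; contt. Qed.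

Lemma prim_exp (l t : R) : 0 < l -> prim (fun s => expR (l * s)) t <= expR (l * t) / l.
Proof.
move=> l0.
have d z : der (fun s => l^-1 * expR (l * s)) z (expR (l * z)).
  apply: (der_eq (derZ l^-1 (der_comp (f := expR) (g := fun s => l * s) (a := expR (l * z)) (b := l) _ _))) => //.
  - by apply/der_is_derive; exact: is_derive_expR.
  - by apply: (der_eq (derZ l (der_id z))) => //; rewrite mulr1.
  - by rewrite mulrCA mulVf ?mulr1// lt0r_neq0.
have ce : continuous (fun s => expR (l * s)).
  by apply: (@der_cont _ _ (fun s => expR (l * s) * l)) => z; apply: (der_eq (derZ l (d z))) => [y|]; rewrite ?mulVKf ?lt0r_neq0// mulrC.
have := prim_diff 0 t ce d; rewrite prim0 subr0 mulr0 expR0 mulr1 => ->.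
by rewrite mulrC gerBl invr_ge0 ltW.
Qed.

Lemma cont_exp (l : R) : continuous (fun s => expR (l * s)).
Proof.
apply: (@der_cont _ _ (fun s => expR (l * s) * l)) => z.
apply: (der_comp (f := expR) (g := fun s => l * s)).
  by apply/der_is_derive; exact: is_derive_expR.
by apply: (der_eq (derZ l (der_id z))) => //; rewrite mulr1.
Qed.

End Limits.

Arguments prim_exp {R l} t _.
Arguments cont_exp {R} l.

(** * Linear Volterra equations *)

Section Volterra.
Context {R : realType}.
Variables (K : R) (B1 B2 : (R -> R) -> R -> R).
Hypotheses (b1 : bop K K 0 B1) (b2 : bop K K 0 B2).
Implicit Types (u v w : R -> R -> R) (f g : R -> R) (T t s x : R).

Let Psi v s x := 1 * B1 (It v s) x + 1 * B2 (v s) x.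

Let Psi_ccurve v : ccurve K v -> ccurve K (Psi v).
Proof.
move=> hv; apply: ccurve_lin; last exact: bop_ccurve b2 hv.
exact: bop_ccurve b1 (It_ccurve hv).
Qed.

Let Psi_diff j : exists2 C : R, 0 <= C & forall v w s (M : R), ccurve K v -> ccurve K w ->
  (forall i x, (i <= j)%N -> `|derive1n i (It v s) x - derive1n i (It w s) x| <= M) ->
  (forall i x, (i <= j)%N -> `|derive1n i (v s) x - derive1n i (w s) x| <= M) ->
  forall i x, (i <= j)%N -> `|derive1n i (Psi v s) x - derive1n i (Psi w s) x| <= C * M.
Proof.
have [C1 C10 h1] := bop_diff j b1; have [C2 C20 h2] := bop_diff j b2.
rewrite !addn0 in h1 h2.
exists (C1 + C2); first exact: addr_ge0.
move=> v w s M hv hw hI hM i x ij.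
have [hv1 hv2 _] := bop_ccurve b1 (It_ccurve hv); have [hv3 hv4 _] := bop_ccurve b2 hv.
have [hw1 hw2 _] := bop_ccurve b1 (It_ccurve hw); have [hw3 hw4 _] := bop_ccurve b2 hw.
rewrite /Psi (derive1n_lin 1 1 i (hv1 s) (hv3 s)) (derive1n_lin 1 1 i (hw1 s) (hw3 s)).
rewrite !mul1r opprD addrACA (le_trans (ler_normD _ _))// mulrDl lerD//.
  have [j1 j2 _] := It_ccurve hv; have [j3 j4 _] := It_ccurve hw.
  by apply: h1 => //; exact: hI.
have [j1 j2 _] := hv; have [j3 j4 _] := hw.
by apply: h2 => //; exact: hM.
Qed.

(* Picard iteration; the weight e^(lt) makes the Volterra operator a contraction. *)
Lemma volterra w0 : ccurve K w0 -> exists2 v, ccurve K v &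
  forall t x, v t x = w0 t x + It (fun s x => B1 (It v s) x + B2 (v s) x) t x.
Proof.
move=> h0.
pose V := fix V n := if n is n'.+1 then fun t x => 1 * w0 t x + 1 * It (Psi (V n')) t x else w0.
have hV n : ccurve K (V n).
  elim: n => // n IH; apply: ccurve_lin => //; apply: It_ccurve; exact: Psi_ccurve.
have DV n i t x : derive1n i (V n.+1 t) x = derive1n i (w0 t) x + derive1n i (It (Psi (V n)) t) x.
  have sI := It_smooth t (Psi_ccurve (hV n)).
  by rewrite /= (derive1n_lin 1 1 i (ccurve_smooth t h0) sI) !mul1r.
have est j T : exists2 l : R, 0 < l & exists2 M : R, 0 <= M & forall n i t x, (i <= j)%N -> 0 <= t <= T ->
    `|derive1n i (V n.+1 t) x - derive1n i (V n t) x| <= M / 2 ^+ n * expR (l * t).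
  have [C C0 hC] := Psi_diff j.
  have [M M0 hM] := ccurve_bounds j T (It_ccurve (Psi_ccurve h0)).
  (* Integrating [e^(lt)] gains a factor [1/l]. As [l >= 2 C], one Picard step halves the weighted
     difference; as [l >= 1], the inner integral [It v] costs nothing. *)
  pose l := 2 * C + 1; have l1 : 1 <= l by rewrite /l; lra.
  have l0 : 0 < l by lra.
  exists l => //; exists M => //; elim=> [|n IH] i t x ij /andP[t0 tT].
    rewrite DV addrC addKr expr0 divr1 (le_trans (hM _ _ _ ij _))//; first by rewrite ger0_norm.
    by rewrite ler_peMr// -expR0 ler_expR mulr_ge0// ltW.
  rewrite DV [derive1n i (V n.+1 t) x]DV opprD addrACA subrr add0r.
  pose N := M / 2 ^+ n; have N0 : 0 <= N by rewrite divr_ge0// exprn_ge0.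
  apply: (@le_trans _ _ (prim (fun s => C * N * expR (l * s)) (Num.max 0 t))).
    have h1 := Psi_ccurve (hV n.+1); have h2 := Psi_ccurve (hV n).
    have ce := cont_exp l.
    apply: (It_diff h1 h2); first by contt.
    rewrite max0E// => s /andP[s0 st].
    have sT : 0 <= s <= T by rewrite s0 (le_trans st).
    have pN r y i' : (i' <= j)%N -> 0 <= r <= T ->
        `|derive1n i' (V n.+1 r) y - derive1n i' (V n r) y| <= N * expR (l * r).
      by move=> h h'; exact: IH.
    rewrite -mulrA; apply: (hC) => // i' y i'j; last exact: pN.
    apply: (@le_trans _ _ (prim (fun r => N * expR (l * r)) (Num.max 0 s))).
      apply: (It_diff (hV n.+1) (hV n)); first by contt.
      rewrite max0E// => r /andP[r0 rs]; apply: pN => //.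
      by rewrite r0 (le_trans rs)// (le_trans st).
    rewrite max0E//.
    have -> : prim (fun r => N * expR (l * r)) s = N * prim (fun r => expR (l * r)) s.
      have := prim_lin N 0 s ce ce; rewrite mul0r addr0 => <-.
      by congr (prim _ s); apply/funext => r; rewrite mul0r addr0.
    rewrite ler_wpM2l// (le_trans (prim_exp s l0))// ler_pdivrMr// ler_peMr//.
  rewrite max0E//.
  have ce := cont_exp l.
  have -> : prim (fun r => C * N * expR (l * r)) t = C * N * prim (fun r => expR (l * r)) t.
    have := prim_lin (C * N) 0 t ce ce; rewrite mul0r addr0 => <-.
    by congr (prim _ t); apply/funext => r; rewrite mul0r addr0.
  apply: le_trans (ler_wpM2l _ (prim_exp t l0)) _; first exact: mulr_ge0.
  have -> : M / 2 ^+ n.+1 * expR (l * t) = N * expR (l * t) / 2 by rewrite /N exprS; field; rewrite ?expf_neq0.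
  have cl : C / l <= 2^-1 by rewrite ler_pdivrMr// /l; lra.
  rewrite [X in X <= _](_ : _ = N * expR (l * t) * (C / l)); last by ring.
  by rewrite ler_wpM2l// mulr_ge0 ?expR_ge0.
have hc : ucauchy V.
  move=> j T e e0; have [l l0 [M M0 hM]] := est j (Num.max 0 T).
  pose E := expR (l * Num.max 0 T); have E0 : 0 < E by exact: expR_gt0.
  have step n t x : t <= T -> `|derive1n j (V n.+1 t) x - derive1n j (V n t) x| <= M * E / 2 ^+ n.
    move=> tT; case: (leP 0 t) => t0.
      apply: (le_trans (hM n j t x (leqnn j) _)); first by rewrite t0 le_max tT orbT.
      rewrite mulrAC ler_wpM2r ?invr_ge0 ?exprn_ge0// ler_wpM2l// ler_expR ler_wpM2l ?(ltW l0)//.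
      by rewrite le_max tT orbT.
    have cst m : derive1n j (V m t) x = derive1n j (w0 t) x.
      by case: m => // m; rewrite DV It_le0 ?(ltW t0)// derive1n_cst0 addr0.
    by rewrite !cst subrr normr0 divr_ge0 ?mulr_ge0 ?exprn_ge0// ltW.
  (* The sum of the geometric series is written as a difference of tails, so that the induction on
     [k] closes exactly. *)
  have tele n k t x : t <= T ->
      `|derive1n j (V (n + k)%N t) x - derive1n j (V n t) x| <= 2 * (M * E) / 2 ^+ n - 2 * (M * E) / 2 ^+ (n + k).
    move=> tT; elim: k => [|k IH]; first by rewrite addn0 !subrr normr0.
    rewrite addnS; have := step (n + k)%N t x tT; move: IH.
    have -> : 2 * (M * E) / 2 ^+ (n + k).+1 = (M * E) / 2 ^+ (n + k).
      by rewrite exprS invfM mulrACA divff ?mul1r.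
    have -> : 2 * (M * E) / 2 ^+ (n + k) = M * E / 2 ^+ (n + k) + M * E / 2 ^+ (n + k) by ring.
    move=> k1 k2; have := norm_tri4 k1 k2; congr (_ <= _); ring.
  have ME : 0 <= 2 * (M * E) by rewrite !mulr_ge0// ltW.
  have [N hN] : exists N, 2 * (M * E) / 2 ^+ N <= e / 2.
    exists (Num.truncn (4 * (M * E) / e)).+1.
    rewrite ler_pdivrMr ?exprn_gt0//.
    have := truncnS_gt (4 * (M * E) / e); set m := (Num.truncn _).+1 => hm.
    have : (m%:R : R) <= 2 ^+ m.
      by rewrite -natrX ler_nat ltnW// ltn_expl.
    move=> h2; have : 4 * (M * E) / e <= 2 ^+ m by apply: le_trans h2; exact: ltW.
    by rewrite ler_pdivrMr// => ?; lra.
  have fin n t x : (N <= n)%N -> t <= T -> `|derive1n j (V n t) x - derive1n j (V N t) x| <= e / 2.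
    move=> Nn tT; have := tele N (n - N)%N t x tT; rewrite subnKC// => /le_trans; apply.
    by apply: le_trans hN; rewrite gerBl divr_ge0// exprn_ge0.
  exists N => n m Nn Nm t x tT.
  exact: norm_half (fin n t x Nn tT) (fin m t x Nm tT).
have [v hv cv] := ucauchy_cvg hV hc.
exists v => // t x; apply/eqP; rewrite -subr_eq0 -normr_le0; apply: le_eps => e e0; rewrite add0r.
rewrite (_ : (fun s x => _) = Psi v); last first.
  by apply/funext => s; apply/funext => y; rewrite /Psi !mul1r.
have [C C0 hC] := Psi_diff 0.
set T := Num.max 0 t; have T0 : 0 <= T := max0_ge t.
pose d := e / (1 + T * (C * (1 + T))).
have D0 : 0 < 1 + T * (C * (1 + T)) by rewrite ltr_wpDr// !mulr_ge0// addr_ge0.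
have d0 : 0 < d by exact: divr_gt0.
have [N hN] := cv 0 T d d0.
have tT : t <= T by rewrite /T le_max lexx orbT.
have e1 := hN N.+1 (leqnSn N) t x tT.
have e2 : `|derive1n 0 (It (Psi (V N)) t) x - derive1n 0 (It (Psi v) t) x| <= T * (C * ((1 + T) * d)).
  apply: (It_diff_cst (Psi_ccurve (hV N)) (Psi_ccurve hv)) => s /andP[s0 sT].
  apply: (hC _ _ _ _ (hV N) hv) => // i y; rewrite leqn0 => /eqP ->.
    apply: (@le_trans _ _ (Num.max 0 s * d)).
      apply: (It_diff_cst (hV N) hv) => r; rewrite max0E// => /andP[r0 rs].
      by apply: hN => //; rewrite (le_trans rs).
    rewrite (max0E s0); apply: ler_wpM2r; first exact: ltW.
    by apply: (le_trans sT); rewrite -/T lerDr.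
  apply: le_trans (hN N (leqnn N) s y sT) _.
  by rewrite ler_peMl ?(ltW d0)// lerDl.
have : d + T * (C * ((1 + T) * d)) = e.
  by rewrite (_ : d + _ = d * (1 + T * (C * (1 + T)))); [rewrite divfK// lt0r_neq0|ring].
move=> <-.
have -> : v t x - (w0 t x + It (Psi v) t x) = - (derive1n 0 (V N.+1 t) x - derive1n 0 (v t) x) +
   (derive1n 0 (It (Psi (V N)) t) x - derive1n 0 (It (Psi v) t) x).
  by rewrite /=; ring.
by rewrite (le_trans (ler_normD _ _))// normrN lerD.
Qed.

End Volterra.

Arguments derive1n : simpl never.

(** * The energy estimate *)

Section StaticEnergy.
Context {R : realType}.
Implicit Types (f g : R -> R) (x : R).

(** Applied to [b1] and [U']: once the top term is split off, only derivatives of [U] of order at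
    most [n] remain, and these are bounded by the energy. *)
Lemma leib_bound1 (B M : R) f g n x :
  (forall i, (0 < i <= n)%N -> `|derive1n i f x| <= B) ->
  (forall i, (i < n)%N -> `|derive1n i g x| <= M) -> 0 <= B -> 0 <= M ->
  `|leib f g n x - f x * derive1n n g x| <= 2 ^+ n * (B * M).
Proof.
move=> hf hg B0 M0.
have -> : leib f g n x - f x * derive1n n g x =
    \sum_(i < n) 'C(n, i.+1)%:R * (derive1n i.+1 f x * derive1n (n - i.+1) g x).
  rewrite /leib big_ord_recl /= bin0 subn0 mul1r addrC addKr.
  by apply: eq_bigr => i _; rewrite /bump /= add1n.
apply: (@le_trans _ _ (\sum_(i < n) 'C(n, i.+1)%:R * (B * M))).
  rewrite (le_trans (ler_norm_sum _ _ _))//; apply: ler_sum => i _.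
  rewrite normrM ger0_norm// ler_wpM2l// normrM.
  apply: ler_pM => //; first by apply: hf; rewrite /= ltn_ord.
  by apply: hg; rewrite ltn_subrL /= (leq_ltn_trans _ (ltn_ord i)).
rewrite -mulr_suml ler_wpM2r ?mulr_ge0//.
have e := expnDn 1 1 n; rewrite [in (1 + 1)%N]addn1 big_ord_recl in e.
have -> : (2 : R) ^+ n = ((2 ^ n)%N)%:R by rewrite natrX.
rewrite e -natr_sum ler_nat; apply: leq_trans (leq_addl _ _); apply: leq_sum => i _.
by rewrite !exp1n !muln1 lift0.
Qed.

(** Applied to [a] and [U'']: the two terms split off contain [D^(n+2) U] and [D^(n+1) U], which the
    energy bounds at best with the weight [a]. The remaining ones have order at most [n]. *)
Lemma leib_bound2 (B M : R) f g n x :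
  (forall i, (1 < i <= n)%N -> `|derive1n i f x| <= B) ->
  (forall i, (i.+1 < n)%N -> `|derive1n i g x| <= M) -> 0 <= B -> 0 <= M ->
  `|leib f g n x - f x * derive1n n g x - n%:R * (derive1n 1 f x * derive1n n.-1 g x)|
    <= 2 ^+ n * (B * M).
Proof.
move=> hf hg B0 M0; case: n hf hg => [|n] hf hg.
  by rewrite leib0 mul0r subr0 subrr normr0 mulr_ge0 ?exprn_ge0 ?mulr_ge0.
have -> : leib f g n.+1 x - f x * derive1n n.+1 g x - n.+1%:R * (derive1n 1 f x * derive1n n g x) =
    \sum_(i < n) 'C(n.+1, i.+2)%:R * (derive1n i.+2 f x * derive1n (n.+1 - i.+2) g x).
  rewrite /leib 2!big_ord_recl /= bin0 mul1r /bump /= ?addn0 bin1 ?subSS ?subn0.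
  set S := RHS; set S' := (X in _ + (_ + X)).
  have -> : S' = S.
    by apply: eq_bigr => i _; rewrite !add1n.
  by rewrite derive1n0; ring.
apply: (@le_trans _ _ (\sum_(i < n) 'C(n.+1, i.+2)%:R * (B * M))).
  rewrite (le_trans (ler_norm_sum _ _ _))//; apply: ler_sum => i _.
  rewrite normrM ger0_norm// ler_wpM2l// normrM.
  apply: ler_pM => //; first by apply: hf; rewrite /= ltnS ltn_ord.
  apply: hg; rewrite subSS ltnS -subSn; last exact: ltn_ord.
  by rewrite subSS leq_subr.
rewrite -mulr_suml ler_wpM2r ?mulr_ge0//.
have e := expnDn 1 1 n.+1; rewrite [in (1 + 1)%N]addn1 !big_ord_recl in e.
have -> : (2 : R) ^+ n.+1 = ((2 ^ n.+1)%N)%:R by rewrite natrX.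
rewrite e -natr_sum ler_nat; apply: leq_trans (leq_addl _ _).
apply: leq_trans (leq_addl _ _); apply: leq_sum => i _.
by rewrite !exp1n !muln1 !lift0.
Qed.

Variables (a b1 b2 b3 : R -> R) (N : nat) (B La M2 : R).
Hypotheses (sa : smooth a) (sb1 : smooth b1) (sb2 : smooth b2) (sb3 : smooth b3).
Hypothesis (N0 : (0 < N)%N).
Hypotheses (a0 : forall x, 0 <= a x) (B0 : 0 <= B) (La0 : 0 <= La) (M0 : 0 <= M2).
Hypothesis ba : forall i x, (i <= N)%N -> `|derive1n i a x| <= B.
Hypothesis bb1 : forall i x, (i <= N)%N -> `|derive1n i b1 x| <= B.
Hypothesis bb2 : forall i x, (i <= N)%N -> `|derive1n i b2 x| <= B.
Hypothesis bb3 : forall i x, (i <= N)%N -> `|derive1n i b3 x| <= B.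
Hypothesis hb1 : forall x, b1 x ^+ 2 <= M2 * a x.
Hypothesis ha : (1 < N)%N -> forall x, derive1n 1 a x ^+ 2 <= La * a x.

Definition opA (U V : R -> R) x : R :=
  a x * derive1n 2 U x - b1 x * derive1n 1 U x - b2 x * V x - b3 x * U x.

(** The third argument is separate because for the regularized equation the weighted term contains
    the averaged function [S u], whereas the other terms contain [u] and [v] themselves. *)
Definition dens (u v U : R -> R) x : R := \sum_(j < N.+1)
  (derive1n j v x ^+ 2 + derive1n j u x ^+ 2 + a x * derive1n j.+1 U x ^+ 2).

Definition flux (U V : R -> R) x : R :=
  \sum_(j < N.+1) 2 * (a x * (derive1n j.+1 U x * derive1n j V x)).

Definition dflux (U V : R -> R) x : R :=
  \sum_(j < N.+1) 2 * (derive1n 1 a x * (derive1n j.+1 U x * derive1n j V x) +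
    a x * (derive1n j.+2 U x * derive1n j V x + derive1n j.+1 U x * derive1n j.+1 V x)).

(** The 6 comes from squaring a sum of six terms: four Leibniz remainders, each at most [(2^N B)^2]
    times the density, the top term of [b1], and the term [(j - 1) a' D^(j+1) U]. The factor [N + 1]
    counts the orders [j], and the final 1 is the share of [|D^j V|^2] in Young's inequality. *)
Definition ecst : R :=
  6 * (4 * (2 ^+ N * B) ^+ 2 + M2 + (B ^+ 2 + N%:R ^+ 2 * La)) * N.+1%:R + 1.

Variables (U V : R -> R).
Hypotheses (sU : smooth U) (sV : smooth V).

Lemma smooth_opA : smooth (opA U V).
Proof. by rewrite /opA; smt. Qed.

Lemma flux_der x : der (flux U V) x (dflux U V x).
Proof.
apply: (der_sum (F := fun j x => 2 * (a x * (derive1n j.+1 U x * derive1n j V x)))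
  (dF := fun j => 2 * (derive1n 1 a x * (derive1n j.+1 U x * derive1n j V x) +
    a x * (derive1n j.+2 U x * derive1n j V x + derive1n j.+1 U x * derive1n j.+1 V x)))).
move=> j _; apply: derZ; apply: derM; first exact: smooth_der0.
by apply: derM; exact: smooth_der.
Qed.

Lemma cont_dflux : continuous (dflux U V).
Proof. by apply: ctsP; rewrite /dflux; apply: cts_sum => j; contt. Qed.

Lemma dens_ge0 u v W x : 0 <= dens u v W x.
Proof. by apply: sumr_ge0 => j _; rewrite !addr_ge0 ?sqr_ge0// mulr_ge0 ?sqr_ge0. Qed.

Lemma dens_term (u v W : R -> R) x j : (j <= N)%N ->
  [/\ derive1n j v x ^+ 2 <= dens u v W x, derive1n j u x ^+ 2 <= dens u v W x &
      a x * derive1n j.+1 W x ^+ 2 <= dens u v W x].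
Proof.
rewrite -ltnS => jN.
have h : derive1n j v x ^+ 2 + derive1n j u x ^+ 2 + a x * derive1n j.+1 W x ^+ 2 <= dens u v W x.
  rewrite /dens (bigD1 (Ordinal jN)) //= lerDl; apply: sumr_ge0 => i _.
  by rewrite !addr_ge0 ?sqr_ge0// mulr_ge0 ?sqr_ge0.
have h1 := sqr_ge0 (derive1n j v x); have h2 := sqr_ge0 (derive1n j u x).
have h3 : 0 <= a x * derive1n j.+1 W x ^+ 2 by rewrite mulr_ge0 ?sqr_ge0.
by split; apply: le_trans h; lra.
Qed.

Lemma dens_abs x j : (j <= N)%N ->
  `|derive1n j V x| <= Num.sqrt (dens U V U x) /\ `|derive1n j U x| <= Num.sqrt (dens U V U x).
Proof.
move=> jN; have [h1 h2 _] := dens_term U V U x jN.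
by split; rewrite -sqrtr_sqr ler_wsqrtr.
Qed.

Lemma sqr_le_abs (r c : R) : `|r| <= c -> r ^+ 2 <= c ^+ 2.
Proof.
move=> h; rewrite -[r ^+ 2]real_normK ?num_real//; apply: lerXn2r => //.
by rewrite nnegrE (le_trans _ h).
Qed.

Lemma sqr_sum6 (x1 x2 x3 x4 x5 x6 : R) : (x1 - x2 - x3 - x4 - x5 + x6) ^+ 2 <=
  6 * (x1 ^+ 2 + x2 ^+ 2 + x3 ^+ 2 + x4 ^+ 2 + x5 ^+ 2 + x6 ^+ 2).
Proof.
rewrite -subr_ge0 (_ : _ - _ = (x1 + x2) ^+ 2 + (x1 + x3) ^+ 2 + (x1 + x4) ^+ 2 + (x1 + x5) ^+ 2 + (x1 - x6) ^+ 2 + (x2 - x3) ^+ 2 + (x2 - x4) ^+ 2 + (x2 - x5) ^+ 2 + (x2 + x6) ^+ 2 + (x3 - x4) ^+ 2 + (x3 - x5) ^+ 2 + (x3 + x6) ^+ 2 + (x4 - x5) ^+ 2 + (x4 + x6) ^+ 2 + (x5 + x6) ^+ 2); last by ring.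
by rewrite !addr_ge0 ?sqr_ge0.
Qed.

(* The subtracted terms are (a D^(j+1) U)', which the divergence of the flux absorbs. *)
Lemma commutator_bound x j : (j <= N)%N ->
  (derive1n j (opA U V) x - (a x * derive1n j.+2 U x + derive1n 1 a x * derive1n j.+1 U x)) ^+ 2
    <= 6 * (4 * (2 ^+ N * B) ^+ 2 + M2 + (B ^+ 2 + N%:R ^+ 2 * La)) * dens U V U x.
Proof.
move=> jN.
set e := dens U V U x; have e0 : 0 <= e := dens_ge0 U V U x.
pose m := Num.sqrt e; have m0 : 0 <= m := sqrtr_ge0 e.
have me : m ^+ 2 = e by rewrite sqr_sqrtr.
have sU1 : smooth (derive1n 1 U) by smt.
have sU2 : smooth (derive1n 2 U) by smt.
have -> : derive1n j (opA U V) x = leib a (derive1n 2 U) j x - leib b1 (derive1n 1 U) j x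
    - leib b2 V j x - leib b3 U j x.
  rewrite /opA derive1n_B; [|by smt|by smt].
  rewrite derive1n_B; [|by smt|by smt].
  rewrite derive1n_B; [|by smt|by smt].
  by rewrite !derive1nM.
have p2 : 2 ^+ j <= 2 ^+ N :> R by rewrite ler_eXn2l// ltr1n.
have p0 : 0 <= 2 ^+ j :> R by rewrite exprn_ge0.
have Bm : 0 <= B * m by rewrite mulr_ge0.
have up r : `|r| <= 2 ^+ j * (B * m) -> r ^+ 2 <= (2 ^+ N * B) ^+ 2 * e.
  move=> h; rewrite -me -exprMn; apply: sqr_le_abs; apply: le_trans h _.
  by rewrite -mulrA ler_wpM2r.
have t1 := up _ (@leib_bound2 B m a (derive1n 2 U) j x _ _ B0 m0).
have {t1} t1 : (leib a (derive1n 2 U) j x - a x * derive1n j (derive1n 2 U) x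
  - j%:R * (derive1n 1 a x * derive1n j.-1 (derive1n 2 U) x)) ^+ 2 <= (2 ^+ N * B) ^+ 2 * e.
  apply: t1 => i; first by move=> /andP[_ ij]; apply: ba; exact: leq_trans jN.
  by move=> ij; rewrite derive1nD addn2; apply: (dens_abs x _).2; exact: leq_trans jN.
have t2 : (leib b1 (derive1n 1 U) j x - b1 x * derive1n j (derive1n 1 U) x) ^+ 2 <= (2 ^+ N * B) ^+ 2 * e.
  apply: up; apply: leib_bound1 => // i; first by move=> /andP[_ ij]; apply: bb1; exact: leq_trans jN.
  by move=> ij; rewrite derive1nD addn1; apply: (dens_abs x _).2; exact: leq_trans jN.
have t3 : (leib b2 V j x) ^+ 2 <= (2 ^+ N * B) ^+ 2 * e.
  apply: up; apply: leib_bound => i ij; first by apply: bb2; exact: leq_trans jN.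
  by apply: (dens_abs x _).1; exact: leq_trans jN.
have t4 : (leib b3 U j x) ^+ 2 <= (2 ^+ N * B) ^+ 2 * e.
  apply: up; apply: leib_bound => i ij; first by apply: bb3; exact: leq_trans jN.
  by apply: (dens_abs x _).2; exact: leq_trans jN.
have [_ _ tj] := dens_term U V U x jN.
have t5 : (b1 x * derive1n j.+1 U x) ^+ 2 <= M2 * e.
  rewrite exprMn; apply: (@le_trans _ _ (M2 * (a x * derive1n j.+1 U x ^+ 2))).
    by rewrite mulrA ler_wpM2r ?sqr_ge0.
  by rewrite ler_wpM2l.
(* Three cases. At [j = 0] the factor is -1 and [D U] is in the density because [0 < N]; at [j = 1]
   the term vanishes; for [j >= 2] also [N >= 2], so that [ha] trades [a'^2] for [La a]. *)
have t6 : ((j%:R - 1) * (derive1n 1 a x * derive1n j.+1 U x)) ^+ 2 <= (B ^+ 2 + N%:R ^+ 2 * La) * e.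
  rewrite [X in _ <= X]mulrDl exprMn exprMn.
  have n0 : 0 <= N%:R ^+ 2 * La * e by rewrite !mulr_ge0 ?sqr_ge0.
  have n1 : 0 <= B ^+ 2 * e by rewrite !mulr_ge0 ?sqr_ge0.
  case: j jN tj {t1 t2 t3 t4 t5 p2 p0 up} => [|[|j]] jN tj.
  - rewrite sub0r sqrrN expr1n mul1r; apply: (@le_trans _ _ (B ^+ 2 * e)); last by rewrite lerDl.
    apply: ler_pM; rewrite ?sqr_ge0//; first by apply: sqr_le_abs; exact: ba.
    by have [_ h _] := dens_term U V U x N0.
  - by rewrite subrr expr0n mul0r addr_ge0.
  apply: (@le_trans _ _ (N%:R ^+ 2 * La * e)); last by rewrite lerDr.
  rewrite -mulrA; apply: ler_pM; [exact: sqr_ge0|apply: mulr_ge0; exact: sqr_ge0| |].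
    apply: sqr_le_abs; rewrite ger0_norm; last by rewrite subr_ge0 ler1n.
    by rewrite lerBlDr (@le_trans _ _ N%:R) ?lerDl// ler_nat.
  apply: (@le_trans _ _ (La * (a x * derive1n j.+3 U x ^+ 2))); last by rewrite ler_wpM2l.
  by rewrite mulrA ler_wpM2r ?sqr_ge0// ha// (leq_trans _ jN).
have e1 : derive1n j (derive1n 2 U) x = derive1n j.+2 U x by rewrite derive1nD addn2.
have e2 : derive1n j (derive1n 1 U) x = derive1n j.+1 U x by rewrite derive1nD addn1.
have e3 : j%:R * (derive1n 1 a x * derive1n j.-1 (derive1n 2 U) x) =
    j%:R * (derive1n 1 a x * derive1n j.+1 U x).
  by case: (j) => [|j']; rewrite ?mul0r// derive1nD addn2.
rewrite e1 e3 in t1; rewrite e2 in t2.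
rewrite -[6 * _ * _]mulrA.
have -> : (4 * (2 ^+ N * B) ^+ 2 + M2 + (B ^+ 2 + N%:R ^+ 2 * La)) * e = (2 ^+ N * B) ^+ 2 * e +
    (2 ^+ N * B) ^+ 2 * e + (2 ^+ N * B) ^+ 2 * e + (2 ^+ N * B) ^+ 2 * e + M2 * e +
    (B ^+ 2 + N%:R ^+ 2 * La) * e by ring.
apply: le_trans (ler_wpM2l _ (lerD (lerD (lerD (lerD (lerD t1 t2) t3) t4) t5) t6)) => //.
apply: le_trans (sqr_sum6 _ _ _ _ _ _); rewrite le_eqVlt; apply/orP; left; apply/eqP.
by congr (_ ^+ 2); ring.
Qed.

(** With [r] the commutator, [2 r D^j V <= r^2 + |D^j V|^2]. The terms left over,
    [a D^(j+2) U D^j V], [a' D^(j+1) U D^j V] and [a D^(j+1) U D^(j+1) V], add up to the divergence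
    of the flux. *)
Lemma static_energy x : \sum_(j < N.+1) (2 * (derive1n j (opA U V) x * derive1n j V x) +
    2 * (a x * (derive1n j.+1 U x * derive1n j.+1 V x))) <= dflux U V x + ecst * dens U V U x.
Proof.
set e := dens U V U x; have e0 : 0 <= e := dens_ge0 U V U x.
set c := 6 * (4 * (2 ^+ N * B) ^+ 2 + M2 + (B ^+ 2 + N%:R ^+ 2 * La)).
have -> : ecst * e = \sum_(j < N.+1) (c * e) + e.
  by rewrite /ecst -/c sumr_const card_ord -mulr_natr; ring.
have h : \sum_(j < N.+1) derive1n j V x ^+ 2 <= e.
  apply: ler_sum => j _; rewrite -addrA lerDl addr_ge0 ?sqr_ge0//.
  by rewrite mulr_ge0 ?sqr_ge0.
apply: le_trans (lerD (lexx _) (lerD (lexx _) h)).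
rewrite /dflux -!big_split /=; apply: ler_sum => j _.
have jN : (j <= N)%N by rewrite -ltnS.
have := commutator_bound x jN; rewrite -/e -/c.
set r := (_ - _) => hr.
have -> : derive1n j (opA U V) x = r + (a x * derive1n j.+2 U x + derive1n 1 a x * derive1n j.+1 U x).
  by rewrite /r subrK.
have := sqr_ge0 (r - derive1n j V x).
by move: (derive1n j V x) (derive1n j.+1 V x) (derive1n j.+2 U x) (derive1n j.+1 U x)
  (derive1n 1 a x) r hr => y1 y2 y3 y4 y5 r hr; nra.
Qed.

End StaticEnergy.

(** * Differentiation of integrals in time, and Gronwall's inequality *)

Section UniformDifferentiability.
Context {R : realType}.
Implicit Types (p q : R -> R -> R) (f g : R -> R) (L t s x : R).

(** Uniformity is asked on [[-L, L]], since the factors met below, such as [a] and the moving weight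
    of the finite speed argument, need not have compact support. *)
Definition ucont L t p := forall e : R, 0 < e -> \forall s \near t, forall x, `|x| <= L ->
  `|p s x - p t x| <= e.

Definition udiff L t p f := forall e : R, 0 < e -> \forall s \near t, forall x, `|x| <= L ->
  `|p s x - p t x - (s - t) * f x| <= e * `|s - t|.

Lemma near_dist t d : 0 < d -> \forall s \near t, `|s - t| <= d.
Proof. by move=> d0; apply/nbhs_ballP; exists d => //= s; rewrite /ball /= distrC => /ltW. Qed.

Lemma ucontD L t p q : ucont L t p -> ucont L t q -> ucont L t (fun s x => p s x + q s x).
Proof.
move=> hp hq e e0; have e2 : 0 < e / 2 by lra.
have := hp _ e2; have := hq _ e2; apply: filterS2 => s h1 h2 x xL.
rewrite opprD addrACA [e]splitr (le_trans (ler_normD _ _))// lerD//; [exact: h2|exact: h1].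
Qed.

Lemma ucont_cst L t f : ucont L t (fun=> f).
Proof. by move=> e e0; near=> s => x _; rewrite subrr normr0 ltW. Unshelve. all: by end_near. Qed.

Lemma ucontM L t p q : continuous (p t) -> continuous (q t) ->
  ucont L t p -> ucont L t q -> ucont L t (fun s x => p s x * q s x).
Proof.
move=> cp cq hp hq e e0.
have [M1 h1] := cont_seg_bound L cp; have [M2 h2] := cont_seg_bound L cq.
pose M := `|M1| + `|M2| + 1.
have M0 : 0 < M by rewrite ltr_wpDl// addr_ge0.
have b1 x : `|x| <= L -> `|p t x| <= M.
  move=> xL; apply: le_trans (h1 x xL) _; have := ler_norm M1; have := normr_ge0 M2; rewrite /M; lra.
have b2 x : `|x| <= L -> `|q t x| <= M.
  move=> xL; apply: le_trans (h2 x xL) _; have := ler_norm M2; have := normr_ge0 M1; rewrite /M; lra.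
pose d := Num.min 1 (e / (2 * M + 1)).
have D0 : 0 < 2 * M + 1 by lra.
have d0 : 0 < d by rewrite lt_min ltr01 divr_gt0.
have d1 : d <= 1 by rewrite ge_min lexx.
have d2 : d * (2 * M + 1) <= e by rewrite -ler_pdivlMr// ge_min lexx orbT.
have := hp _ d0; have := hq _ d0; apply: filterS2 => s k1 k2 x xL.
have -> : p s x * q s x - p t x * q t x =
  (p s x - p t x) * (q s x - q t x) + ((p s x - p t x) * q t x + p t x * (q s x - q t x)) by ring.
apply: (@le_trans _ _ (d * d + (d * M + M * d))).
  rewrite (le_trans (ler_normD _ _))// normrM lerD//; first by apply: ler_pM => //; [exact: k2|exact: k1].
  rewrite (le_trans (ler_normD _ _))// !normrM.
  by rewrite lerD//; apply: ler_pM => //; [exact: k2|exact: b2|exact: b1|exact: k1].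
by nra.
Qed.

Lemma udiffD L t p q f g : udiff L t p f -> udiff L t q g ->
  udiff L t (fun s x => p s x + q s x) (fun x => f x + g x).
Proof.
move=> hp hq e e0; have e2 : 0 < e / 2 by lra.
have := hp _ e2; have := hq _ e2; apply: filterS2 => s h1 h2 x xL.
have -> : p s x + q s x - (p t x + q t x) - (s - t) * (f x + g x) =
  (p s x - p t x - (s - t) * f x) + (q s x - q t x - (s - t) * g x) by ring.
rewrite [X in _ <= X * _]splitr [X in _ <= X]mulrDl (le_trans (ler_normD _ _))// lerD//; [exact: h2|exact: h1].
Qed.

Lemma udiff_cst L t f : udiff L t (fun=> f) (fun=> 0).
Proof.
by move=> e e0; near=> s => x _; rewrite subrr mulr0 subr0 normr0 mulr_ge0 ?normr_ge0// ltW.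
Unshelve. all: by end_near. Qed.

Lemma udiffM L t p q f g : continuous (p t) -> continuous (q t) -> continuous f -> continuous g ->
  udiff L t p f -> udiff L t q g ->
  udiff L t (fun s x => p s x * q s x) (fun x => f x * q t x + p t x * g x).
Proof.
move=> cp cq cf cg hp hq e e0.
have [M1 h1] := cont_seg_bound L cp; have [M2 h2] := cont_seg_bound L cq.
have [M3 h3] := cont_seg_bound L cf; have [M4 h4] := cont_seg_bound L cg.
pose M := `|M1| + `|M2| + `|M3| + `|M4| + 1.
have [n1 n2 n3 n4] : [/\ 0 <= `|M1|, 0 <= `|M2|, 0 <= `|M3| & 0 <= `|M4|] by [].
have [m1 m2 m3 m4] : [/\ M1 <= `|M1|, M2 <= `|M2|, M3 <= `|M3| & M4 <= `|M4|] by rewrite !ler_norm.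
have M0 : 1 <= M by rewrite /M; lra.
have b1 x : `|x| <= L -> `|p t x| <= M by move=> xL; apply: le_trans (h1 x xL) _; rewrite /M; lra.
have b2 x : `|x| <= L -> `|q t x| <= M by move=> xL; apply: le_trans (h2 x xL) _; rewrite /M; lra.
have b3 x : `|x| <= L -> `|f x| <= M by move=> xL; apply: le_trans (h3 x xL) _; rewrite /M; lra.
have b4 x : `|x| <= L -> `|g x| <= M by move=> xL; apply: le_trans (h4 x xL) _; rewrite /M; lra.
(* The error terms add up to at most [d (M^2 + 4 M + 1) |s - t|]; as [M >= 1], the bracket is at
   most [8 M^2]. *)
pose d := Num.min 1 (e / (8 * M ^+ 2)).
have D0 : 0 < 8 * M ^+ 2 by rewrite mulr_gt0// exprn_gt0//; lra.
have d0 : 0 < d by rewrite lt_min ltr01 divr_gt0.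
have d1 : d <= 1 by rewrite ge_min lexx.
have d2 : d * (8 * M ^+ 2) <= e by rewrite -ler_pdivlMr// ge_min lexx orbT.
have hn := near_dist t d0.
move: hn (hp _ d0) (hq _ d0); apply: filterS3 => s k0 k1 k2 x xL.
set h := s - t in k0 k1 k2 *.
set r := p s x - p t x - h * f x; set r' := q s x - q t x - h * g x.
have -> : p s x * q s x - p t x * q t x - h * (f x * q t x + p t x * g x) =
  h * (h * (f x * g x)) + (r' * (p t x + h * f x) + r * (q t x + h * g x) + r * r').
  by rewrite /r /r'; ring.
have hr : `|r| <= d * `|h| by exact: k1.
have hr' : `|r'| <= d * `|h| by exact: k2.
have H0 : 0 <= `|h| by [].
have s1 : `|p t x + h * f x| <= 2 * M.
  rewrite (le_trans (ler_normD _ _))// normrM.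
  have := b1 x xL; have := b3 x xL; have := normr_ge0 (f x); nra.
have s2 : `|q t x + h * g x| <= 2 * M.
  rewrite (le_trans (ler_normD _ _))// normrM.
  have := b2 x xL; have := b4 x xL; have := normr_ge0 (g x); nra.
have t1 : `|h * (h * (f x * g x))| <= `|h| * (d * M ^+ 2).
  rewrite !normrM ler_wpM2l// ler_pM ?mulr_ge0// expr2 ler_pM//; [exact: b3|exact: b4].
have t2 : `|r' * (p t x + h * f x)| <= d * `|h| * (2 * M) by rewrite normrM ler_pM.
have t3 : `|r * (q t x + h * g x)| <= d * `|h| * (2 * M) by rewrite normrM ler_pM.
have t4 : `|r * r'| <= d * `|h| * (d * `|h|) by rewrite normrM ler_pM.
apply: (@le_trans _ _ (`|h| * (d * M ^+ 2) + (d * `|h| * (2 * M) + d * `|h| * (2 * M) + d * `|h| * (d * `|h|)))).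
  rewrite (le_trans (ler_normD _ _))// lerD// (le_trans (ler_normD _ _))// lerD//.
  by rewrite (le_trans (ler_normD _ _))// lerD.
apply: (@le_trans _ _ (d * (8 * M ^+ 2) * `|h|)); last by rewrite ler_wpM2r.
have -> : `|h| * (d * M ^+ 2) + (d * `|h| * (2 * M) + d * `|h| * (2 * M) + d * `|h| * (d * `|h|)) =
  d * (M ^+ 2 + 4 * M + d * `|h|) * `|h| by ring.
rewrite ler_wpM2r// ler_wpM2l ?(ltW d0)//.
have : d * `|h| <= 1 by have := ltW d0; nra.
by nra.
Qed.

Lemma udiff_sum L t n (P : nat -> R -> R -> R) (F : nat -> R -> R) :
  (forall i, (i < n)%N -> udiff L t (P i) (F i)) ->
  udiff L t (fun s x => \sum_(i < n) P i s x) (fun x => \sum_(i < n) F i x).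
Proof.
elim: n => [_|n IH h].
  have := @udiff_cst L t (fun=> 0); congr udiff.
    by apply/funext => s; apply/funext => x; rewrite big_ord0.
  by apply/funext => x; rewrite big_ord0.
have := udiffD (IH (fun i hi => h i (ltnW hi))) (h n (ltnSn n)); congr udiff.
  by apply/funext => s; apply/funext => x; rewrite big_ord_recr.
by apply/funext => x; rewrite big_ord_recr.
Qed.

Lemma ucont_sum L t n (P : nat -> R -> R -> R) :
  (forall i, (i < n)%N -> ucont L t (P i)) -> ucont L t (fun s x => \sum_(i < n) P i s x).
Proof.
elim: n => [_|n IH h].
  have := @ucont_cst L t (fun=> 0); congr ucont.
  by apply/funext => s; apply/funext => x; rewrite big_ord0.
have := ucontD (IH (fun i hi => h i (ltnW hi))) (h n (ltnSn n)); congr ucont.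
by apply/funext => s; apply/funext => x; rewrite big_ord_recr.
Qed.

Lemma udiff_Int L t p f : 0 <= L -> (forall s, continuous (p s)) -> continuous f ->
  udiff L t p f -> der (fun s => Int L (p s)) t (Int L f).
Proof.
move=> L0 cp cf h; apply/der_eps => e e0.
have d0 : 0 < e / (2 * L + 1) by apply: divr_gt0 => //; lra.
have := h _ d0; apply: filterS => s hs.
have cps := cp s; have cpt := cp t.
have -> : Int L (p s) - Int L (p t) - (s - t) * Int L f =
    Int L (fun x => p s x - p t x - (s - t) * f x).
  by rewrite !IntB ?IntZ//; contt.
apply: le_trans (Int_abs (M := e / (2 * L + 1) * `|s - t|) _ L0 hs) _; first by contt.
rewrite mulrA ler_wpM2r//.
have L1 : 2 * L + 1 != 0 by rewrite lt0r_neq0//; lra.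
have := divfK L1 e; move: (e / _) d0 => d d0 {hs} de; nra.
Qed.

Lemma ucont_Int L t p : 0 <= L -> (forall s, continuous (p s)) ->
  ucont L t p -> {for t, continuous (fun s => Int L (p s))}.
Proof.
move=> L0 cp h; apply/cvgrPdist_le => e e0.
have d0 : 0 < e / (2 * L + 1) by apply: divr_gt0 => //; lra.
have := h _ d0; apply: filterS => s hs.
have cps := cp s; have cpt := cp t.
rewrite distrC -IntB//; apply: le_trans (Int_abs (M := e / (2 * L + 1)) _ L0 hs) _; first by contt.
have L1 : 2 * L + 1 != 0 by rewrite lt0r_neq0//; lra.
have := divfK L1 e; move: (e / _) d0 => d d0 {hs} de; nra.
Qed.

Lemma ccurve_ucont K L u j t : ccurve K u -> ucont L t (fun s => derive1n j (u s)).
Proof. by move=> hu e e0; have := ccurve_near j t hu e0; apply: filterS => s h x _. Qed.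

Lemma dcurve_udiff L u v j t : dcurve u v -> 0 < t -> udiff L t (fun s => derive1n j (u s)) (derive1n j (v t)).
Proof. by move=> hu t0 e e0; have := hu j t e t0 e0; apply: filterS => s h x _. Qed.

(** The function [e^(-ct) E] minus the primitive of [Phi] is non-increasing, because [e^(-ct) <= 1]
    and [Phi >= 0]. *)
Lemma gronwall (E E' Phi : R -> R) (c : R) : continuous E -> continuous Phi ->
  (forall t, 0 < t -> der E t (E' t)) -> 0 <= c -> (forall t, 0 <= t -> 0 <= Phi t) ->
  (forall t, 0 < t -> E' t <= c * E t + Phi t) ->
  forall t, 0 <= t -> E t <= expR (c * t) * (E 0 + prim Phi t).
Proof.
move=> cE cP dE c0 P0 hE t t0.
pose H s := expR (- c * s) * E s - prim Phi s.
(* At time 0 there is no derivative; the default 0 satisfies the sign condition that [der_le] asks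
   on the closed interval. *)
pose H' s := if 0 < s then (expR (- c * s) * - c) * E s + expR (- c * s) * E' s - Phi s else 0.
have : H t <= H 0.
  apply: (@der_le _ H H') => //.
  - have c1 := @cont_exp R (- c); rewrite /H; contt.
  - move=> z /andP[z0 _]; rewrite /H' z0; apply: derB; last exact: prim_der.
    apply: derM; last exact: dE.
    apply: (der_comp (f := expR) (g := fun s => - c * s)).
      by apply/der_is_derive; exact: is_derive_expR.
    by apply: (der_eq (derZ (- c) (der_id z))) => //; rewrite mulr1.
  move=> z _; rewrite /H'; case: ifP => // z0.
  have := hE z z0; have e0 := expR_gt0 (- c * z).
  have e1 : expR (- c * z) <= 1 by rewrite -expR0 ler_expR mulNr oppr_le0 mulr_ge0// ltW.
  have := P0 z (ltW z0).
  by move: (expR _) e0 e1 (E z) (E' z) (Phi z) => y y0 y1 z1 z2 z3; nra.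
rewrite /H mulr0 expR0 mul1r prim0 subr0 lerBlDr => h.
apply: (@le_trans _ _ (expR (c * t) * (expR (- c * t) * E t))).
  by rewrite mulrA -expRD mulNr subrr expR0 mul1r.
by rewrite ler_wpM2l ?expR_ge0.
Qed.

End UniformDifferentiability.

(** * The energy estimate in time *)

Section Energy.
Context {R : realType}.
Implicit Types (u v w : R -> R -> R) (f g : R -> R) (K L t s x : R).

Definition coefs (a b1 b2 b3 : R -> R) (N : nat) (B La M2 : R) : Prop :=
 [/\ [/\ smooth a, smooth b1, smooth b2 & smooth b3],
     [/\ (0 < N)%N, 0 <= B, 0 <= La & 0 <= M2],
     forall i x, (i <= N)%N -> [/\ `|derive1n i a x| <= B, `|derive1n i b1 x| <= B,
       `|derive1n i b2 x| <= B & `|derive1n i b3 x| <= B],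
     forall x, 0 <= a x /\ b1 x ^+ 2 <= M2 * a x &
     (1 < N)%N -> forall x, derive1n 1 a x ^+ 2 <= La * a x].

Lemma coefs_static a b1 b2 b3 N B La M2 U V x : coefs a b1 b2 b3 N B La M2 ->
  smooth U -> smooth V -> \sum_(j < N.+1) (2 * (derive1n j (opA a b1 b2 b3 U V) x * derive1n j V x) +
    2 * (a x * (derive1n j.+1 U x * derive1n j.+1 V x))) <=
    dflux a N U V x + ecst N B La M2 * dens a N U V U x.
Proof.
move=> [[sa sb1 sb2 sb3] [N0 B0 La0 M0] hB ha hg] sU sV.
apply: static_energy => //.
- by move=> y; have [] := ha y.
- by move=> i y iN; have [] := hB i y iN.
- by move=> i y iN; have [] := hB i y iN.
- by move=> i y iN; have [] := hB i y iN.
- by move=> i y iN; have [] := hB i y iN.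
- by move=> y; have [] := ha y.
Qed.

Lemma ecst_ge0 a b1 b2 b3 N B La M2 : coefs a b1 b2 b3 N B La M2 -> 0 <= ecst N B La M2.
Proof.
move=> [_ [_ B0 La0 M0] _ _ _].
by rewrite /ecst addr_ge0// !mulr_ge0// !addr_ge0// ?mulr_ge0 ?sqr_ge0.
Qed.

(** The time derivative of [dens] along curves with [u' = v] and [U' = V]. *)
Definition ddens (a : R -> R) N (v' v u V U : R -> R) x : R := \sum_(j < N.+1)
  (2 * (derive1n j v' x * derive1n j v x) + 2 * (derive1n j u x * derive1n j v x) +
   2 * (a x * (derive1n j.+1 U x * derive1n j.+1 V x))).

Lemma cont_dens a N (u v U : R -> R) : smooth a -> smooth u -> smooth v -> smooth U ->
  continuous (dens a N u v U).
Proof. by move=> ? ? ? ?; apply: ctsP; rewrite /dens; apply: cts_sum => j; contt. Qed.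

Lemma cont_ddens a N (v' v u V U : R -> R) : smooth a -> smooth v' -> smooth v -> smooth u ->
  smooth V -> smooth U -> continuous (ddens a N v' v u V U).
Proof. by move=> *; apply: ctsP; rewrite /ddens; apply: cts_sum => j; contt. Qed.

Lemma udiff_dens K1 K2 K3 K4 K5 L a N u v v' U V t : smooth a ->
  ccurve K1 u -> ccurve K2 v -> ccurve K3 v' -> ccurve K4 U -> ccurve K5 V ->
  dcurve u v -> dcurve v v' -> dcurve U V -> 0 < t ->
  udiff L t (fun s => dens a N (u s) (v s) (U s)) (ddens a N (v' t) (v t) (u t) (V t) (U t)).
Proof.
move=> sa hu hv hv' hU hV duv dvv dUV t0.
have sq (p q : R -> R -> R) Kp Kq j : ccurve Kp p -> ccurve Kq q -> dcurve p q ->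
    udiff L t (fun s x => derive1n j (p s) x ^+ 2) (fun x => 2 * (derive1n j (q t) x * derive1n j (p t) x)).
  move=> hp hq dpq.
  have d : udiff L t (fun s => derive1n j (p s)) (derive1n j (q t)) by exact: dcurve_udiff.
  have sp s := ccurve_smooth s hp; have sq s := ccurve_smooth s hq.
  have cp : continuous (derive1n j (p t)) by contt.
  have cq : continuous (derive1n j (q t)) by contt.
  have := udiffM cp cp cq cq d d; congr udiff.
  by apply/funext => x; ring.
pose P j s x := derive1n j (v s) x ^+ 2 + derive1n j (u s) x ^+ 2 + a x * derive1n j.+1 (U s) x ^+ 2.
pose P' j x := 2 * (derive1n j (v' t) x * derive1n j (v t) x) +
   2 * (derive1n j (v t) x * derive1n j (u t) x) +
   (0 * derive1n j.+1 (U t) x ^+ 2 + a x * (2 * (derive1n j.+1 (V t) x * derive1n j.+1 (U t) x))).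
have hP j : (j < N.+1)%N -> udiff L t (P j) (P' j).
  move=> _; apply: udiffD; first by apply: udiffD; [exact: sq hv hv' dvv|exact: sq hu hv duv].
  have sU s := ccurve_smooth s hU; have sV s := ccurve_smooth s hV.
  have c1 := smooth_cont sa.
  have c2 : continuous (fun x => derive1n j.+1 (U t) x ^+ 2) by contt.
  have c3 : continuous (fun x => 2 * (derive1n j.+1 (V t) x * derive1n j.+1 (U t) x)) by contt.
  apply: (udiffM (p := fun=> a) (f := fun=> 0) c1 c2 (@cont_cst _ 0) c3).
    exact: udiff_cst.
  exact: sq hU hV dUV.
have := udiff_sum hP; congr udiff; apply/funext => x; apply: eq_bigr => j _.
by rewrite /P'; do ?move: (derive1n _ _ _) => ?; ring.
Qed.

Lemma ucont_dens K1 K2 K4 L a N u v U t : smooth a ->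
  ccurve K1 u -> ccurve K2 v -> ccurve K4 U ->
  ucont L t (fun s => dens a N (u s) (v s) (U s)).
Proof.
move=> sa hu hv hU.
have sq (p : R -> R -> R) Kp j : ccurve Kp p -> ucont L t (fun s x => derive1n j (p s) x ^+ 2).
  move=> hp; have sp s := ccurve_smooth s hp.
  have cp : continuous (derive1n j (p t)) by contt.
  have d : ucont L t (fun s => derive1n j (p s)) by exact: ccurve_ucont hp.
  exact: (ucontM cp cp d d).
apply: (ucont_sum (P := fun j s x => derive1n j (v s) x ^+ 2 + derive1n j (u s) x ^+ 2 +
   a x * derive1n j.+1 (U s) x ^+ 2)) => j _.
apply: ucontD; first by apply: ucontD; [exact: sq hv|exact: sq hu].
have sU s := ccurve_smooth s hU.
have c1 := smooth_cont sa.
have c2 : continuous (fun x => derive1n j.+1 (U t) x ^+ 2) by contt.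
apply: (ucontM (p := fun=> a) c1 c2); [exact: ucont_cst|exact: sq hU].
Qed.

(* The identity is an instance, so that one energy estimate serves both the regularized and the
   original equation. *)
Record friedrichs K K1 L (S : (R -> R) -> R -> R) : Prop := Friedrichs {
  fr_K : 0 <= K; fr_K1 : K <= K1; fr_L : K1 < L;
  fr_bop : bop K K1 0 S;
  fr_smooth : forall f, smooth f -> smooth (S f);
  fr_D : forall f j, smooth f -> derive1n j (S f) = S (derive1n j f);
  fr_adj : forall f g, smooth f -> supp K f -> smooth g ->
    Int L (fun x => S f x * g x) = Int L (fun x => f x * S g x);
  fr_sqr : forall f, smooth f -> supp K f ->
    Int L (fun x => S f x ^+ 2) <= Int L (fun x => f x ^+ 2) }.

Definition hnorm2 L N f : R := \sum_(j < N.+1) Int L (fun x => derive1n j f x ^+ 2).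

Lemma hnorm2_Int L N f : smooth f ->
  hnorm2 L N f = Int L (fun x => \sum_(j < N.+1) derive1n j f x ^+ 2).
Proof.
move=> sf; rewrite /hnorm2 (@Int_sum _ L N.+1 (fun j x => derive1n j f x ^+ 2))// => i; contt.
Qed.

Lemma hnorm2_ge0 L N f : 0 <= L -> smooth f -> 0 <= hnorm2 L N f.
Proof.
move=> L0 sf; apply: sumr_ge0 => j _; apply: Int_ge0 => //; first by contt.
by move=> x _; exact: sqr_ge0.
Qed.

Lemma hnorm2_cont K L N u : 0 <= L -> ccurve K u -> continuous (fun t => hnorm2 L N (u t)).
Proof.
move=> L0 hu.
have su s := ccurve_smooth s hu.
rewrite (_ : (fun t => _) = fun t => Int L (fun x => \sum_(j < N.+1) derive1n j (u t) x ^+ 2)); last first.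
  by apply/funext => t; rewrite hnorm2_Int.
move=> t; apply: (@ucont_Int _ L t (fun t x => \sum_(j < N.+1) derive1n j (u t) x ^+ 2)) => // [s|].
  by apply: ctsP; apply: cts_sum => j; contt.
apply: (ucont_sum (P := fun j s x => derive1n j (u s) x ^+ 2)) => j _.
have cp : continuous (derive1n j (u t)) by contt.
have d : ucont L t (fun s => derive1n j (u s)) by exact: ccurve_ucont hu.
exact: (ucontM cp cp d d).
Qed.

(** Isolates the pairing of [p] with [v] in the derivative of one energy term, so that
    self-adjointness can replace it by the pairing of [q] with [w]. *)
Lemma Int_transpose L (p q r s f g w v a : R -> R) :
  continuous p -> continuous q -> continuous r -> continuous s -> continuous f -> continuous g ->
  continuous w -> continuous v -> continuous a ->
  Int L (fun x => p x * v x) = Int L (fun x => q x * w x) ->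
  Int L (fun x => 2 * ((p x + f x) * v x) + 2 * (g x * v x) + 2 * (a x * (r x * s x))) =
  Int L (fun x => 2 * (q x * w x) + 2 * (a x * (r x * s x))) +
  Int L (fun x => 2 * (f x * v x) + 2 * (g x * v x)).
Proof.
move=> cp cq cr cs cf cg cw cv ca e.
rewrite (_ : (fun x => _ + _ + _) = fun x => 2 * (p x * v x) +
   (2 * (f x * v x) + 2 * (g x * v x) + 2 * (a x * (r x * s x)))); last by apply/funext => x; ring.
rewrite IntD; [|by contt|by contt]; rewrite IntZ; last by contt.
rewrite e -IntZ; last by contt.
rewrite IntD; [|by contt|by contt].
rewrite [in RHS]IntD; [|by contt|by contt].
by rewrite addrA addrAC.
Qed.

Lemma Int_sqr_le L (p q f g h : R -> R) :
  continuous p -> continuous q -> continuous f -> continuous g -> continuous h ->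
  Int L (fun x => p x ^+ 2) <= Int L (fun x => f x ^+ 2) ->
  Int L (fun x => q x ^+ 2) <= Int L (fun x => g x ^+ 2) ->
  Int L (fun x => p x ^+ 2 + q x ^+ 2 + h x) <= Int L (fun x => f x ^+ 2 + g x ^+ 2 + h x).
Proof.
move=> cp cq cf cg ch h1 h2.
rewrite !IntD; try by contt.
by rewrite lerD2r lerD.
Qed.

(** Since [S] is self-adjoint and commutes with derivatives, the pairing of [D^j S A] with [D^j v]
    is that of [D^j A] with [D^j (S v)], and the static estimate applies to [S u] and [S v]. Since
    [S] does not increase the [L^2] norm, the density of [S u], [S v] is bounded by the one being
    estimated. Hence the constant is the same for all [S]. The added 2 absorbs the products [2 F v]
    and [2 u v]. *)
Lemma energy_estimate K K1 L S a b1 b2 b3 N B La M2 u v v' F :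
  coefs a b1 b2 b3 N B La M2 -> friedrichs K K1 L S ->
  ccurve K u -> ccurve K v -> ccurve K v' -> ccurve K F -> dcurve u v -> dcurve v v' ->
  (forall t, supp K (opA a b1 b2 b3 (S (u t)) (S (v t)))) ->
  (forall t x, 0 < t -> v' t x = S (opA a b1 b2 b3 (S (u t)) (S (v t))) x + F t x) ->
  forall t, 0 <= t -> Int L (dens a N (u t) (v t) (S (u t))) <=
    expR ((ecst N B La M2 + 2) * t) *
    (Int L (dens a N (u 0) (v 0) (S (u 0))) + prim (fun s => hnorm2 L N (F s)) t).
Proof.
move=> hc fr hu hv hv' hF duv dvv kA eqv.
have K0 := fr_K fr; have KK1 := fr_K1 fr; have KL := fr_L fr.
have L0 : 0 <= L by rewrite ltW// (le_lt_trans K0)// (le_lt_trans KK1).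
have [[sa sb1 sb2 sb3] [N0 B0 La0 M0] _ ha _] := hc.
have hU := bop_ccurve (fr_bop fr) hu; have hV := bop_ccurve (fr_bop fr) hv.
have dUV := bop_dcurve (fr_bop fr) hu hv duv.
have su s := ccurve_smooth s hu; have sv s := ccurve_smooth s hv.
have sv' s := ccurve_smooth s hv'; have sF s := ccurve_smooth s hF.
have sU s := ccurve_smooth s hU; have sV s := ccurve_smooth s hV.
have kU s := ccurve_supp s hU; have ku s := ccurve_supp s hu; have kv s := ccurve_supp s hv.
have cd s := cont_dens (N := N) sa (su s) (sv s) (sU s).
have c0 := ecst_ge0 hc.
have cF := hnorm2_cont (N := N) L0 hF.
pose E' t := Int L (ddens a N (v' t) (v t) (u t) (S (v t)) (S (u t))).
apply: (@gronwall _ _ E') => //.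
- move=> t; apply: (@ucont_Int _ L t (fun t => dens a N (u t) (v t) (S (u t)))) => //.
  exact: ucont_dens sa hu hv hU.
- move=> t t0; apply: (@udiff_Int _ L t (fun t => dens a N (u t) (v t) (S (u t)))) => //.
    exact: (cont_ddens sa (sv' t) (sv t) (su t) (sV t) (sU t)).
  exact: udiff_dens sa hu hv hv' hU hV duv dvv dUV t0.
- by lra.
- by move=> t _; exact: (hnorm2_ge0 N L0 (sF t)).
move=> t t0; rewrite /E'.
set A := opA a b1 b2 b3 (S (u t)) (S (v t)).
have sA : smooth A by exact: (smooth_opA sa sb1 sb2 sb3 (sU t) (sV t)).
have sSA : smooth (S A) by exact: fr_smooth fr _ sA.
have kAt : supp K A := kA t.
have Dv' j x : derive1n j (v' t) x = S (derive1n j A) x + derive1n j (F t) x.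
  have -> : v' t = fun x => S A x + F t x by apply/funext => y; rewrite eqv.
  by rewrite derive1n_D; [rewrite (fr_D fr j sA)|smt|smt].
have sSj j : smooth (S (derive1n j A)) by apply: fr_smooth fr _ _; smt.
have sSv j : smooth (S (derive1n j (v t))) by apply: fr_smooth fr _ _; smt.
have hst x : \sum_(j < N.+1) (2 * (derive1n j A x * derive1n j (S (v t)) x) +
    2 * (a x * (derive1n j.+1 (S (u t)) x * derive1n j.+1 (S (v t)) x))) <=
    dflux a N (S (u t)) (S (v t)) x + ecst N B La M2 * dens a N (S (u t)) (S (v t)) (S (u t)) x.
  exact: (coefs_static x hc (sU t) (sV t)).
clearbody A.
have Ej j : Int L (fun x => S (derive1n j A) x * derive1n j (v t) x) =
    Int L (fun x => derive1n j A x * derive1n j (S (v t)) x).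
  rewrite (fr_D fr j (sv t)); apply: (fr_adj fr); [by smt|exact: supp_derive1n|by smt].
pose q1 j x := 2 * (derive1n j A x * derive1n j (S (v t)) x) +
  2 * (a x * (derive1n j.+1 (S (u t)) x * derive1n j.+1 (S (v t)) x)).
pose q2 j x := 2 * (derive1n j (F t) x * derive1n j (v t) x) + 2 * (derive1n j (u t) x * derive1n j (v t) x).
have sUt := sU t; have sVt := sV t.
have cq1 j : continuous (q1 j) by rewrite /q1; contt.
have cq2 j : continuous (q2 j) by rewrite /q2; contt.
have -> : Int L (ddens a N (v' t) (v t) (u t) (S (v t)) (S (u t))) =
    Int L (fun x => \sum_(j < N.+1) q1 j x) + Int L (fun x => \sum_(j < N.+1) q2 j x).
  rewrite !Int_sum// -big_split /=.
  rewrite /ddens (@Int_sum _ L N.+1 (fun j x => 2 * (derive1n j (v' t) x * derive1n j (v t) x) +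
    2 * (derive1n j (u t) x * derive1n j (v t) x) +
    2 * (a x * (derive1n j.+1 (S (u t)) x * derive1n j.+1 (S (v t)) x)))); last by move=> i; contt.
  apply: eq_bigr => j _; rewrite /q1 /q2; have sSjj := sSj j.
  rewrite -(Int_transpose (p := S (derive1n j A)) (v := derive1n j (v t))); [|by contt..|exact: Ej].
  by congr Int; apply/funext => x; rewrite Dv'.
have l1 : Int L (fun x => \sum_(j < N.+1) q1 j x) <=
    ecst N B La M2 * Int L (dens a N (S (u t)) (S (v t)) (S (u t))).
  have cdf := cont_dflux (N := N) sa (sU t) (sV t).
  have cds := cont_dens (N := N) sa (sU t) (sV t) (sU t).
  have -> : ecst N B La M2 * Int L (dens a N (S (u t)) (S (v t)) (S (u t))) =
      Int L (fun x => dflux a N (S (u t)) (S (v t)) x + ecst N B La M2 * dens a N (S (u t)) (S (v t)) (S (u t)) x).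
    rewrite IntD; [|by contt|by contt]; rewrite IntZ//.
    rewrite (Int_der L cdf (fun x => flux_der N sa (sU t) (sV t) x)).
    (* The flux has no boundary terms, because [L] lies strictly beyond the support of [S u]. *)
    have z y : K1 < `|y| -> flux a N (S (u t)) (S (v t)) y = 0.
      move=> hy; rewrite /flux big1// => j _.
      by rewrite (supp_derive1n (K := K1) _ (kU t))// mul0r !mulr0.
    have LL : K1 < `|L| by rewrite ger0_norm.
    by rewrite !z ?normrN// subrr add0r.
  apply: Int_le => //; [by apply: ctsP; apply: cts_sum => j; have := cq1 j => ?; contt|by contt|].
  by move=> x _; exact: hst.
have l2 : Int L (dens a N (S (u t)) (S (v t)) (S (u t))) <= Int L (dens a N (u t) (v t) (S (u t))).
  rewrite /dens (@Int_sum _ L N.+1 (fun j x => derive1n j (S (v t)) x ^+ 2 + derive1n j (S (u t)) x ^+ 2 +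
    a x * derive1n j.+1 (S (u t)) x ^+ 2)); last by move=> i; contt.
  rewrite (@Int_sum _ L N.+1 (fun j x => derive1n j (v t) x ^+ 2 + derive1n j (u t) x ^+ 2 +
    a x * derive1n j.+1 (S (u t)) x ^+ 2)); last by move=> i; contt.
  apply: ler_sum => j _.
  apply: Int_sqr_le; [by contt..| |].
    by rewrite (fr_D fr j (sv t)); apply: (fr_sqr fr); [by smt|exact: supp_derive1n].
  by rewrite (fr_D fr j (su t)); apply: (fr_sqr fr); [by smt|exact: supp_derive1n].
have l3 : Int L (fun x => \sum_(j < N.+1) q2 j x) <=
    2 * Int L (dens a N (u t) (v t) (S (u t))) + hnorm2 L N (F t).
  have cds := cd t.
  have hN : hnorm2 L N (F t) = Int L (fun x => \sum_(j < N.+1) derive1n j (F t) x ^+ 2) by exact: hnorm2_Int (sF t).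
  rewrite hN -IntZ// -IntD; last 2 first.
  - by contt.
  - by apply: ctsP; apply: cts_sum => j; contt.
  apply: Int_le => //.
  - by apply: ctsP; apply: cts_sum => j; have := cq2 j => ?; contt.
  - apply: contD; first by contt.
    by apply: ctsP; apply: cts_sum => j; contt.
  move=> x _; rewrite /dens mulr_sumr -big_split /=; apply: ler_sum => j _; rewrite /q2.
  have [a0 _] := ha x.
  have := sqr_ge0 (derive1n j (F t) x - derive1n j (v t) x).
  have := sqr_ge0 (derive1n j (u t) x - derive1n j (v t) x).
  have : 0 <= a x * derive1n j.+1 (S (u t)) x ^+ 2 by rewrite mulr_ge0 ?sqr_ge0.
  move: (a x * _) (derive1n j (F t) x) (derive1n j (v t) x) (derive1n j (u t) x) => y1 y2 y3 y4.
  have := sqr_ge0 y4; nra.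
have l4 := ler_wpM2l c0 l2.
by rewrite mulrDl; lra.
Qed.

End Energy.

(** * Existence for compactly supported coefficients *)

Section Regularization.
Context {R : realType}.
Implicit Types (u v w : R -> R -> R) (f g : R -> R) (K L t s x h : R).

(** Two averages, each of which absorbs one of the two derivatives in [a U'']. *)
Definition mol h f := avg h (avg h f).

Lemma smooth_mol h f : smooth f -> smooth (mol h f).
Proof. by move=> sf; apply: smooth_avg; exact: smooth_avg. Qed.
Arguments smooth_mol h [f] _.

Lemma derive1n_mol h f j : smooth f -> derive1n j (mol h f) = mol h (derive1n j f).
Proof.
move=> sf; rewrite /mol derive1n_avg; last exact: smooth_avg.
by rewrite derive1n_avg.
Qed.

Lemma bop_mol h K : 0 < h -> bop K (K + h + h) 0 (mol h).
Proof. by move=> h0; have := bop_comp (bop_avg K h0) (bop_avg (K + h) h0). Qed.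

Lemma mol_bound h f (M : R) x : 0 < h -> smooth f -> (forall y, `|f y| <= M) -> `|mol h f x| <= M.
Proof.
move=> h0 sf hM; have sa := smooth_avg h sf.
apply: avg_bound => //; first exact: smooth_cont.
by move=> y; apply: avg_bound => //; exact: smooth_cont.
Qed.

Lemma mol_error h f (M : R) x : 0 < h -> smooth f -> (forall y, `|derive1n 1 f y| <= M) ->
  `|mol h f x - f x| <= 2 * h * M.
Proof.
move=> h0 sf hM; have sa := smooth_avg h sf; have sf1 : smooth (derive1n 1 f) by smt.
have hM' y : `|derive1n 1 (avg h f) y| <= M.
  rewrite derive1n_avg//; apply: avg_bound => //; exact: smooth_cont.
have e1 := avg_error x h0 sa hM'; have e2 := avg_error x h0 sf hM.
by have := norm_tri4 e2 e1; congr (_ <= _); ring.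
Qed.

Lemma friedrichs_mol h K L : 0 < h -> 0 <= K -> K + h + h < L -> friedrichs K (K + h + h) L (mol h).
Proof.
move=> h0 K0 KL; have Kh : 0 <= K + h by lra.
have KL' : K + h < L by lra.
have K1 : K <= K + h + h by lra.
apply: (Friedrichs K0 K1 KL (bop_mol K h0)).
- by move=> f sf; exact: (smooth_mol h sf).
- by move=> f j sf; exact: derive1n_mol sf.
- move=> f g sf kf sg; have sa := smooth_avg h sf; have sg' := smooth_avg h sg.
  rewrite (Int_avg h0 Kh sa (supp_avg h0 (smooth_cont sf) kf) sg KL).
  by rewrite (Int_avg h0 K0 sf kf sg' KL').
move=> f sf kf; have sa := smooth_avg h sf.
apply: le_trans (Int_avg_sqr h0 Kh sa (supp_avg h0 (smooth_cont sf) kf) KL) _.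
exact: Int_avg_sqr h0 K0 sf kf KL'.
Qed.

Lemma friedrichs_id K L : 0 <= K -> K < L -> friedrichs K K L (fun f => f).
Proof. by move=> K0 KL; split => //; exact: bop_id. Qed.

(** The Taylor bound is evaluated at the minimum [y = x - a'(x) / (2 A)] of the parabola that
    dominates [a], where [a y >= 0]. *)
Lemma glaeser (a : R -> R) (A : R) x : smooth a -> (forall y, 0 <= a y) -> 0 < A ->
  (forall y, `|derive1n 2 a y| <= A) -> derive1n 1 a x ^+ 2 <= 4 * A * a x.
Proof.
move=> sa a0 A0 hA; set d := derive1n 1 a x; set y := x - d / (2 * A).
have := der_taylor x y (fun z => smooth_der0 z sa) (fun z => smooth_der 1 z sa) hA.
have e : y - x = - (d / (2 * A)) by rewrite /y; ring.
rewrite -/d e => /ler_normlP [_ h]; have := a0 y.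
have -> : 4 * A * a x = d ^+ 2 + 4 * A * (a x - d / (2 * A) * d + A * (- (d / (2 * A))) ^+ 2).
  by field; rewrite lt0r_neq0.
by move=> h2; rewrite lerDl; apply: mulr_ge0; lra.
Qed.

Lemma supp_bounds f n K : smooth f -> supp K f -> exists2 M : R, 0 <= M &
  forall i x, (i <= n)%N -> `|derive1n i f x| <= M.
Proof.
move=> sf kf; have [M M0 hM] := seg_bounds n K sf; exists M => // i x ij.
case: (leP `|x| K) => xK; first exact: hM.
by rewrite (supp_derive1n (K := K))// normr0.
Qed.

Variables (K0 : R) (a b1 b2 b3 : R -> R) (M2 : R).
Hypotheses (K00 : 0 <= K0) (sa : smooth a) (sb1 : smooth b1) (sb2 : smooth b2) (sb3 : smooth b3).
Hypotheses (ka : supp K0 a) (kb1 : supp K0 b1) (kb2 : supp K0 b2) (kb3 : supp K0 b3).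
Hypotheses (a0 : forall x, 0 <= a x) (M0 : 0 <= M2) (hb1 : forall x, b1 x ^+ 2 <= M2 * a x).

Lemma coefs_supp N : (0 < N)%N -> exists B La, coefs a b1 b2 b3 N B La M2.
Proof.
move=> N0.
(* Two more orders for [a], so that [a''] is bounded whatever the value of [N]. *)
have [Ba Ba0 hBa] := supp_bounds N.+2 sa ka; have [B1 B10 hB1] := supp_bounds N sb1 kb1.
have [B2 B20 hB2] := supp_bounds N sb2 kb2; have [B3 B30 hB3] := supp_bounds N sb3 kb3.
pose B := Ba + B1 + B2 + B3 + 1.
exists B, (4 * B); split.
- by split.
- by split => //; rewrite /B; lra.
- move=> i x iN; split.
  + by apply: le_trans (hBa i x (leq_trans iN (leqW (leqnSn N)))) _; rewrite /B; lra.
  + by apply: le_trans (hB1 i x iN) _; rewrite /B; lra.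
  + by apply: le_trans (hB2 i x iN) _; rewrite /B; lra.
  + by apply: le_trans (hB3 i x iN) _; rewrite /B; lra.
- by move=> x; split.
move=> _ x; apply: glaeser => //; first by rewrite /B; lra.
by move=> y; apply: le_trans (hBa 2 y _) _ => //; rewrite /B; lra.
Qed.

(** The coefficients [1 *] and [-1 *] reproduce the linear combinations of [bop_lin]. *)
Definition opA1 (U : R -> R) x : R :=
  1 * (1 * (a x * derive1n 1 (derive1n 1 U) x) + -1 * (b1 x * derive1n 1 U x)) + -1 * (b3 x * U x).
Definition opA2 (V : R -> R) x : R := 0 * V x + -1 * (b2 x * V x).

Lemma opAE U V x : opA a b1 b2 b3 U V x = 1 * opA1 U x + 1 * opA2 V x.
Proof. by rewrite /opA /opA1 /opA2 derive1nD; ring. Qed.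

Lemma bop_A1 K : bop K K0 2 opA1.
Proof.
have b := bop_comp (bop_D K) (bop_D K).
apply: bop_lin; first apply: bop_lin.
- exact: (bop_comp b (bop_mulK K sa ka)).
- have := bop_comp (bop_D K) (bop_mulK K sb1 kb1); exact: bop_sub.
- have := bop_comp (bop_id K) (bop_mulK K sb3 kb3); exact: bop_sub.
Qed.

Lemma bop_A2 K : bop K K0 0 opA2.
Proof.
have [h1 h2 h3 h4] := bop_lin 0 (-1) (bop_mulK K sb2 kb2) (bop_mulK K sb2 kb2).
have e f : (fun x => 0 * (b2 x * f x) + -1 * (b2 x * f x)) = opA2 f.
  by apply/funext => x; rewrite /opA2; ring.
split.
- by move=> f sf kf; rewrite -e; exact: h1.
- by move=> f sf kf; rewrite -e; exact: h2.
- by move=> f g c d sf kf sg kg; rewrite -!e; exact: h3.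
- by move=> j; have [C C0 hC] := h4 j; exists C => // f M sf kf; rewrite -e; exact: hC.
Qed.

Lemma opA_supp U V : supp K0 (opA a b1 b2 b3 U V).
Proof. by move=> x hx; rewrite /opA ka// kb1// kb2// kb3// !mul0r !subr0. Qed.

Definition regA h U V := mol h (opA a b1 b2 b3 (mol h U) (mol h V)).

(** For fixed [h] both parts lose no derivative: each derivative meets an average of its own.
    Multiplication by the coefficients returns to [[-K0, K0]], and the outer averages widen this by
    [2 h <= 2], so the radius [K0 + 2] is preserved. *)
Lemma regA_bop h : 0 < h -> h <= 1 -> exists B1 B2 : (R -> R) -> R -> R,
  [/\ bop (K0 + 2) (K0 + 2) 0 B1, bop (K0 + 2) (K0 + 2) 0 B2 &
   forall U V x, smooth U -> smooth V -> supp (K0 + 2) U -> supp (K0 + 2) V ->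
     regA h U V x = B1 U x + B2 V x].
Proof.
move=> h0 h1; set K := K0 + 2.
pose P2 f := derive1n 1 (avg h (derive1n 1 (avg h f))).
pose P1 f := derive1n 1 (avg h (avg h f)).
have bP2 : bop K (K + h + h) 0 P2 by have := bop_comp (bop_avgD K h0) (bop_avgD (K + h) h0).
have bP1 : bop K (K + h + h) 0 P1 by have := bop_comp (bop_avg K h0) (bop_avgD (K + h) h0).
have bP0 := bop_mol K h0.
have bm : bop K0 K 0 (mol h).
  by apply: bop_sub (bop_mol K0 h0) => //; rewrite /K; lra.
pose Q1 f x := 1 * (1 * (a x * P2 f x) + -1 * (b1 x * P1 f x)) + -1 * (b3 x * mol h f x).
have bQ1 : bop K K0 0 Q1.
  apply: bop_lin; first apply: bop_lin.
  - exact: (bop_comp bP2 (bop_mulK _ sa ka)).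
  - exact: (bop_comp bP1 (bop_mulK _ sb1 kb1)).
  - exact: (bop_comp bP0 (bop_mulK _ sb3 kb3)).
have bQ2 : bop K K0 0 (fun f => opA2 (mol h f)) by exact: (bop_comp bP0 (bop_A2 _)).
exists (fun f => mol h (Q1 f)), (fun f => mol h (opA2 (mol h f))).
split; [exact: (bop_comp bQ1 bm)|exact: (bop_comp bQ2 bm)|].
move=> U V x sU sV kU kV; rewrite /regA.
have e1 : opA a b1 b2 b3 (mol h U) (mol h V) = fun x => 1 * Q1 U x + 1 * opA2 (mol h V) x.
  apply/funext => y; rewrite opAE; congr (1 * _ + _); rewrite /opA1 /Q1 /P2 /P1 /mol.
  have sa1 := smooth_avg h sU.
  by rewrite [derive1n 1 (derive1n 1 _)](_ : _ = derive1n 1 (avg h (derive1n 1 (avg h U))))// (derive1n_avg _ 1 sa1).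
have [q1 q2 _ _] := bQ1; have [q3 q4 _ _] := bQ2; have [_ _ hm _] := bm.
rewrite e1 (hm _ _ 1 1 (q1 _ sU kU) (q2 _ sU kU) (q3 _ sV kV) (q4 _ sV kV)).
by rewrite !mul1r.
Qed.

(** Consistency of first order in [h]: the operator costs two derivatives and the averaging error a
    third, whence [j + 3]. *)
Lemma regA_error K j : exists2 C : R, 0 <= C & forall h U V (M : R), 0 < h -> h <= 1 ->
  smooth U -> smooth V -> supp K U -> supp K V ->
  (forall i x, (i <= j + 3)%N -> `|derive1n i U x| <= M /\ `|derive1n i V x| <= M) ->
  forall x, `|derive1n j (regA h U V) x - derive1n j (opA a b1 b2 b3 U V) x| <= C * (h * M).
Proof.
have [C1 C10 hC1] := bop_diff j (bop_A1 (K + 2)); have [C2 C20 hC2] := bop_diff j (bop_A2 (K + 2)).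
have [_ _ _ q1] := bop_A1 (K + 2); have [_ _ _ q2] := bop_A2 (K + 2).
have [D1 D10 hD1] := q1 j.+1; have [D2 D20 hD2] := q2 j.+1.
exists (2 * (C1 + C2 + D1 + D2)); first by rewrite mulr_ge0// !addr_ge0.
move=> h U V M h0 h1 sU sV kU kV hM x.
have K2 : K + h + h <= K + 2 by lra.
have [p1 p2 _ _] := bop_sub (lexx K) K2 (leqnn 0) (bop_mol K h0).
have [smU kmU] : smooth (mol h U) /\ supp (K + 2) (mol h U) by split; [exact: p1|exact: p2].
have [smV kmV] : smooth (mol h V) /\ supp (K + 2) (mol h V) by split; [exact: p1|exact: p2].
have kU2 : supp (K + 2) U by apply: supp_le kU; lra.
have kV2 : supp (K + 2) V by apply: supp_le kV; lra.
have M0' : 0 <= M by have [h' _] := hM 0%N 0 isT; exact: le_trans h'.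
have bM i y : (i <= j + 3)%N -> `|derive1n i (mol h U) y| <= M /\ `|derive1n i (mol h V) y| <= M.
  move=> ij; rewrite (derive1n_mol h i sU) (derive1n_mol h i sV).
  have sUi : smooth (derive1n i U) by smt.
  have sVi : smooth (derive1n i V) by smt.
  by split; [apply: (mol_bound _ h0 sUi)|apply: (mol_bound _ h0 sVi)] => z; have [] := hM i z ij.
have eM i y : (i <= j + 2)%N -> `|derive1n i (mol h U) y - derive1n i U y| <= 2 * h * M /\
    `|derive1n i (mol h V) y - derive1n i V y| <= 2 * h * M.
  move=> ij; rewrite (derive1n_mol h i sU) (derive1n_mol h i sV).
  have sUi : smooth (derive1n i U) by smt.
  have sVi : smooth (derive1n i V) by smt.
  split; [apply: (mol_error _ h0 sUi)|apply: (mol_error _ h0 sVi)] => z; rewrite derive1nD add1n.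
    by have [] := hM i.+1 z; rewrite // addn3 ltnS -addn2.
  by have [] := hM i.+1 z; rewrite // addn3 ltnS -addn2.
have opE U' V' : opA a b1 b2 b3 U' V' = fun x => 1 * opA1 U' x + 1 * opA2 V' x.
  by apply/funext => y; rewrite opAE.
have [s1 _ _ _] := bop_A1 (K + 2); have [s2 _ _ _] := bop_A2 (K + 2).
have D i U' V' y : smooth U' -> supp (K + 2) U' -> smooth V' -> supp (K + 2) V' ->
    derive1n i (opA a b1 b2 b3 U' V') y = derive1n i (opA1 U') y + derive1n i (opA2 V') y.
  move=> sU' kU' sV' kV'.
  by rewrite opE (derive1n_lin 1 1 i (s1 _ sU' kU') (s2 _ sV' kV')) !mul1r.
have sX : smooth (opA a b1 b2 b3 (mol h U) (mol h V)) by exact: (smooth_opA sa sb1 sb2 sb3 smU smV).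
have t1 : `|derive1n j (regA h U V) x - derive1n j (opA a b1 b2 b3 (mol h U) (mol h V)) x| <=
    2 * h * ((D1 + D2) * M).
  rewrite /regA (derive1n_mol h j sX); have sXj : smooth (derive1n j (opA a b1 b2 b3 (mol h U) (mol h V))) by smt.
  apply: (mol_error _ h0 sXj) => y; rewrite derive1nD add1n (D _ _ _ _ smU kmU smV kmV) mulrDl (le_trans (ler_normD _ _))// lerD//.
    by apply: (hD1 _ _ smU kmU) => i z ij; rewrite addSnnS in ij; have [] := bM i z ij.
  by apply: (hD2 _ _ smV kmV) => i z ij; have [] := bM i z; rewrite // (leq_trans ij)// addSnnS leq_add2l.
have t2 : `|derive1n j (opA a b1 b2 b3 (mol h U) (mol h V)) x - derive1n j (opA a b1 b2 b3 U V) x| <=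
    (C1 + C2) * (2 * h * M).
  rewrite (D _ _ _ _ smU kmU smV kmV) (D _ _ _ _ sU kU2 sV kV2) opprD addrACA mulrDl (le_trans (ler_normD _ _))// lerD//.
    by apply: (hC1 _ _ _ smU kmU sU kU2) => // i z ij; have [] := eM i z.
  by apply: (hC2 _ _ _ smV kmV sV kV2) => // i z ij; have [] := eM i z; rewrite // (leq_trans ij)// leq_add2l.
have := norm_tri4 t2 t1; congr (_ <= _); ring.
Qed.

End Regularization.

Arguments smooth_mol {R} h [f] _.

(** * Convergence of the regularized solutions *)

Section ExistenceCompact.
Context {R : realType}.
Implicit Types (u v w : R -> R -> R) (f g : R -> R) (K L t s x h : R).

Lemma It_add K w w' t x : ccurve K w -> ccurve K w' ->
  It (fun s x => w s x + w' s x) t x = It w t x + It w' t x.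
Proof.
move=> hw hw'; have c1 := ccurve_time 0 x hw; have c2 := ccurve_time 0 x hw'.
have := prim_lin 1 1 (Num.max 0 t) c1 c2; rewrite !mul1r => <-.
by congr (prim _ _); apply/funext => s; rewrite !mul1r.
Qed.

(** Sobolev's inequality costs one derivative, hence [j < N]; the factor 2 counts the orders [j] and
    [j.+1]. *)
Lemma dens_sup L a N (u v U : R -> R) j x : smooth a -> smooth u -> smooth v -> smooth U ->
  (forall x, 0 <= a x) -> supp (L - 1) u -> supp (L - 1) v -> 1 <= L -> (j < N)%N ->
  derive1n j u x ^+ 2 <= 2 * Int L (dens a N u v U) /\
  derive1n j v x ^+ 2 <= 2 * Int L (dens a N u v U).
Proof.
move=> sa su sv sU a0 ku kv L1 jN.
have L0 : 0 <= L by lra.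
have cd := cont_dens (N := N) sa su sv sU.
have le i : (i <= N)%N -> Int L (fun y => derive1n i u y ^+ 2) <= Int L (dens a N u v U) /\
    Int L (fun y => derive1n i v y ^+ 2) <= Int L (dens a N u v U).
  move=> iN; split; apply: Int_le => //; [by contt| |by contt|] => y _.
    by have [_ h _] := dens_term a0 u v U y iN.
  by have [h _ _] := dens_term a0 u v U y iN.
have LL : L - 1 + 1 = L by ring.
have L10 : 0 <= L - 1 by lra.
have [a1 a2] := le j (ltnW jN); have [a3 a4] := le j.+1 jN.
have sju : smooth (derive1n j u) by smt.
have sjv : smooth (derive1n j v) by smt.
split.
  have := Int_sobolev x sju (supp_derive1n j ku) L10.
  rewrite LL derive1nD add1n => h; apply: le_trans h _.
  by rewrite mulr_natl mulr2n; exact: lerD a1 a3.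
have := Int_sobolev x sjv (supp_derive1n j kv) L10.
rewrite LL derive1nD add1n => h; apply: le_trans h _.
by rewrite mulr_natl mulr2n; exact: lerD a2 a4.
Qed.

Lemma sumr_ord_const n (c : R) : \sum_(i < n) c = n%:R * c.
Proof. by rewrite sumr_const card_ord mulr_natl. Qed.

Lemma abs_le_sqr (y q : R) : 0 <= q -> y ^+ 2 <= q ^+ 2 -> `|y| <= q.
Proof.
move=> q0 h; rewrite -(ler_pXn2r (n := 2)) ?nnegrE//.
by rewrite real_normK ?num_real.
Qed.

Variables (K0 : R) (a b1 b2 b3 : R -> R) (M2 : R).
Hypotheses (K00 : 0 <= K0) (sa : smooth a) (sb1 : smooth b1) (sb2 : smooth b2) (sb3 : smooth b3).
Hypotheses (ka : supp K0 a) (kb1 : supp K0 b1) (kb2 : supp K0 b2) (kb3 : supp K0 b3).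
Hypotheses (a0 : forall x, 0 <= a x) (M0 : 0 <= M2) (hb1 : forall x, b1 x ^+ 2 <= M2 * a x).
Variables (g0 g1 : R -> R) (F : R -> R -> R).
Hypotheses (sg0 : smooth g0) (sg1 : smooth g1) (kg0 : supp K0 g0) (kg1 : supp K0 g1) (hF : ccurve K0 F).

(** Coefficients and data live in radius [K0], the regularized solutions in [K0 + 2], their averages
    in [K0 + 4]. The radius [L] exceeds all of these, with the margin 1 that [Int_sobolev]
    requires. *)
Let K := K0 + 2.
Let L := K0 + 6.
Let L0 : 0 <= L. Proof. by rewrite addr_ge0. Qed.
Let L1 : 1 <= L. Proof. by rewrite -[1]add0r lerD// ler1n. Qed.
Let kK f : supp K0 f -> supp K f. Proof. by apply: supp_le; rewrite /K; lra. Qed.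
Let kL f : supp K f -> supp (L - 1) f. Proof. by apply: supp_le; rewrite /K /L; lra. Qed.
Let A := opA a b1 b2 b3.

Let regA_ccurve h u v : 0 < h -> h <= 1 -> ccurve K u -> ccurve K v ->
  ccurve K (fun t => regA a b1 b2 b3 h (u t) (v t)).
Proof.
move=> h0 h1 hu hv; have [B1 [B2 [c1 c2 e]]] := regA_bop sa sb1 sb2 sb3 ka kb1 kb2 kb3 h0 h1.
have := ccurveD (bop_ccurve c1 hu) (bop_ccurve c2 hv); congr ccurve.
apply/funext => t; apply/funext => x; rewrite (e _ _ x (ccurve_smooth t hu) (ccurve_smooth t hv)) //.
  exact: (ccurve_supp t hu).
exact: (ccurve_supp t hv).
Qed.

Lemma opA_ccurve K' u v : ccurve K' u -> ccurve K' v ->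
  ccurve K0 (fun t => opA a b1 b2 b3 (u t) (v t)).
Proof.
move=> hu hv.
have := ccurve_lin 1 1 (bop_ccurve (bop_A1 sa sb1 sb3 ka kb1 kb3 K') hu)
  (bop_ccurve (bop_A2 sb2 kb2 K') hv); congr ccurve.
by apply/funext => t; apply/funext => x; rewrite opAE.
Qed.

(** Substituting [u = g0 + It v] leaves a Volterra equation for [v] alone, with [B1 g0 + F] as the
    source. *)
Lemma regularized_solution h : 0 < h -> h <= 1 -> exists u v, [/\ ccurve K u, ccurve K v,
  forall t x, u t x = g0 x + It v t x &
  forall t x, v t x = g1 x + It (fun s x => regA a b1 b2 b3 h (u s) (v s) x + F s x) t x].
Proof.
move=> h0 h1; have [B1 [B2 [c1 c2 e]]] := regA_bop sa sb1 sb2 sb3 ka kb1 kb2 kb3 h0 h1.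
have hFK : ccurve K F by apply: ccurve_le hF; rewrite /K; lra.
have [q1 q2 q3 _] := c1.
have hB0 : ccurve K (fun=> B1 g0) by apply: ccurve_cst; [exact: q1 sg0 (kK kg0)|exact: q2 sg0 (kK kg0)].
have hw := ccurveD hB0 hFK.
have hW := ccurve_It sg1 (kK kg1) hw.
have [v hv ev] := volterra c1 c2 hW.
pose u t x := g0 x + It v t x.
have hu : ccurve K u := ccurve_It sg0 (kK kg0) hv.
exists u, v; split => // t x; rewrite ev -addrA; congr (_ + _).
have hI := It_ccurve hv.
have h2 := ccurveD (bop_ccurve c1 hI) (bop_ccurve c2 hv).
rewrite -(It_add _ _ hw h2); congr It; apply/funext => s; apply/funext => y.
have [su sv] := (ccurve_smooth s hu, ccurve_smooth s hv).
have [ku kv] := (ccurve_supp s hu, ccurve_supp s hv).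
rewrite (e _ _ y su sv ku kv).
have -> : u s = fun x => 1 * g0 x + 1 * It v s x by apply/funext => z; rewrite !mul1r.
rewrite (q3 _ _ 1 1 sg0 (kK kg0) (ccurve_smooth s hI) (ccurve_supp s hI)).
by rewrite !mul1r; ring.
Qed.

Let frK h : 0 < h -> h <= 1 -> friedrichs K (K + h + h) L (mol h).
Proof. by move=> h0 h1; apply: friedrichs_mol => //; rewrite /K /L; have k := K00; lra. Qed.

(** The energy estimate of order [j.+1] has constants independent of [h], and Sobolev's inequality
    turns it into sup bounds of order [j]. For [t <= 0] the curves are frozen at time 0. *)
Lemma uniform_bounds j (T : R) : exists2 M : R, 0 <= M & forall h u v, 0 < h -> h <= 1 ->
  ccurve K u -> ccurve K v -> (forall t x, u t x = g0 x + It v t x) ->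
  (forall t x, v t x = g1 x + It (fun s x => regA a b1 b2 b3 h (u s) (v s) x + F s x) t x) ->
  forall t x, t <= T -> `|derive1n j (u t) x| <= M /\ `|derive1n j (v t) x| <= M.
Proof.
have [B [La hc]] := coefs_supp sa sb1 sb2 sb3 ka kb1 kb2 kb3 a0 M0 hb1 (ltn0Sn j).
have [Ba Ba0 hBa] := supp_bounds 0 sa ka.
have [G0 G00 hG0] := supp_bounds j.+2 sg0 kg0; have [G1 G10 hG1] := supp_bounds j.+1 sg1 kg1.
set T' := Num.max 0 T.
pose c := ecst j.+1 B La M2 + 2.
have c0 : 0 <= c by have := ecst_ge0 hc; rewrite /c; lra.
(* A bound on the initial energy over [[-L, L]] by sup norms of the data. Averaging [g0] does not
   increase these, so [I0] is free of [h]. *)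
pose I0 := 2 * L * (j.+2%:R * (G1 ^+ 2 + G0 ^+ 2 + Ba * G0 ^+ 2)).
pose P := prim (fun s => hnorm2 L j.+1 (F s)) T'.
pose Q := expR (c * T') * (I0 + P).
have cP := hnorm2_cont (N := j.+1) L0 hF.
have P0 s : 0 <= hnorm2 L j.+1 (F s) by exact: (hnorm2_ge0 j.+1 L0 (ccurve_smooth s hF)).
have PP t : 0 <= t <= T' -> 0 <= prim (fun s => hnorm2 L j.+1 (F s)) t <= P.
  move=> /andP[t0 tT]; apply/andP; split.
    by have := prim_mono cP t0 (fun s _ => P0 s); rewrite prim0.
  exact: prim_mono.
have Q0 : 0 <= 2 * Q.
  rewrite mulr_ge0// mulr_ge0 ?expR_ge0// addr_ge0//; last first.
    by have := PP T'; rewrite max0_ge lexx => /(_ isT) /andP[].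
  by rewrite /I0 !mulr_ge0// !addr_ge0 ?mulr_ge0 ?sqr_ge0.
exists (Num.sqrt (2 * Q)); first exact: sqrtr_ge0.
move=> h u v h0 h1 hu hv eu ev t x tT.
have hFK : ccurve K F by apply: ccurve_le hF; rewrite /K; lra.
have hR := regA_ccurve h0 h1 hu hv.
have hv' := ccurveD hR hFK.
have duv : dcurve u v.
  have := dcurve_It sg0 hv; congr dcurve.
  by apply/funext => s; apply/funext => y; rewrite eu.
have dvv : dcurve v (fun s x => regA a b1 b2 b3 h (u s) (v s) x + F s x).
  have := dcurve_It sg1 hv'; congr dcurve.
  by apply/funext => s; apply/funext => y; rewrite ev.
have kA s : supp K (A (mol h (u s)) (mol h (v s))).
  by apply: kK; exact: opA_supp.
have en := energy_estimate hc (frK h0 h1) hu hv hv' hFK duv dvv kA (fun _ _ _ => erefl).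
have u0 s : s <= 0 -> u s = u 0.
  by move=> s0; apply/funext => y; rewrite !eu !It_le0.
have v0 s : s <= 0 -> v s = v 0.
  by move=> s0; apply/funext => y; rewrite !ev !It_le0.
have eu0 : u 0 = g0 by apply/funext => y; rewrite eu It_le0// addr0.
have ev0 : v 0 = g1 by apply/funext => y; rewrite ev It_le0// addr0.
have su s := ccurve_smooth s hu; have sv s := ccurve_smooth s hv.
have smg := smooth_mol h sg0.
have i0 : Int L (dens a j.+1 (u 0) (v 0) (mol h (u 0))) <= I0.
  rewrite eu0 ev0 /I0 -Int_cst; apply: Int_le => //; [exact: (cont_dens sa sg0 sg1 smg)|by contt|].
  move=> y _; rewrite -sumr_ord_const /dens.
  apply: ler_sum => i _; have ij : (i <= j.+1)%N by rewrite -ltnS.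
  rewrite lerD//; first rewrite lerD//.
  - by apply: sqr_le_abs; exact: hG1.
  - by apply: sqr_le_abs; apply: hG0; exact: leqW.
  apply: ler_pM => //; [exact: sqr_ge0|exact: le_trans (ler_norm _) (hBa 0%N y isT)|].
  apply: sqr_le_abs; rewrite (derive1n_mol h _ sg0).
  have sgi : smooth (derive1n i.+1 g0) by smt.
  by apply: (mol_bound _ h0 sgi) => z; exact: hG0.
have fin s : 0 <= s <= T' -> Int L (dens a j.+1 (u s) (v s) (mol h (u s))) <= Q.
  move=> /andP[s0 sT]; apply: le_trans (en s s0) _.
  have p := PP s; rewrite s0 sT in p; have /andP[p0 p1] := p isT.
  apply: ler_pM; rewrite ?expR_ge0//.
  - apply: addr_ge0 => //; apply: Int_ge0 => //; first exact: (cont_dens sa (su 0) (sv 0) (smooth_mol h (su 0))).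
    by move=> y _; exact: dens_ge0.
  - by rewrite ler_expR ler_wpM2l.
  - by rewrite lerD.
have main s : 0 <= s <= T' -> `|derive1n j (u s) x| <= Num.sqrt (2 * Q) /\ `|derive1n j (v s) x| <= Num.sqrt (2 * Q).
  move=> hs.
  have [d1 d2] := dens_sup x sa (su s) (sv s) (smooth_mol h (su s)) a0 (kL (ccurve_supp s hu))
    (kL (ccurve_supp s hv)) L1 (ltnSn j).
  have f2 : 2 * Int L (dens a j.+1 (u s) (v s) (mol h (u s))) <= 2 * Q by rewrite ler_wpM2l// fin.
  by split; apply: abs_le_sqr; rewrite ?sqrtr_ge0// sqr_sqrtr//; [apply: le_trans d1 f2|apply: le_trans d2 f2].
case: (leP 0 t) => t0; first by apply: main; rewrite t0 le_max tT orbT.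
by rewrite (u0 t (ltW t0)) (v0 t (ltW t0)); apply: main; rewrite lexx max0_ge.
Qed.

(** The difference of two regularized solutions solves the equation of width [h] with zero data and
    the source [G = A_h (u', v') - A_h' (u', v')]. Both operators are close to the unregularized one
    on the uniformly bounded pair [(u', v')], so [G] is of size [h + h'], and the energy estimate
    carries this rate over to the difference. *)
Lemma difference_bound j (T : R) : exists2 Q : R, 0 <= Q & forall h h' u v u' v',
  0 < h -> h <= 1 -> 0 < h' -> h' <= 1 ->
  ccurve K u -> ccurve K v -> (forall t x, u t x = g0 x + It v t x) ->
  (forall t x, v t x = g1 x + It (fun s x => regA a b1 b2 b3 h (u s) (v s) x + F s x) t x) ->
  ccurve K u' -> ccurve K v' -> (forall t x, u' t x = g0 x + It v' t x) ->
  (forall t x, v' t x = g1 x + It (fun s x => regA a b1 b2 b3 h' (u' s) (v' s) x + F s x) t x) ->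
  forall t x, t <= T -> `|derive1n j (u t) x - derive1n j (u' t) x| <= Q * (h + h') /\
    `|derive1n j (v t) x - derive1n j (v' t) x| <= Q * (h + h').
Proof.
have [B [La hc]] := coefs_supp sa sb1 sb2 sb3 ka kb1 kb2 kb3 a0 M0 hb1 (ltn0Sn j).
set N := j.+1 in hc.
set T' := Num.max 0 T; have T0 : 0 <= T' := max0_ge T.
have [C C0 hC] : exists2 C : R, 0 <= C & forall i h U V (M : R), (i <= N)%N -> 0 < h -> h <= 1 ->
    smooth U -> smooth V -> supp K U -> supp K V ->
    (forall i x, (i <= N + 3)%N -> `|derive1n i U x| <= M /\ `|derive1n i V x| <= M) ->
    forall x, `|derive1n i (regA a b1 b2 b3 h U V) x - derive1n i (opA a b1 b2 b3 U V) x| <= C * (h * M).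
  elim: (N) => [|n [C C0 hC]].
    have [C C0 hC] := regA_error sa sb1 sb2 sb3 ka kb1 kb2 kb3 K 0.
    by exists C => // i h U V M; rewrite leqn0 => /eqP ->; exact: hC.
  have [C' C'0 hC'] := regA_error sa sb1 sb2 sb3 ka kb1 kb2 kb3 K n.+1.
  exists (C + C'); first exact: addr_ge0.
  move=> i h U V M iN h0 h1 sU sV kU kV hM x.
  have hM0 : 0 <= h * M by rewrite mulr_ge0 ?(ltW h0)//; have [h' _] := hM 0%N 0 isT; exact: le_trans h'.
  move: iN; rewrite leq_eqVlt ltnS => /predU1P[->|iN].
    by rewrite (le_trans (hC' h U V M h0 h1 sU sV kU kV hM x))// ler_wpM2r// lerDr.
  have hM' i' y : (i' <= n + 3)%N -> `|derive1n i' U y| <= M /\ `|derive1n i' V y| <= M.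
    by move=> hi; apply: hM; rewrite addSn leqW.
  by rewrite (le_trans (hC i h U V M iN h0 h1 sU sV kU kV hM' x))// ler_wpM2r// lerDl.
have [M M00 hM] : exists2 M : R, 0 <= M & forall i h u v, (i <= N + 3)%N -> 0 < h -> h <= 1 ->
  ccurve K u -> ccurve K v -> (forall t x, u t x = g0 x + It v t x) ->
  (forall t x, v t x = g1 x + It (fun s x => regA a b1 b2 b3 h (u s) (v s) x + F s x) t x) ->
  forall t x, t <= T' -> `|derive1n i (u t) x| <= M /\ `|derive1n i (v t) x| <= M.
  elim: (N + 3)%N => [|n [M M00 hM]].
    have [M M00 hM] := uniform_bounds 0 T'; exists M => // i h u v; rewrite leqn0 => /eqP ->.
    exact: hM.
  have [M' M'0 hM'] := uniform_bounds n.+1 T'; exists (M + M'); first exact: addr_ge0.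
  move=> i h u v iN h0 h1 hu hv eu ev t x tT.
  move: iN; rewrite leq_eqVlt ltnS => /predU1P[->|iN].
    have [p q] := hM' h u v h0 h1 hu hv eu ev t x tT.
    by split; [apply: le_trans p _|apply: le_trans q _]; rewrite lerDr.
  have [p q] := hM i h u v iN h0 h1 hu hv eu ev t x tT.
  by split; [apply: le_trans p _|apply: le_trans q _]; rewrite lerDl.
pose c := ecst N B La M2 + 2.
have c0 : 0 <= c by have := ecst_ge0 hc; rewrite /c; lra.
(* With zero data, the energy of the difference is at most [X (h + h')^2] up to time [T']: each of
   the [N + 1] derivatives of the source has size [C M (h + h')] on an interval of length [2 L]. *)
pose X := expR (c * T') * (T' * (N.+1%:R * (2 * L * (C * M) ^+ 2))).
have X0 : 0 <= X by rewrite /X mulr_ge0 ?expR_ge0// !mulr_ge0// ?sqr_ge0.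
exists (Num.sqrt (2 * X)); first exact: sqrtr_ge0.
move=> h h' u v u' v' h0 h1 h0' h1' hu hv eu ev hu' hv' eu' ev' t x tT.
have hFK : ccurve K F by apply: ccurve_le hF; rewrite /K; lra.
have su s := ccurve_smooth s hu; have sv s := ccurve_smooth s hv.
have su' s := ccurve_smooth s hu'; have sv' s := ccurve_smooth s hv'.
pose w t x := 1 * u t x + -1 * u' t x; pose z t x := 1 * v t x + -1 * v' t x.
have hw : ccurve K w := ccurve_lin 1 (-1) hu hu'.
have hz : ccurve K z := ccurve_lin 1 (-1) hv hv'.
have hR := regA_ccurve h0 h1 hu hv; have hR' := regA_ccurve h0' h1' hu' hv'.
have hRx := regA_ccurve h0 h1 hu' hv'.
have hd := ccurveD hR hFK; have hd' := ccurveD hR' hFK.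
pose z' t x := 1 * (regA a b1 b2 b3 h (u t) (v t) x + F t x) +
  -1 * (regA a b1 b2 b3 h' (u' t) (v' t) x + F t x).
have hz' : ccurve K z' := ccurve_lin 1 (-1) hd hd'.
pose G t x := 1 * regA a b1 b2 b3 h (u' t) (v' t) x + -1 * regA a b1 b2 b3 h' (u' t) (v' t) x.
have hG : ccurve K G := ccurve_lin 1 (-1) hRx hR'.
have duv : dcurve u v.
  have := dcurve_It sg0 hv; congr dcurve.
  by apply/funext => s; apply/funext => y; rewrite eu.
have duv' : dcurve u' v'.
  have := dcurve_It sg0 hv'; congr dcurve.
  by apply/funext => s; apply/funext => y; rewrite eu'.
have dvv : dcurve v (fun s x => regA a b1 b2 b3 h (u s) (v s) x + F s x).
  have := dcurve_It sg1 hd; congr dcurve.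
  by apply/funext => s; apply/funext => y; rewrite ev.
have dvv' : dcurve v' (fun s x => regA a b1 b2 b3 h' (u' s) (v' s) x + F s x).
  have := dcurve_It sg1 hd'; congr dcurve.
  by apply/funext => s; apply/funext => y; rewrite ev'.
have sd s := ccurve_smooth s hd; have sd' s := ccurve_smooth s hd'.
have dw : dcurve w z by exact: (dcurve_lin 1 (-1) su su' sv sv' duv duv').
have dz : dcurve z z' by exact: (dcurve_lin 1 (-1) sv sv' sd sd' dvv dvv').
have kA s : supp K (A (mol h (w s)) (mol h (z s))) by apply: kK; exact: opA_supp.
have eqz s y : 0 < s -> z' s y = mol h (A (mol h (w s)) (mol h (z s))) y + G s y.
  move=> _.
  have [B1 [B2 [c1 c2 e]]] := regA_bop sa sb1 sb2 sb3 ka kb1 kb2 kb3 h0 h1.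
  have kw := ccurve_supp s hw; have kz := ccurve_supp s hz.
  have ku := ccurve_supp s hu; have kv := ccurve_supp s hv.
  have ku' := ccurve_supp s hu'; have kv' := ccurve_supp s hv'.
  rewrite -[mol h _]/(regA a b1 b2 b3 h (w s) (z s)).
  rewrite (e _ _ y (ccurve_smooth s hw) (ccurve_smooth s hz) kw kz).
  have [_ _ l1 _] := c1; have [_ _ l2 _] := c2.
  rewrite /w /z (l1 _ _ 1 (-1) (su s) ku (su' s) ku') (l2 _ _ 1 (-1) (sv s) kv (sv' s) kv').
  rewrite /z' /G (e _ _ y (su s) (sv s) ku kv) (e _ _ y (su' s) (sv' s) ku' kv').
  by ring.
have en := energy_estimate hc (frK h0 h1) hw hz hz' hG dw dz kA eqz.
have eu0 : u 0 = g0 by apply/funext => y; rewrite eu It_le0// addr0.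
have ev0 : v 0 = g1 by apply/funext => y; rewrite ev It_le0// addr0.
have eu0' : u' 0 = g0 by apply/funext => y; rewrite eu' It_le0// addr0.
have ev0' : v' 0 = g1 by apply/funext => y; rewrite ev' It_le0// addr0.
have w0 : w 0 = fun=> 0 by apply/funext => y; rewrite /w eu0 eu0'; ring.
have z0 : z 0 = fun=> 0 by apply/funext => y; rewrite /z ev0 ev0'; ring.
have i0 : Int L (dens a N (w 0) (z 0) (mol h (w 0))) = 0.
  rewrite w0 z0 (bop0 (bop_mol K h0)) (_ : dens _ _ _ _ _ = fun=> 0) ?Int0//.
  by apply/funext => y; rewrite /dens big1// => i _; rewrite !derive1n_cst0 !expr0n mulr0 !addr0.
have hh : 0 <= h + h' by lra.
have gb s y i : (i <= N)%N -> 0 <= s <= T' -> `|derive1n i (G s) y| <= C * M * (h + h').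
  move=> iN /andP[s0 sT].
  have bd i' y' : (i' <= N + 3)%N -> `|derive1n i' (u' s) y'| <= M /\ `|derive1n i' (v' s) y'| <= M.
    by move=> hi; exact: (hM i' h' u' v' hi h0' h1' hu' hv' eu' ev' s y' sT).
  have e1 := hC i h (u' s) (v' s) M iN h0 h1 (su' s) (sv' s) (ccurve_supp s hu') (ccurve_supp s hv') bd y.
  have e2 := hC i h' (u' s) (v' s) M iN h0' h1' (su' s) (sv' s) (ccurve_supp s hu') (ccurve_supp s hv') bd y.
  rewrite /G (derive1n_lin 1 (-1) i (ccurve_smooth s hRx) (ccurve_smooth s hR')) mul1r mulN1r.
  have := norm_tri2 e1 e2; congr (_ <= _); ring.
have sG s := ccurve_smooth s hG.
have cG := hnorm2_cont (N := N) L0 hG.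
have hGn s : 0 <= s <= T' -> hnorm2 L N (G s) <= N.+1%:R * (2 * L * (C * M * (h + h')) ^+ 2).
  move=> hs; rewrite /hnorm2 -sumr_ord_const; apply: ler_sum => i _.
  rewrite -Int_cst; have sGs := sG s; apply: Int_le => //; [by contt|by contt|].
  by move=> y _; apply: sqr_le_abs; apply: gb => //; rewrite -ltnS.
have fin s : 0 <= s <= T' -> Int L (dens a N (w s) (z s) (mol h (w s))) <= X * (h + h') ^+ 2.
  move=> /andP[s0 sT]; apply: le_trans (en s s0) _; rewrite i0 add0r.
  have -> : X * (h + h') ^+ 2 = expR (c * T') * (T' * (N.+1%:R * (2 * L * (C * M * (h + h')) ^+ 2))).
    by rewrite /X; ring.
  have p0 r : 0 <= hnorm2 L N (G r) by exact: (hnorm2_ge0 N L0 (sG r)).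
  apply: ler_pM; rewrite ?expR_ge0//.
  - by have := prim_mono cG s0 (fun s _ => p0 s); rewrite prim0.
  - by rewrite ler_expR ler_wpM2l.
  apply: (@le_trans _ _ (prim (fun s => hnorm2 L N (G s)) T')).
    by apply: prim_mono.
  by rewrite -[T' * _]prim_cst; apply: prim_le => //; contt.
have sw s := ccurve_smooth s hw; have sz s := ccurve_smooth s hz.
have main s : 0 <= s <= T' -> `|derive1n j (u s) x - derive1n j (u' s) x| <= Num.sqrt (2 * X) * (h + h') /\
    `|derive1n j (v s) x - derive1n j (v' s) x| <= Num.sqrt (2 * X) * (h + h').
  move=> hs.
  have [d1 d2] := dens_sup x sa (sw s) (sz s) (smooth_mol h (sw s)) a0 (kL (ccurve_supp s hw))
    (kL (ccurve_supp s hz)) L1 (ltnSn j).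
  have f2 : 2 * Int L (dens a N (w s) (z s) (mol h (w s))) <= (Num.sqrt (2 * X) * (h + h')) ^+ 2.
    by rewrite exprMn sqr_sqrtr ?mulr_ge0// -mulrA ler_wpM2l// fin.
  have q0 : 0 <= Num.sqrt (2 * X) * (h + h') by rewrite mulr_ge0 ?sqrtr_ge0.
  have e1 := derive1n_lin 1 (-1) j (su s) (su' s); have e2 := derive1n_lin 1 (-1) j (sv s) (sv' s).
  have {}d1 := le_trans d1 f2; have {}d2 := le_trans d2 f2.
  rewrite /w e1 mul1r mulN1r in d1; rewrite /z e2 mul1r mulN1r in d2.
  by split; apply: abs_le_sqr.
case: (leP 0 t) => t0; first by apply: main; rewrite t0 le_max tT orbT.
have r0 : u t = u 0 by apply/funext => y; rewrite !eu !It_le0// ltW.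
have r1 : v t = v 0 by apply/funext => y; rewrite !ev !It_le0// ltW.
have r2 : u' t = u' 0 by apply/funext => y; rewrite !eu' !It_le0// ltW.
have r3 : v' t = v' 0 by apply/funext => y; rewrite !ev' !It_le0// ltW.
by rewrite r0 r1 r2 r3; apply: main; rewrite lexx max0_ge.
Qed.

(** The limit is taken in the integrated equations, so that no convergence of time derivatives is
    involved; [u] is followed up to order 2 and [v] up to order 0, as the operator demands. *)
Theorem existence_compact : exists u v, [/\ ccurve K u, ccurve K v,
  forall t x, u t x = g0 x + It v t x &
  forall t x, v t x = g1 x + It (fun s x => opA a b1 b2 b3 (u s) (v s) x + F s x) t x].
Proof.
pose h n : R := n.+1%:R^-1.
have h0 n : 0 < h n by rewrite invr_gt0 ltr0n.
have h1 n : h n <= 1 by rewrite invf_le1 ?ltr0n// ler1n.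
have ex n : exists p : (R -> R -> R) * (R -> R -> R), [/\ ccurve K p.1, ccurve K p.2,
  forall t x, p.1 t x = g0 x + It p.2 t x &
  forall t x, p.2 t x = g1 x + It (fun s x => regA a b1 b2 b3 (h n) (p.1 s) (p.2 s) x + F s x) t x].
  by have [u [v H]] := regularized_solution (h0 n) (h1 n); exists (u, v).
pose p n := projT1 (cid (ex n)).
have hp n := projT2 (cid (ex n)); rewrite -/p in hp.
pose U n := (p n).1; pose V n := (p n).2.
have hU n : ccurve K (U n) by have [] := hp n.
have hV n : ccurve K (V n) by have [] := hp n.
have eU n t x : U n t x = g0 x + It (V n) t x by have [_ _ e _] := hp n; exact: e.
have eV n t x : V n t x = g1 x + It (fun s x => regA a b1 b2 b3 (h n) (U n s) (V n s) x + F s x) t x.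
  by have [_ _ _ e] := hp n; exact: e.
have small (Q e : R) : 0 <= Q -> 0 < e -> exists N, forall n, (N <= n)%N -> Q * h n <= e.
  move=> Q0 e0; exists (Num.truncn (Q / e)) => n Nn.
  rewrite ler_pdivrMr ?ltr0n// mulrC -ler_pdivrMr//.
  by apply: ltW; apply: lt_le_trans (truncnS_gt _) _; rewrite ler_nat.
have cau j T (e : R) : 0 < e -> exists N, forall n m, (N <= n)%N -> (N <= m)%N -> forall t x, t <= T ->
    `|derive1n j (U n t) x - derive1n j (U m t) x| <= e /\ `|derive1n j (V n t) x - derive1n j (V m t) x| <= e.
  move=> e0; have [Q Q0 hQ] := difference_bound j T.
  have e2 : 0 < e / 2 by lra.
  have [N hN] := small Q (e / 2) Q0 e2; exists N => n m Nn Nm t x tT.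
  have [q1 q2] := hQ (h n) (h m) (U n) (V n) (U m) (V m) (h0 n) (h1 n) (h0 m) (h1 m)
    (hU n) (hV n) (eU n) (eV n) (hU m) (hV m) (eU m) (eV m) t x tT.
  have : Q * (h n + h m) <= e by rewrite mulrDr [e]splitr lerD// hN.
  by move=> le; split; [exact: le_trans q1 le|exact: le_trans q2 le].
have cU : ucauchy U.
  by move=> j T e e0; have [N hN] := cau j T e e0; exists N => n m Nn Nm t x tT; have [] := hN n m Nn Nm t x tT.
have cV : ucauchy V.
  by move=> j T e e0; have [N hN] := cau j T e e0; exists N => n m Nn Nm t x tT; have [] := hN n m Nn Nm t x tT.
have [u hu lu] := ucauchy_cvg hU cU; have [v hv lv] := ucauchy_cvg hV cV.
have hFK : ccurve K F by apply: ccurve_le hF; rewrite /K; lra.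
have hAK : ccurve K (fun t => opA a b1 b2 b3 (u t) (v t)).
  by apply: ccurve_le (opA_ccurve hu hv); rewrite /K; lra.
have hd := ccurveD hAK hFK.
exists u, v; split => // t x; apply/eqP; rewrite -subr_eq0 -normr_le0; apply: le_eps => e e0; rewrite add0r;
  set T := Num.max 0 t; have T0 : 0 <= T := max0_ge t;
  have tT : t <= T by rewrite /T le_max lexx orbT.
  pose d := e / (1 + T); have D0 : 0 < 1 + T by lra.
  have d0 : 0 < d by exact: divr_gt0.
  have [N1 l1] := lu 0 T d d0; have [N2 l2] := lv 0 T d d0.
  pose n := maxn N1 N2.
  have k1 := l1 n (leq_maxl _ _) t x tT.
  have k2 : `|derive1n 0 (It (V n) t) x - derive1n 0 (It v t) x| <= T * d.
    by apply: (It_diff_cst (hV n) hv) => s /andP[s0 sT]; apply: l2 => //; exact: leq_maxr.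
  have -> : u t x - (g0 x + It v t x) = - (derive1n 0 (U n t) x - derive1n 0 (u t) x) +
      (derive1n 0 (It (V n) t) x - derive1n 0 (It v t) x).
    by rewrite !derive1n0 eU; ring.
  rewrite (le_trans (ler_normD _ _))// normrN (le_trans (lerD k1 k2))//.
  by rewrite -[X in X + _]mul1r -mulrDl mulrC divfK// lt0r_neq0.
have [Ce Ce0 hCe] := regA_error sa sb1 sb2 sb3 ka kb1 kb2 kb3 K 0.
have [D1 D10 hD1] := bop_diff 0 (bop_A1 sa sb1 sb3 ka kb1 kb3 K).
have [D2 D20 hD2] := bop_diff 0 (bop_A2 sb2 kb2 K).
have [M M00 hM] : exists2 M : R, 0 <= M & forall i n t x, (i <= 3)%N -> t <= T ->
    `|derive1n i (U n t) x| <= M /\ `|derive1n i (V n t) x| <= M.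
  elim: 3%N => [|i [M M00 hM]].
    have [M M00 hM] := uniform_bounds 0 T; exists M => // i n s y; rewrite leqn0 => /eqP ->.
    exact: (hM (h n) _ _ (h0 n) (h1 n) (hU n) (hV n) (eU n) (eV n)).
  have [M' M'0 hM'] := uniform_bounds i.+1 T; exists (M + M'); first exact: addr_ge0.
  move=> i' n s y; rewrite leq_eqVlt ltnS => /predU1P[->|iN] sT.
    have [p1 q1] := hM' (h n) _ _ (h0 n) (h1 n) (hU n) (hV n) (eU n) (eV n) s y sT.
    by split; [apply: le_trans p1 _|apply: le_trans q1 _]; rewrite lerDr.
  have [p1 q1] := hM i' n s y iN sT.
  by split; [apply: le_trans p1 _|apply: le_trans q1 _]; rewrite lerDl.
(* With all errors at most [d], the defect of the second equation is at most [d S]: one [d] for [v],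
   and under the time integral [d] for consistency and [D1 d], [D2 d] for the two parts of the
   operator. *)
pose S := 1 + T * (1 + D1 + D2).
have S0 : 0 < S by rewrite ltr_wpDr// mulr_ge0// !addr_ge0.
pose d := e / S; have d0 : 0 < d by exact: divr_gt0.
have [N0 l0] := small (Ce * M) d (mulr_ge0 Ce0 M00) d0.
have [N1 l1] : exists N, forall n, (N <= n)%N -> forall i s y, (i <= 2)%N -> s <= T ->
    `|derive1n i (U n s) y - derive1n i (u s) y| <= d.
  elim: 2%N => [|i [N hN]].
    have [N hN] := lu 0 T d d0; exists N => n Nn i s y; rewrite leqn0 => /eqP ->; exact: hN.
  have [N' hN'] := lu i.+1 T d d0; exists (maxn N N') => n; rewrite geq_max => /andP[Nn Nn'] i' s y.
  by rewrite leq_eqVlt ltnS => /predU1P[->|iN] sT; [exact: hN'|exact: hN].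
have [N2 l2] := lv 0 T d d0.
pose n := maxn N0 (maxn N1 N2).
have n0 : (N0 <= n)%N by exact: leq_maxl.
have n1 : (N1 <= n)%N by rewrite leq_max leq_max leqnn orbT.
have n2 : (N2 <= n)%N by rewrite leq_max leq_max leqnn !orbT.
have hRn := regA_ccurve (h0 n) (h1 n) (hU n) (hV n).
have hdn := ccurveD hRn hFK.
have k1 := l2 n n2 t x tT.
have k2 : `|derive1n 0 (It (fun s x => regA a b1 b2 b3 (h n) (U n s) (V n s) x + F s x) t) x -
    derive1n 0 (It (fun s x => opA a b1 b2 b3 (u s) (v s) x + F s x) t) x| <= T * ((1 + D1 + D2) * d).
  apply: (It_diff_cst hdn hd) => s /andP[s0 sT]; rewrite !derive1n0.
  have sU := ccurve_smooth s (hU n); have sV := ccurve_smooth s (hV n).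
  have kU := ccurve_supp s (hU n); have kV := ccurve_supp s (hV n).
  have su := ccurve_smooth s hu; have sv := ccurve_smooth s hv.
  have ku := ccurve_supp s hu; have kv := ccurve_supp s hv.
  have r1 := hCe (h n) (U n s) (V n s) M (h0 n) (h1 n) sU sV kU kV (fun i y hi => hM i n s y hi sT) x.
  have r2 := hD1 (U n s) (u s) d sU kU su ku (fun i y hi => l1 n n1 i s y hi sT) 0%N x (leqnn 0).
  have r3' i y : (i <= 0 + 0)%N -> `|derive1n i (V n s) y - derive1n i (v s) y| <= d.
    by rewrite leqn0 => /eqP ->; exact: l2.
  have r3 := hD2 (V n s) (v s) d sV kV sv kv r3' 0%N x (leqnn 0).
  rewrite !derive1n0 in r1 r2 r3.
  have -> : regA a b1 b2 b3 (h n) (U n s) (V n s) x + F s x - (opA a b1 b2 b3 (u s) (v s) x + F s x) =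
    (regA a b1 b2 b3 (h n) (U n s) (V n s) x - opA a b1 b2 b3 (U n s) (V n s) x) +
    ((opA1 a b1 b3 (U n s) x - opA1 a b1 b3 (u s) x) + (opA2 b2 (V n s) x - opA2 b2 (v s) x)).
    by rewrite !opAE; ring.
  have -> : (1 + D1 + D2) * d = d + (D1 * d + D2 * d) by ring.
  rewrite (le_trans (ler_normD _ _))// lerD//.
    by apply: le_trans r1 _; rewrite [h n * M]mulrC mulrA; exact: l0.
  by rewrite (le_trans (ler_normD _ _))// lerD.
have -> : v t x - (g1 x + It (fun s x => opA a b1 b2 b3 (u s) (v s) x + F s x) t x) =
  - (derive1n 0 (V n t) x - derive1n 0 (v t) x) +
  (derive1n 0 (It (fun s x => regA a b1 b2 b3 (h n) (U n s) (V n s) x + F s x) t) x -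
    derive1n 0 (It (fun s x => opA a b1 b2 b3 (u s) (v s) x + F s x) t) x).
  by rewrite !derive1n0 eV; ring.
rewrite (le_trans (ler_normD _ _))// normrN (le_trans (lerD k1 k2))//.
have -> : d + T * ((1 + D1 + D2) * d) = d * S by rewrite /S; ring.
by rewrite divfK// lt0r_neq0.
Qed.

End ExistenceCompact.

(** * Finite speed of propagation *)

Section FiniteSpeed.
Context {R : realType}.
Implicit Types (u v w : R -> R -> R) (f g : R -> R) (K L t s x y h : R).

(** The square makes the positive part continuously differentiable, with a remainder of at most
    [h^2]; the weight can thus be differentiated in time and in space. *)
Definition sqp y : R := Num.max y 0 ^+ 2.
Definition dsqp y : R := 2 * Num.max y 0.

Lemma sqp_quad y h : `|sqp (y + h) - sqp y - h * dsqp y| <= h ^+ 2.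
Proof.
rewrite /sqp /dsqp ler_norml; case: (leP (y + h) 0); case: (leP y 0) => h1 h2; apply/andP; split; nra.
Qed.

Lemma sqp_der y : der sqp y (dsqp y).
Proof.
apply: (@der_quad _ _ _ _ 1) => z; have := sqp_quad y (z - y).
by have -> : y + (z - y) = z; [ring|rewrite mul1r].
Qed.

Lemma sqp_ge0 y : 0 <= sqp y. Proof. exact: sqr_ge0. Qed.
Lemma dsqp_ge0 y : 0 <= dsqp y. Proof. by rewrite mulr_ge0// le_max lexx orbT. Qed.
Lemma sqp0 y : y <= 0 -> sqp y = 0. Proof. by move=> h; rewrite /sqp max_r// expr0n. Qed.
Lemma sqp_gt0 y : 0 < y -> 0 < sqp y. Proof. by move=> h; rewrite /sqp max_l ?ltW// exprn_gt0. Qed.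

Lemma dsqp_cont : continuous dsqp.
Proof.
move=> y; apply/cvgrPdist_le => e e0.
have e2 : 0 < e / 2 by lra.
have := near_dist y e2; apply: filterS => z hz; apply: (@le_trans _ _ (2 * `|z - y|)); last by lra.
rewrite /dsqp -mulrBr normrM ger0_norm// ler_wpM2l//.
have := ler_norm (z - y); have := ler_norm (y - z); rewrite (distrC y z) => k1 k2.
by case: (leP y 0); case: (leP z 0) => z0 y0; rewrite ler_norml; apply/andP; split; lra.
Qed.

(** The primitive of [f] is monotone with equal end values, hence constant, and its derivative [f]
    vanishes. *)
Lemma Int_zero L f x : continuous f -> (forall y, `|y| <= L -> 0 <= f y) -> Int L f <= 0 ->
  `|x| < L -> f x = 0.
Proof.
move=> cf f0 i0 xL; have L0 : 0 <= L by exact: le_trans (ltW xL).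
have mono y z : - L <= y -> y <= z -> z <= L -> prim f y <= prim f z.
  move=> Ly yz zL; apply: prim_mono => // w /andP[h1 h2]; apply: f0.
  by rewrite ler_norml; apply/andP; split; lra.
rewrite IntE in i0.
have flat y : `|y| < L -> prim f y = prim f (- L).
  move=> /ltW; rewrite ler_norml => /andP[h1 h2].
  by have := mono _ _ (lexx _) h1 h2; have := mono _ _ h1 h2 (lexx _); lra.
have d1 := prim_der x cf.
have d2 : der (prim f) x 0.
  apply/der_eps => e e0; apply/nbhs_ballP; exists (L - `|x|); first by rewrite /= subr_gt0.
  move=> y; rewrite /ball /= => hy.
  have yL : `|y| < L.
    have := ler_normB x (x - y); rewrite (_ : x - (x - y) = y); last by ring.
    by lra.
  by rewrite !flat// subrr mulr0 subr0 normr0 mulr_ge0 ?normr_ge0// ltW.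
exact: der_unique d1 d2.
Qed.

(** Young's inequality for [sqrt a p] and [q], with one factor [sqrt a <= c] left over. This factor
    is the propagation speed: it bounds the flux by [c] times the density. *)
Lemma weighted_young (a c p q : R) : 0 <= a -> a <= c ^+ 2 -> 0 <= c ->
  `|2 * (a * (p * q))| <= c * (a * p ^+ 2 + q ^+ 2).
Proof.
move=> a0 ac c0.
have sc : Num.sqrt a <= c by rewrite -[c]ger0_norm// -sqrtr_sqr ler_wsqrtr.
have [r [r0 rc ->]] : exists r : R, [/\ 0 <= r, r <= c & a = r ^+ 2].
  by exists (Num.sqrt a); rewrite sqrtr_ge0 sqr_sqrtr.
apply: (@le_trans _ _ (r * (r ^+ 2 * p ^+ 2 + q ^+ 2))); last first.
  by rewrite ler_wpM2r// addr_ge0 ?sqr_ge0// mulr_ge0 ?sqr_ge0.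
have -> : 2 * (r ^+ 2 * (p * q)) = r * (2 * (r * p * q)) by ring.
rewrite normrM (ger0_norm r0) ler_wpM2l// ler_norml.
have h1 := sqr_ge0 (r * p - q); have h2 := sqr_ge0 (r * p + q).
by apply/andP; split; nra.
Qed.

Lemma flux_bound a N (U V : R -> R) c x : 0 <= a x -> a x <= c ^+ 2 -> 0 <= c ->
  `|flux a N U V x| <= c * dens a N U V U x.
Proof.
move=> a0 ac c0; rewrite /flux /dens mulr_sumr (le_trans (ler_norm_sum _ _ _))//.
apply: ler_sum => j _.
move: (derive1n j V x) (derive1n j U x) (derive1n j.+1 U x) => q r p.
apply: le_trans (weighted_young p q a0 ac c0) _.
by rewrite ler_wpM2l// addrC lerD2r lerDl sqr_ge0.
Qed.

Variables (a b1 b2 b3 : R -> R) (B La M2 c R0 K : R) (u v v' F : R -> R -> R).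
Hypotheses (hc : coefs a b1 b2 b3 1 B La M2) (c0 : 0 <= c) (ac : forall x, a x <= c ^+ 2).
Hypotheses (K0 : 0 <= K) (hu : ccurve K u) (hv : ccurve K v) (hv' : ccurve K v').
Hypotheses (sF : forall t, smooth (F t)) (kF : forall t, supp R0 (F t)).
Hypotheses (ku : supp R0 (u 0)) (kv : supp R0 (v 0)) (duv : dcurve u v) (dvv : dcurve v v').
Hypothesis (eqv : forall t x, 0 < t -> v' t x = opA a b1 b2 b3 (u t) (v t) x + F t x).

(* The weight (s x - R0 - c t)_+^2, with s = 1 or s = -1, moves at the maximal speed. *)
Lemma finite_speed_half (sg : R) : sg ^+ 2 = 1 -> forall t x, 0 <= t -> R0 + c * t < sg * x ->
  u t x = 0 /\ v t x = 0.
Proof.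
move=> sg1 t1 x1 t10 hx1.
have nsg : `|sg| = 1.
  by apply/eqP; rewrite -(@eqrXn2 _ 2) ?ler01// real_normK ?num_real// sg1 expr1n.
pose L := K + `|x1| + 1; have L0 : 0 <= L by rewrite /L; have := K0; have := normr_ge0 x1; lra.
have KL : K < L by rewrite /L; have := normr_ge0 x1; lra.
have x1L : `|x1| < L by rewrite /L; have := K0; lra.
pose y t x := sg * x + (- R0 - c * t).
pose W t x := sqp (y t x).
pose e t := dens a 1 (u t) (v t) (u t).
have su s := ccurve_smooth s hu; have sv s := ccurve_smooth s hv; have sv' s := ccurve_smooth s hv'.
have [[sa sb1 sb2 sb3] [_ B0 La0 M0] _ ha _] := hc.
have a0 x : 0 <= a x by have [] := ha x.
have ce s : continuous (e s) by exact: (cont_dens sa (su s) (sv s) (su s)).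
have cde s : continuous (ddens a 1 (v' s) (v s) (u s) (v s) (u s)).
  exact: (cont_ddens sa (sv' s) (sv s) (su s) (sv s) (su s)).
have cy s : continuous (y s) by rewrite /y; contt.
have dW s x : der (W s) x (sg * dsqp (y s x)).
  by apply: der_aff; exact: sqp_der.
have cW s : continuous (W s) by exact: (der_cont (dW s)).
have cdW s : continuous (fun x => dsqp (y s x)) by exact: (cont_comp dsqp_cont (cy s)).
have uW s : udiff L s W (fun x => - c * dsqp (y s x)).
  move=> e0 e00; have d0 : 0 < e0 / (c ^+ 2 + 1) by rewrite divr_gt0// ltr_wpDl ?sqr_ge0.
  have := near_dist s d0; apply: filterS => r hr x _.
  rewrite /W; have -> : y r x = y s x + - c * (r - s) by rewrite /y; ring.
  have := sqp_quad (y s x) (- c * (r - s)).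
  rewrite (_ : - c * (r - s) * dsqp (y s x) = (r - s) * (- c * dsqp (y s x))); last by ring.
  move=> /le_trans; apply.
  rewrite exprMn sqrrN -[(r - s) ^+ 2]real_normK ?num_real// expr2 [`|_| ^+ 2]expr2 mulrA.
  rewrite ler_wpM2r//; apply: (@le_trans _ _ (c * c * (e0 / (c ^+ 2 + 1)))).
    by rewrite ler_wpM2l// mulr_ge0.
  have C1 : c ^+ 2 + 1 != 0 by rewrite lt0r_neq0// ltr_wpDl ?sqr_ge0.
  have := divfK C1 e0; move: (e0 / _) d0 => d d0 {hr} de; nra.
pose E s := Int L (fun x => W s x * e s x).
pose E' s := Int L (fun x => - c * dsqp (y s x) * e s x + W s x * ddens a 1 (v' s) (v s) (u s) (v s) (u s) x).
have dE s : 0 < s -> der E s (E' s).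
  move=> s0; apply: (@udiff_Int _ L s (fun s x => W s x * e s x)) => //.
  - by move=> r; have := cW r; have := ce r => h1 h2; contt.
  - by have h1 := cW s; have h2 := ce s; have h3 := cdW s; have h4 := cde s; contt.
  have h3 := cdW s.
  have c1 : continuous (fun x => - c * dsqp (y s x)) by contt.
  apply: (udiffM (cW s) (ce s) c1 (cde s) (uW s)).
  exact: (udiff_dens L 1 sa hu hv hv' hu hv duv dvv duv s0).
have cE : continuous E.
  move=> s; apply: (@ucont_Int _ L s (fun s x => W s x * e s x)) => //.
    by move=> r; have := cW r; have := ce r => h1 h2; contt.
  apply: ucontM => //; last exact: (ucont_dens L 1 s sa hu hv hu).
  move=> e0 e00; have [M hM] := cont_seg_bound L (cdW s).
  have h2 := uW s 1 ltr01.
  pose d := e0 / (1 + c * `|M|); have D0 : 0 < 1 + c * `|M| by rewrite ltr_wpDr// mulr_ge0.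
  have d0 : 0 < d by exact: divr_gt0.
  have := near_dist s d0; move: h2; apply: filterS2 => r h2 hr x xL.
  have := h2 x xL; rewrite mul1r => /(norm_tri1 (b := (r - s) * (- c * dsqp (y s x)))) h3.
  apply: (le_trans (h3 (`|r - s| * (c * `|M|)) _)).
    rewrite (normrM (r - s)) (normrM (- c)) normrN (ger0_norm c0) ler_wpM2l// ler_wpM2l//.
    by apply: le_trans (hM x xL) (ler_norm _).
  have -> : `|r - s| * (c * `|M|) + `|r - s| = `|r - s| * (1 + c * `|M|) by ring.
  by rewrite -ler_pdivlMr.
have ec0 := ecst_ge0 hc.
(* The weight vanishes for [|x| <= R0], and there alone can the source be non-zero. *)
have WF s j x : 0 <= s -> W s x * derive1n j (F s) x = 0.
  move=> s0; case: (leP `|x| R0) => xR.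
    rewrite /W sqp0 ?mul0r// /y.
    have h1 : sg * x <= R0 by rewrite (le_trans (ler_norm _))// normrM nsg mul1r.
    have h2 : 0 <= c * s by rewrite mulr_ge0.
    by lra.
  by rewrite (supp_derive1n j (kF s)) ?mulr0.
have hE s : 0 < s -> E' s <= (ecst 1 B La M2 + 2) * E s + 0.
  move=> s0; rewrite addr0 /E' /E.
  pose A := opA a b1 b2 b3 (u s) (v s).
  have sA : smooth A by exact: (smooth_opA sa sb1 sb2 sb3 (su s) (sv s)).
  have h1 := cW s; have h2 := ce s; have h3 := cdW s; have h4 := cde s.
  have h5 := cont_dflux (N := 1) sa (su s) (sv s).
  have fl x := flux_der 1 sa (su s) (sv s) x.
  have h6 := der_cont fl.
  have z : Int L (fun x => sg * dsqp (y s x) * flux a 1 (u s) (v s) x + W s x * dflux a 1 (u s) (v s) x) = 0.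
    rewrite (Int_der L (G := fun x => W s x * flux a 1 (u s) (v s) x)); last 2 first.
    - by contt.
    - by move=> x; exact: (derM (dW s x) (fl x)).
    have zz q : K < `|q| -> flux a 1 (u s) (v s) q = 0.
      move=> hq; rewrite /flux big1// => j _.
      by rewrite (supp_derive1n (K := K) _ (ccurve_supp s hu))// mul0r !mulr0.
    by rewrite !zz ?normrN ?(ger0_norm L0)// !mulr0 subrr.
  have -> : (ecst 1 B La M2 + 2) * Int L (fun x => W s x * e s x) =
      (ecst 1 B La M2 + 2) * Int L (fun x => W s x * e s x) +
      Int L (fun x => sg * dsqp (y s x) * flux a 1 (u s) (v s) x + W s x * dflux a 1 (u s) (v s) x).
    by rewrite z addr0.
  rewrite -IntZ; last by contt.
  rewrite -IntD; [|by contt|by contt].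
  apply: Int_le => //; [by contt|by contt|] => x _.
  have st := coefs_static x hc (su s) (sv s).
  rewrite -/A in st.
  have W0 : 0 <= W s x := sqp_ge0 _.
  have e0 : 0 <= e s x by exact: dens_ge0.
  have fb : `|flux a 1 (u s) (v s) x| <= c * e s x by exact: flux_bound.
  (* The decay of the weight in time, at rate [c dsqp], pays for the flux through its gradient. *)
  have te1 : - c * dsqp (y s x) * e s x <= sg * dsqp (y s x) * flux a 1 (u s) (v s) x.
    have := ler_wpM2l (dsqp_ge0 (y s x)) fb.
    rewrite -[X in X * _ <= _](ger0_norm (dsqp_ge0 (y s x))) -normrM -[X in X <= _]mul1r -nsg -normrM.
    by move=> /ler_normlP [+ _]; lra.
  have te2 : W s x * ddens a 1 (v' s) (v s) (u s) (v s) (u s) x <=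
      W s x * (dflux a 1 (u s) (v s) x + ecst 1 B La M2 * e s x + 2 * e s x).
    have -> : W s x * ddens a 1 (v' s) (v s) (u s) (v s) (u s) x =
        W s x * (\sum_(j < 2) (2 * (derive1n j A x * derive1n j (v s) x) +
          2 * (a x * (derive1n j.+1 (u s) x * derive1n j.+1 (v s) x))) +
          \sum_(j < 2) 2 * (derive1n j (u s) x * derive1n j (v s) x)).
      rewrite -big_split /= /ddens !mulr_sumr; apply: eq_bigr => j _.
      have -> : derive1n j (v' s) x = derive1n j A x + derive1n j (F s) x.
        have -> : v' s = fun x => A x + F s x by apply/funext => q; exact: eqv.
        by rewrite derive1n_D; [reflexivity|exact: sA|exact: sF].
      have := WF s j x (ltW s0).
      move: (derive1n j (F s) x) (derive1n j A x) (derive1n j (v s) x) (derive1n j (u s) x) => f p q r.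
      move: (a x * _) => z' hf.
      have -> : W s x * (2 * ((p + f) * q) + 2 * (r * q) + 2 * z') =
          W s x * (2 * (p * q) + 2 * z' + 2 * (r * q)) + 2 * (W s x * f) * q by ring.
      by rewrite hf mulr0 mul0r addr0.
    rewrite ler_wpM2l// lerD//.
    rewrite /e /dens mulr_sumr; apply: ler_sum => j _.
    have h7 := sqr_ge0 (derive1n j (u s) x - derive1n j (v s) x).
    have h8 : 0 <= a x * derive1n j.+1 (u s) x ^+ 2 by rewrite mulr_ge0 ?sqr_ge0.
    move: (a x * _) (derive1n j (u s) x) (derive1n j (v s) x) h7 h8 => q1 q2 q3 h7 h8.
    have := sqr_ge0 q2; have := sqr_ge0 q3; nra.
  by have := lerD te1 te2; rewrite mulrDl; lra.
have E0 : E 0 = 0.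
  rewrite /E (_ : (fun x => _) = fun=> 0) ?Int0//; apply/funext => x.
  case: (leP `|x| R0) => xR.
    rewrite /W sqp0 ?mul0r// /y mulr0 subr0.
    have h1 : sg * x <= R0 by rewrite (le_trans (ler_norm _))// normrM nsg mul1r.
    by lra.
  rewrite /e /dens big1 ?mulr0// => j _.
  rewrite (supp_derive1n j kv xR) (supp_derive1n j ku xR) (supp_derive1n j.+1 ku xR).
  by rewrite !expr0n mulr0 !addr0.
have ec2 : 0 <= ecst 1 B La M2 + 2 by lra.
have := gronwall cE (@cont_cst R 0) dE ec2 (fun _ _ => lexx 0) hE t10.
rewrite E0 prim_cst mulr0 addr0 mulr0 => Et.
have cWe : continuous (fun x => W t1 x * e t1 x).
  by have h1 := cW t1; have h2 := ce t1; contt.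
have := Int_zero cWe (fun z _ => mulr_ge0 (sqp_ge0 _) (dens_ge0 1 a0 _ _ _ _)) Et x1L.
have Wp : 0 < W t1 x1.
  by apply: sqp_gt0; move: hx1; rewrite /y -subr_gt0 opprD addrA.
move=> /eqP; rewrite mulf_eq0 (gt_eqF Wp) /= => /eqP ez.
have [h1 h2 _] := dens_term (N := 1) a0 (u t1) (v t1) (u t1) x1 (leq0n 1).
rewrite -/(e t1 x1) ez !derive1n0 in h1 h2.
by split; apply/eqP; rewrite -sqrf_eq0 eq_le sqr_ge0 andbT.
Qed.

Lemma finite_speed t : 0 <= t -> supp (R0 + c * t) (u t) /\ supp (R0 + c * t) (v t).
Proof.
move=> t0.
suff h x : R0 + c * t < `|x| -> u t x = 0 /\ v t x = 0 by split=> x /h [].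
case: (lerP 0 x) => x0 hx.
  by apply: (finite_speed_half (expr1n _ 2) t0); rewrite mul1r -(ger0_norm x0).
have s1 : (-1 : R) ^+ 2 = 1 by rewrite sqrrN expr1n.
by apply: (finite_speed_half s1 t0); rewrite mulN1r -(ltr0_norm x0).
Qed.

End FiniteSpeed.

(** * Existence for general coefficients *)

Section Existence.
Context {R : realType}.
Implicit Types (u v w : R -> R -> R) (f g : R -> R) (K L t s x y h : R).

(** The speed is [c = Ba + 1], because [a <= Ba <= c^2]. The cutoff enters [a] squared and [b1]
    once, so that [b1^2 <= M2 a] persists with the same [M2]. The derivative [v'] is returned as a
    curve on all of R, whereas the original equation holds up to time [T]. *)
Theorem existence (chi : R -> R) (a b1 b2 b3 g0 g1 : R -> R) (F : R -> R -> R) (Ba M2 R0 T : R) :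
  smooth a -> smooth b1 -> smooth b2 -> smooth b3 ->
  (forall x, 0 <= a x) -> (forall x, a x <= Ba) -> 0 <= M2 -> (forall x, b1 x ^+ 2 <= M2 * a x) ->
  0 <= R0 -> 0 <= T -> smooth g0 -> supp R0 g0 -> smooth g1 -> supp R0 g1 -> ccurve R0 F ->
  smooth chi -> supp (R0 + (Ba + 1) * T + 2) chi -> (forall x, chi x ^+ 2 <= 1) ->
  (forall x, `|x| <= R0 + (Ba + 1) * T -> chi x = 1) ->
  exists K u v v', [/\ 0 <= K, ccurve K u /\ ccurve K v, ccurve K v',
    (forall t x, u t x = g0 x + It v t x) /\ (forall t x, v t x = g1 x + It v' t x) &
    forall t x, 0 <= t <= T -> v' t x = opA a b1 b2 b3 (u t) (v t) x + F t x].
Proof.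
move=> sa sb1 sb2 sb3 a0 aB M0 hb R00 T0 sg0 kg0 sg1 kg1 hF schi kchi chile chi1.
set c := Ba + 1 in kchi chi1; have Ba0 : 0 <= Ba := le_trans (a0 0) (aB 0).
have c0 : 0 <= c by rewrite /c; lra.
pose a' x := chi x * (chi x * a x); pose b1' x := chi x * b1 x.
pose b2' x := chi x * b2 x; pose b3' x := chi x * b3 x.
set r := R0 + c * T in chi1 kchi; have r0 : 0 <= r by rewrite /r addr_ge0// mulr_ge0.
set K0 := r + 2 in kchi; have K00 : 0 <= K0 by rewrite /K0; lra.
have sup f : supp K0 (fun x => chi x * f x) by move=> x hx; rewrite kchi// mul0r.
have sa' : smooth a' by rewrite /a'; smt.
have sb1' : smooth b1' by rewrite /b1'; smt.
have sb2' : smooth b2' by rewrite /b2'; smt.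
have sb3' : smooth b3' by rewrite /b3'; smt.
have a'E x : a' x = chi x ^+ 2 * a x by rewrite /a'; ring.
have a'0 x : 0 <= a' x by rewrite a'E mulr_ge0 ?sqr_ge0.
have hb' x : b1' x ^+ 2 <= M2 * a' x.
  by rewrite /b1' exprMn a'E (mulrCA M2); apply: ler_wpM2l => //; exact: sqr_ge0.
have RK : R0 <= K0 by rewrite /K0 /r; have := mulr_ge0 c0 T0; lra.
have [u [v [hu hv eu ev]]] := existence_compact K00 sa' sb1' sb2' sb3' (sup _) (sup _) (sup _) (sup _)
  a'0 M0 hb' sg0 sg1 (supp_le RK kg0) (supp_le RK kg1) (ccurve_le RK hF).
pose K := K0 + 2; have K0' : 0 <= K by rewrite /K; lra.
have hFK : ccurve K F by apply: ccurve_le hF; rewrite /K; lra.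
have hA : ccurve K0 (fun t => opA a' b1' b2' b3' (u t) (v t)).
  exact: (opA_ccurve sa' sb1' sb2' sb3' (sup _) (sup _) (sup _) (sup _) hu hv).
have K0K : K0 <= K by rewrite /K; lra.
have hv' := ccurveD (ccurve_le K0K hA) hFK.
exists K, u, v, (fun t x => opA a' b1' b2' b3' (u t) (v t) x + F t x); split => //.
move=> t x /andP[t0 tT]; congr (_ + _).
have [B [La hc]] := coefs_supp sa' sb1' sb2' sb3' (sup _) (sup _) (sup _) (sup _) a'0 M0 hb' (ltn0Sn 0).
have ac y : a' y <= c ^+ 2.
  rewrite a'E; apply: (@le_trans _ _ (1 * a y)); first by rewrite ler_wpM2r.
  by rewrite mul1r; have := aB y; rewrite /c; nra.
have duv : dcurve u v.
  have := dcurve_It sg0 hv; congr dcurve.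
  by apply/funext => s; apply/funext => y; rewrite eu.
have dvv : dcurve v (fun t x => opA a' b1' b2' b3' (u t) (v t) x + F t x).
  have := dcurve_It sg1 hv'; congr dcurve.
  by apply/funext => s; apply/funext => y; rewrite ev.
have u0 : u 0 = g0 by apply/funext => y; rewrite eu It_le0// addr0.
have v0 : v 0 = g1 by apply/funext => y; rewrite ev It_le0// addr0.
have sF s := ccurve_smooth s hF; have kF s := ccurve_supp s hF.
have ku : supp R0 (u 0) by rewrite u0.
have kv : supp R0 (v 0) by rewrite v0.
have [fu fv] := finite_speed hc c0 ac K0' hu hv hv' sF kF ku kv duv dvv (fun _ _ _ => erefl) t0.
have le1 : R0 + c * t <= r by rewrite /r lerD2l ler_wpM2l.
(* Inside, the cutoff is 1; outside, [u t] and [v t] vanish, so both operators give 0. *)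
case: (leP `|x| r) => xr.
  by rewrite /opA /a' /b1' /b2' /b3' (chi1 x xr) !mul1r.
have xr' : R0 + c * t < `|x| by exact: le_lt_trans xr.
rewrite /opA (supp_derive1n 2 fu xr') (supp_derive1n 1 fu xr') (fu x xr') (fv x xr').
by rewrite !mulr0 !subr0.
Qed.

End Existence.

(** * Smooth cutoff functions *)

Section Bump.
Context {R : realType}.
Implicit Types (f g : R -> R) (x y z : R) (p q : {poly R}).

Lemma horner_le_exp p : forall l : R, 0 < l ->
  exists2 M : R, 0 <= M & forall z, 0 <= z -> `|p.[z]| <= M * expR (l * z).
Proof.
elim/poly_ind: p => [|p c IH] l l0.
  by exists 0 => // z z0; rewrite horner0 normr0 mul0r.
have l2 : 0 < l / 2 by lra.
have [M M0 hM] := IH _ l2; exists (M * (2 / l) + `|c|).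
  by rewrite addr_ge0// mulr_ge0// divr_ge0// ltW.
move=> z z0; rewrite hornerMXaddC mulrDl (le_trans (ler_normD _ _))// lerD//; last first.
  by rewrite ler_peMr// -expR0 ler_expR mulr_ge0// ltW.
rewrite normrM (ger0_norm z0).
have -> : expR (l * z) = expR (l / 2 * z) * expR (l / 2 * z).
  by rewrite -expRD; congr expR; lra.
rewrite mulrACA ler_pM ?hM//.
have h := expR_ge1Dx (l / 2 * z).
rewrite mulrAC ler_pdivlMr//; lra.
Qed.

(** Functions of the form [p(1/x) e^(-1/x)], extended by 0, are closed under differentiation: [p]
    becomes [X^2 (p - p')]. Treating all polynomials [p] at once makes smoothness immediate. *)
Definition expinv p x : R := if 0 < x then p.[x^-1] * expR (- x^-1) else 0.

Lemma der_expinv p x : der (expinv p) x (expinv ('X^2 * (p - p^`())) x).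
Proof.
have nonpos q z : z <= 0 -> expinv q z = 0 by rewrite /expinv leNgt => /negbTE ->.
have [x0|x0|->] := ltrgtP x 0.
- rewrite (nonpos _ _ (ltW x0)).
  apply/der_eps => e e0; near=> y.
  have y0 : y < 0 by near: y; exact: lt_nbhsl.
  by rewrite !nonpos ?(ltW y0) ?(ltW x0)// mulr0 !subr0 normr0 mulr_ge0 ?normr_ge0 ?(ltW e0).
- have xn : x != 0 by rewrite gt_eqF.
  have hi : der (fun y : R => y^-1) x (- x ^- 2).
    have h : der (fun y : R => y^-1) x (- x ^- 2 *: 1) by exact: (is_deriveV xn (der_id x)).
    by rewrite scaler1 in h.
  have hp : der (fun y => p.[y^-1]) x (p^`().[x^-1] * - x ^- 2).
    apply: der_comp hi; have := is_derive_poly p x^-1; exact.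
  have he : der (fun y => expR (- y^-1)) x (expR (- x^-1) * x ^- 2).
    apply: (der_comp (f := expR)); first exact: is_derive_expR.
    by have := derN hi; rewrite opprK.
  have := derM hp he => /der_eps h; apply/der_eps => e e0; near=> y.
  have y0 : 0 < y by near: y; exact: lt_nbhsr.
  have : `|p.[y^-1] * expR (- y^-1) - p.[x^-1] * expR (- x^-1) - (y - x) *
    (p^`().[x^-1] * - x ^- 2 * expR (- x^-1) + p.[x^-1] * (expR (- x^-1) * x ^- 2))| <= e * `|y - x|.
    by near: y; exact: h.
  rewrite /expinv x0 y0 hornerM hornerXn hornerD hornerN.
  congr (`|_ - (y - x) * _| <= _); rewrite exprVn; ring.
- rewrite (nonpos _ 0)//.
  (* At 0: as [z^2 p(z) e^(-z)] is bounded for [z >= 0], taking [z = 1/y] shows that the function is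
     at most [M y^2], so its derivative is 0. *)
  have [M M0 hM] := horner_le_exp ('X^2 * p) ltr01.
  apply: (@der_quad _ _ _ _ M) => y; rewrite /expinv ltxx !subr0 mulr0 subr0.
  case: ltP => y0; last by rewrite normr0 mulr_ge0 ?sqr_ge0.
  have yi : 0 < y^-1 by rewrite invr_gt0.
  have := hM _ (ltW yi); rewrite mul1r hornerM hornerXn normrM normrM expRN.
  have Ep : 0 < expR y^-1 by exact: expR_gt0.
  rewrite (ger0_norm (ltW yi)) normrM [`|(expR _)^-1|]ger0_norm ?invr_ge0 ?(ltW Ep)//.
  move=> h; rewrite ler_pdivrMr// mulrAC.
  have -> : `|p.[y^-1]| = y^-1 * y^-1 * `|p.[y^-1]| * y ^+ 2 by field; rewrite gt_eqF.
  by apply: ler_wpM2r => //; exact: sqr_ge0.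
Unshelve. all: by end_near. Qed.

Lemma smooth_expinv p : smooth (expinv p).
Proof.
apply: (family_smooth (F := fun n => expinv (iter n (fun p => 'X^2 * (p - p^`())) p))).
by move=> n x; exact: der_expinv.
Qed.

(** The normalized primitive of the bump [b(x) b(1 - x)], where [b] is the flat exponential. *)
Theorem smooth_step : exists s : R -> R, [/\ smooth s, forall x, 0 <= s x <= 1,
  forall x, x <= 0 -> s x = 0 & forall x, 1 <= x -> s x = 1].
Proof.
pose b := expinv 1; have sb : smooth b by exact: smooth_expinv.
pose w x := b x * b (-1 * x + 1).
have sw : smooth w.
  have h : smooth (fun x => b (-1 * x + 1)) by exact: (@smooth_aff _ _ (-1) 1 sb).
  exact (smoothM sb h).
have b0 x : 0 <= b x by rewrite /b /expinv; case: ifP => // _; rewrite hornerC mul1r expR_ge0.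
have bz x : x <= 0 -> b x = 0 by rewrite /b /expinv leNgt => /negbTE ->.
have bp x : 0 < x -> 0 < b x by rewrite /b /expinv => ->; rewrite hornerC mul1r expR_gt0.
have w0 x : 0 <= w x by rewrite mulr_ge0.
have cw := smooth_cont sw; have dW x := prim_der x cw.
have mono x y : x <= y -> prim w x <= prim w y.
  by move=> xy; apply: prim_mono => // z _; exact: w0.
have neg x : x <= 0 -> prim w x = 0.
  move=> x0; have := mvt x0 (fun z _ => dW z) (prim_cont cw).
  move=> [z /andP[_ z0]]; rewrite prim0 /w (bz z z0) !mul0r; lra.
have big x : 1 <= x -> prim w x = prim w 1.
  move=> x1; have := mvt x1 (fun z _ => dW z) (prim_cont cw).
  move=> [z /andP[z1 _]]; rewrite /w (bz (-1 * z + 1)) ?mulr0 ?mul0r; lra.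
have c0 : 0 < prim w 1.
  have h : (4^-1 : R) <= 3 / 4 by lra.
  have [z /andP[h1 h2] e] := mvt h (fun z _ => dW z) (prim_cont cw).
  have wz : 0 < w z by rewrite /w mulr_gt0// bp//; lra.
  have m1 : prim w 0 <= prim w 4^-1 by apply: mono; lra.
  have m2 : prim w (3 / 4) <= prim w 1 by apply: mono; lra.
  rewrite prim0 in m1; nra.
exists (fun x => (prim w 1)^-1 * prim w x); split.
- exact (@smoothZ _ _ (prim w 1)^-1 (smooth_prim sw)).
- move=> x; apply/andP; split.
    rewrite mulr_ge0 ?invr_ge0 ?(ltW c0)//; case: (leP x 0) => [/neg -> //|x0].
    by rewrite -(prim0 w) mono// ltW.
  rewrite mulrC ler_pdivrMr// mul1r; case: (leP x 1) => [|/ltW /big -> //]; exact: mono.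
- by move=> x /neg ->; rewrite mulr0.
- by move=> x /big ->; rewrite mulVf// gt_eqF.
Qed.

Lemma cutoff (r : R) : exists chi : R -> R, [/\ smooth chi, supp (r + 1) chi,
  forall x, chi x ^+ 2 <= 1 & forall x, `|x| <= r -> chi x = 1].
Proof.
have [s [ss s01 s0 s1]] := smooth_step.
exists (fun x => s (1 * x + (r + 1)) * s (-1 * x + (r + 1))); split.
- have h1 : smooth (fun x => s (1 * x + (r + 1))) by exact: (@smooth_aff _ _ 1 (r + 1) ss).
  have h2 : smooth (fun x => s (-1 * x + (r + 1))) by exact: (@smooth_aff _ _ (-1) (r + 1) ss).
  exact (smoothM h1 h2).
- move=> x; rewrite ltr_normr => /orP[] h; first by rewrite (s0 (-1 * x + _)) ?mulr0//; lra.
  by rewrite s0 ?mul0r//; lra.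
- move=> x; have /andP[h1 h2] := s01 (1 * x + (r + 1)).
  have /andP[h3 h4] := s01 (-1 * x + (r + 1)).
  by rewrite exprMn mulr_ile1 ?sqr_ge0// expr_le1.
- by move=> x; rewrite ler_norml => /andP[h1 h2]; rewrite !s1 ?mulr1//; lra.
Qed.

End Bump.

(** * Square integrable functions and Sobolev norms *)

Section L2Theory.
Context {R : realType}.
Local Notation mu := (@lebesgue_measure R).
Implicit Types (u v w f g : R -> R) (K L e t x y : R).

Lemma Lnorm2E w : ('N[mu]_2%:E [EFin \o w] ^+ 2 = \int[mu]_x (w x ^+ 2)%:E)%E.
Proof.
rewrite unlock /Lnorm.
have -> : (\int[mu]_x `|(EFin \o w) x| `^ 2 = \int[mu]_x (w x ^+ 2)%:E)%E.
  by apply: eq_integral => x _; rewrite /= powR_mulrn// real_normK ?num_real.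
have : (0 <= \int[mu]_x (w x ^+ 2)%:E)%E.
  by apply: integral_ge0 => x _; rewrite lee_fin sqr_ge0.
move: (\int[mu]_x _)%E => [r|_|//]; last first.
  by rewrite poweRyr ?invr_eq0// expe2 mulyy.
rewrite lee_fin => r0; rewrite poweR_EFin powR12_sqrt// expe2 -EFinM.
by rewrite -expr2 sqr_sqrtr.
Qed.

Lemma L2P w : L2 w <-> measurable_fun setT w /\ (\int[mu]_x (w x ^+ 2)%:E < +oo)%E.
Proof.
have h : ('N[mu]_2%:E [EFin \o w] < +oo)%E <-> (\int[mu]_x (w x ^+ 2)%:E < +oo)%E.
  rewrite -Lnorm2E; have := Lnorm_ge0 mu 2%:E (EFin \o w).
  by case: ('N[mu]_2%:E [EFin \o w])%E => [r _|_|//]; rewrite expe2 ?mulyy// -EFinM !ltry.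
split.
  move=> hw; have : w \in Lfun mu 2%:E by exact: hw.
  by case/andP; rewrite !inE/= => mw /h.
move=> -[mw /h fw]; suff : w \in Lfun mu 2%:E by [].
by apply/andP; rewrite !inE.
Qed.

Lemma L2_meas w : L2 w -> measurable_fun setT w. Proof. by move=> /L2P[]. Qed.

Lemma L2_sqr w : L2 w -> mu.-integrable setT (EFin \o (fun x => w x ^+ 2)).
Proof.
move=> /L2P[mw h]; apply/integrableP; split.
  by apply/measurable_EFinP; exact: measurable_funX.
apply: le_lt_trans h; apply: ge0_le_integral => //.
- by apply: measurableT_comp => //; apply/measurable_EFinP; exact: measurable_funX.
- by apply/measurable_EFinP; exact: measurable_funX.
- by move=> x _ /=; rewrite ger0_norm ?sqr_ge0.
Qed.

Lemma L2_mul u v : L2 u -> L2 v -> mu.-integrable setT (EFin \o (fun x => u x * v x)).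
Proof.
move=> hu hv.
have := integrableD measurableT (L2_sqr hu) (L2_sqr hv); apply: le_integrable => //.
  by apply/measurable_EFinP; apply: measurable_funM; exact: L2_meas.
move=> x _ /=; rewrite lee_fin [X in _ <= X]ger0_norm ?addr_ge0 ?sqr_ge0// normrM.
rewrite -[u x ^+ 2]real_normK ?num_real// -[v x ^+ 2]real_normK ?num_real//.
have := sqr_ge0 (`|u x| - `|v x|); have := normr_ge0 (u x); have := normr_ge0 (v x).
nra.
Qed.

Lemma L2_lin u v (a b : R) : L2 u -> L2 v -> L2 (fun x => a * u x + b * v x).
Proof.
move=> hu hv; apply/L2P.
have mz : measurable_fun setT (fun x => a * u x + b * v x).
  by apply: measurable_funD; apply: measurable_funM => //; exact: L2_meas.
split => //.
have := integrableD measurableT (integrableZl measurableT (2 * a ^+ 2) (L2_sqr hu))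
  (integrableZl measurableT (2 * b ^+ 2) (L2_sqr hv)).
move=> /(integrable_lty measurableT) h; apply: le_lt_trans h.
apply: ge0_le_integral => //.
- by move=> x _; rewrite lee_fin sqr_ge0.
- by apply/measurable_EFinP; exact: measurable_funX.
- apply: emeasurable_funD; apply: emeasurable_funM => //; apply/measurable_EFinP;
    apply: measurable_funX; exact: L2_meas.
move=> x _ /=; rewrite lee_fin.
have := sqr_ge0 (a * u x - b * v x); lra.
Qed.

Lemma L2_supp K f : continuous f -> supp K f -> L2 f.
Proof.
move=> cf kf; apply/L2P; split.
  exact: continuous_measurable_fun.
have : mu.-integrable setT (EFin \o (fun x => f x ^+ 2)).
  apply: (@supp_integrable _ K); first exact: contX.
  by move=> x /kf ->; rewrite expr0n.
exact: (integrable_lty measurableT).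
Qed.

Lemma L2B u v : L2 u -> L2 v -> L2 (fun x => u x - v x).
Proof.
move=> hu hv; have := L2_lin 1 (-1) hu hv; congr L2.
by apply/funext => x; rewrite mul1r mulN1r.
Qed.

Lemma pair_lin u v w (a b : R) : L2 u -> L2 v -> L2 w ->
  \int[mu]_x ((a * u x + b * v x) * w x) = a * \int[mu]_x (u x * w x) + b * \int[mu]_x (v x * w x).
Proof.
move=> hu hv hw; have h1 := L2_mul hu hw; have h2 := L2_mul hv hw.
rewrite -RintegralZl// -RintegralZl// -RintegralD//; first last.
- exact: (integrableZl measurableT b h2).
- exact: (integrableZl measurableT a h1).
by apply: eq_Rintegral => x _; ring.
Qed.

Lemma pairC u v : \int[mu]_x (u x * v x) = \int[mu]_x (v x * u x).
Proof. by apply: eq_Rintegral => x _; rewrite mulrC. Qed.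

Lemma pairB u v w : L2 u -> L2 v -> L2 w ->
  \int[mu]_x ((u x - v x) * w x) = \int[mu]_x (u x * w x) - \int[mu]_x (v x * w x).
Proof.
move=> hu hv hw; have := pair_lin 1 (-1) hu hv hw; rewrite mul1r mulN1r => <-.
by apply: eq_Rintegral => x _; rewrite mul1r mulN1r.
Qed.

Lemma pair_cs u v (a b : R) : L2 u -> L2 v -> 0 <= a -> 0 <= b ->
  (\int[mu]_x (u x ^+ 2)%:E <= (a ^+ 2)%:E)%E -> (\int[mu]_x (v x ^+ 2)%:E <= (b ^+ 2)%:E)%E ->
  `|\int[mu]_x (u x * v x)| <= a * b.
Proof.
move=> hu hv a0 b0 ha hb; have huv := L2_mul hu hv.
have nrm w c : 0 <= c -> (\int[mu]_x (w x ^+ 2)%:E <= (c ^+ 2)%:E)%E ->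
    ('N[mu]_2%:E [EFin \o w] <= c%:E)%E.
  move=> c0; rewrite -Lnorm2E; have := Lnorm_ge0 mu 2%:E (EFin \o w).
  case: ('N[mu]_2%:E [EFin \o w])%E => [r|_|//]; last by rewrite expe2 mulyy leye_eq.
  by rewrite expe2 -EFinM -expr2 !lee_fin => r0; rewrite ler_pXn2r.
rewrite -lee_fin EFin_normr_Rintegral//.
have /measurable_int muv := huv.
apply: le_trans (le_abse_integral mu measurableT muv) _.
have := @hoelder _ _ _ mu u v 2 2 (L2_meas hu) (L2_meas hv).
rewrite Lnorm1 => h; apply: le_trans (h _ _ _) _ => //; first by lra.
by rewrite EFinM lee_pmul ?Lnorm_ge0 ?nrm.
Qed.

End L2Theory.

(** * The fundamental lemma of the calculus of variations *)

Section Fundamental.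
Context {R : realType}.
Local Notation mu := (@lebesgue_measure R).
Implicit Types (u v w f g : R -> R) (K L e t x y : R).

Lemma L2_abs_integrable w (a b : R) : L2 w -> mu.-integrable `[a, b] (EFin \o w).
Proof.
move=> hw; have mw := L2_meas hw.
have h1 : mu.-integrable `[a, b] (EFin \o (fun x => w x ^+ 2)).
  by apply: integrableS (L2_sqr hw).
have h2 : mu.-integrable `[a, b] (EFin \o (fun=> 1 : R)).
  by apply: cont_integrable; exact: cont_cst.
apply: (le_integrable _ _ _ (integrableD _ h1 h2)) => //.
  by apply/measurable_EFinP; apply: measurable_funTS.
move=> x _ /=; rewrite lee_fin [X in _ <= X]ger0_norm ?addr_ge0 ?sqr_ge0//.
rewrite -[w x ^+ 2]real_normK ?num_real//.
have := sqr_ge0 (`|w x| - 1); have := normr_ge0 (w x); nra.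
Qed.

(** The test functions [th n], products of two steps that steepen with [n], converge to the
    indicator of []a, b[]. Dominated convergence applies because an [L^2] function is integrable on
    [[a, b]]. *)
Lemma L2_null_Rint w : L2 w -> (forall phi, Ccinfty phi -> \int[mu]_x (w x * phi x) = 0) ->
  forall a b : R, \int[mu]_(x in `]a, b[) w x = 0.
Proof.
move=> hw h a b; have [s [ss s01 s0 s1]] := @smooth_step R.
have mw := L2_meas hw.
pose th (n : nat) x := s (n%:R * x + - (n%:R * a)) * s (- n%:R * x + n%:R * b).
have sth n : smooth (th n).
  have h1 : smooth (fun x => s (n%:R * x + - (n%:R * a))) by exact: (@smooth_aff _ _ n%:R _ ss).
  have h2 : smooth (fun x => s (- n%:R * x + n%:R * b)) by exact: (@smooth_aff _ _ (- n%:R) _ ss).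
  exact (smoothM h1 h2).
have th0 n x : ~ (a < x < b) -> th n x = 0.
  move=> /negP; rewrite negb_and -!leNgt /th => /orP[] hx.
    by rewrite s0 ?mul0r// -mulrBr mulr_ge0_le0// subr_le0.
  by rewrite (s0 (_ + n%:R * b)) ?mulr0// mulNr addrC -mulrBr mulr_ge0_le0// subr_le0.
have th1 n x : 0 <= th n x <= 1.
  have /andP[p1 p2] := s01 (n%:R * x + - (n%:R * a)); have /andP[p3 p4] := s01 (- n%:R * x + n%:R * b).
  by rewrite /th mulr_ge0//= mulr_ile1.
pose K := `|a| + `|b|.
have kth n : supp K (th n).
  move=> x hx; apply: th0 => /andP[h1 h2]; move: hx; apply/negP; rewrite -leNgt.
  rewrite /K ler_norml; have := ler_norm b; have := ler_norm (- a); rewrite normrN.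
  have := normr_ge0 a; have := normr_ge0 b; move=> *; apply/andP; split; lra.
have z n : (\int[mu]_x (w x * th n x)%:E = 0)%E.
  have hth : L2 (th n) by exact: L2_supp (smooth_cont (sth n)) (kth n).
  have hm := L2_mul hw hth.
  rewrite -[LHS]fineK; last by apply: integrable_fin_num hm.
  congr EFin; apply: h; have K0 : 0 <= K by rewrite addr_ge0.
  exact: ((CcinftyP _).2 (conj (sth n) (ex_intro2 _ _ K K0 (kth n)))).
have cv x : (w x * th n x)%:E @[n --> \oo] --> ((w \_ `]a, b[) x)%:E.
  apply: cvg_EFin; first by near=> n.
  rewrite patchE; case: ifPn => [|/negP]; rewrite inE /= in_itv /= => xab; last first.
    apply: cvg_near_cst; near=> n; by rewrite /= th0 ?mulr0.
  have /andP[h1 h2] := xab.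
  apply: cvg_near_cst; near=> n => /=.
  have n1 : (x - a)^-1 <= n%:R by near: n; exact: nbhs_infty_ger.
  have n2 : (b - x)^-1 <= n%:R by near: n; exact: nbhs_infty_ger.
  have e1 : 1 <= n%:R * (x - a) by rewrite -ler_pdivrMr ?subr_gt0// div1r.
  have e2 : 1 <= n%:R * (b - x) by rewrite -ler_pdivrMr ?subr_gt0// div1r.
  by rewrite /th !s1 ?mulr1//; lra.
have ab := L2_abs_integrable a b hw.
have dom : mu.-integrable setT (EFin \o ((fun x => `|w x|) \_ `[a, b])).
  rewrite -restrict_EFin; apply/(integrable_restrict _ _ _) => //=; rewrite setTI.
  have := integrable_abse ab; apply: eq_integrable => // x _.
have mth n : measurable_fun setT (EFin \o (fun x => w x * th n x)).
  apply/measurable_EFinP; apply: measurable_funM => //.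
  by apply: continuous_measurable_fun; exact: (smooth_cont (sth n)).
have [] := @dominated_convergence _ _ R mu setT measurableT
  (fun n => EFin \o (fun x => w x * th n x)) (EFin \o (w \_ `]a, b[)) _ mth _ _ dom _.
- apply/measurable_EFinP; apply/(measurable_restrictT _ _).1 => //.
  exact: (measurable_funTS mw).
- by apply: aeW => x _; exact: cv.
- apply: aeW => x n _ /=; rewrite lee_fin patchE; case: ifPn => [|/negP]; rewrite inE /= in_itv /= => xab.
    have /andP[p1 p2] := th1 n x.
    by rewrite normrM (ger0_norm p1) ler_piMr.
  rewrite th0 ?mulr0 ?normr0// => /andP[/ltW h1 /ltW h2]; apply: xab; exact/andP.
move=> _ _; under eq_fun do rewrite /= z.
move=> /(cvg_lim (@ereal_hausdorff R)); rewrite lim_cst; last exact: ereal_hausdorff.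
by move=> e; rewrite Rintegral_mkcond /Rintegral -e.
Unshelve. all: by end_near. Qed.

(** All integrals of [w] over bounded intervals vanish, and by Lebesgue's theorem [w] is almost
    everywhere the derivative of its primitive. Primitives start from [-n], since [w] need not be
    integrable at infinity, and countably many [n] cover the line. *)
Theorem fundamental_lemma w : L2 w -> (forall phi, Ccinfty phi -> \int[mu]_x (w x * phi x) = 0) ->
  {ae mu, forall x, w x = 0}.
Proof.
move=> hw h.
have loc : locally_integrable setT w.
  split; [exact: L2_meas|exact: openT|] => K _ cK.
  have [M [_ hM]] := compact_bounded cK.
  have KM : K `<=` `[- (`|M| + 1), `|M| + 1]%classic.
    move=> x Kx; rewrite /= in_itv /= -ler_norml; apply: (hM (`|M| + 1)) => //.
    by rewrite ltr_pwDr// ler_norm.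
  have := L2_abs_integrable (- (`|M| + 1)) (`|M| + 1) hw.
  move=> /integrableP[_]; apply: le_lt_trans.
  apply: ge0_subset_integral => //; first exact: compact_measurable.
  by apply/measurable_EFinP; apply: measurableT_comp => //; exact: (measurable_funTS (L2_meas hw)).
have hn (n : nat) : {ae mu, forall x, - n%:R < x -> w x = 0}.
  have := @FTC1 R w (BLeft (- n%:R)) (fun y => L2_abs_integrable _ _ hw) loc.
  apply: filterS; first exact: (ae_filter_ringOfSetsType mu).
  move=> x hx xn; have [|_ <-] := hx; first by rewrite lte_fin.
  apply: der_val; apply/der_eps => e e0; near=> y.
  have yn : - n%:R < y by near: y; exact: lt_nbhsr.
  have z q : \int[mu]_(t in [set` Interval (BLeft (- n%:R)) (BRight q)]) w t = 0.
    have hq := L2_abs_integrable (- n%:R) q hw.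
    rewrite -Rintegral_itv_obnd_cbnd; last first.
      by apply: integrableS hq => //; apply: subset_itvr; rewrite bnd_simp.
    rewrite -Rintegral_itv_bndo_bndc; last first.
      by apply: integrableS hq => //; apply: subset_itv; rewrite bnd_simp.
    exact: L2_null_Rint.
  by rewrite !z mulr0 !subr0 normr0 mulr_ge0// ltW.
have : {ae mu, forall x (n : nat), - n%:R < x -> w x = 0}.
  exact/ae_foralln.
apply: filterS; first exact: (ae_filter_ringOfSetsType mu).
move=> x hx; have [n nx] : exists n : nat, `|x| < n%:R.
  by exists (Num.trunc `|x|).+1; exact: truncnS_gt.
by apply: (hx n); move: nx; rewrite ltr_norml => /andP[].
Unshelve. all: by end_near. Qed.
End Fundamental.

(** * Weak derivatives and the Sobolev norms *)

Section Sobolev.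
Context {R : realType}.
Local Notation mu := (@lebesgue_measure R).
Implicit Types (u v w f g phi : R -> R) (K L e t x y : R).

Lemma Cc_intro K f : smooth f -> 0 <= K -> supp K f -> Ccinfty f.
Proof. by move=> sf K0 kf; exact: ((CcinftyP _).2 (conj sf (ex_intro2 _ _ K K0 kf))). Qed.

Lemma Cc_L2 j f : Ccinfty f -> L2 (derive1n j f).
Proof.
move=> /CcinftyP[sf [K K0 kf]].
exact: (L2_supp (smooth_cont (smooth_derive1n (n := j) sf)) (supp_derive1n j kf)).
Qed.

Lemma Cc_L2_0 f : Ccinfty f -> L2 f. Proof. exact: (@Cc_L2 0). Qed.

Lemma ae_eq_pair u v w : L2 u -> L2 v -> L2 w -> {ae mu, forall x, u x = v x} ->
  \int[mu]_x (u x * w x) = \int[mu]_x (v x * w x).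
Proof.
move=> hu hv hw h; congr fine; apply: ae_eq_integral => //.
- by apply/measurable_EFinP; apply: measurable_funM; exact: L2_meas.
- by apply/measurable_EFinP; apply: measurable_funM; exact: L2_meas.
- move: h; apply: filterS; first exact: (ae_filter_ringOfSetsType mu).
  by move=> x h _; rewrite h.
Qed.

Lemma ae_eq_L2norm u v : L2 u -> L2 v -> {ae mu, forall x, u x = v x} ->
  (\int[mu]_x (u x ^+ 2)%:E = \int[mu]_x (v x ^+ 2)%:E)%E.
Proof.
move=> hu hv h; apply: ae_eq_integral => //.
- by apply/measurable_EFinP; apply: measurable_funX; exact: L2_meas.
- by apply/measurable_EFinP; apply: measurable_funX; exact: L2_meas.
- move: h; apply: filterS; first exact: (ae_filter_ringOfSetsType mu).
  by move=> x h _; rewrite h.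
Qed.

Lemma weak_derivative_unique j u v w : L2 v -> L2 w ->
  weak_derivative j u v -> weak_derivative j u w -> {ae mu, forall x, v x = w x}.
Proof.
move=> hv hw dv dw.
have : {ae mu, forall x, v x - w x = 0}.
  apply: fundamental_lemma; first exact: L2B.
  move=> phi hphi; rewrite pairB//; last exact: Cc_L2_0.
  have := dv _ hphi; rewrite (dw _ hphi) => /eqP.
  by rewrite (inj_eq (mulfI _)) ?signr_eq0// => /eqP ->; rewrite subrr.
apply: filterS; first exact: (ae_filter_ringOfSetsType mu).
by move=> x /eqP; rewrite subr_eq0 => /eqP.
Qed.

Lemma weak_derivative_Cc j u : Ccinfty u -> weak_derivative j u (derive1n j u).
Proof.
move=> hu; elim: j => [|j IH] phi hphi; first by rewrite expr0 mul1r.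
have [su [K K0 ku]] := (CcinftyP _).1 hu; have [sphi [L L0 kphi]] := (CcinftyP _).1 hphi.
have s1 : smooth (derive1n 1 phi) := smooth_derive1n (n := 1) sphi.
have k1 : supp L (derive1n 1 phi) := supp_derive1n 1 kphi.
have := IH _ (Cc_intro s1 L0 k1); rewrite derive1nD addn1 => ->.
have sj : smooth (derive1n j u) := smooth_derive1n (n := j) su.
have sj1 : smooth (derive1n j.+1 u) := smooth_derive1n (n := j.+1) su.
pose M := L + 1; have LM : L < M by rewrite /M ltrDl.
have M0 : 0 <= M by apply: ltW; exact: le_lt_trans LM.
have supM f : supp M (fun x => f x * derive1n 1 phi x).
  by move=> x hx; rewrite k1 ?mulr0//; exact: lt_trans hx.
have supM0 f : supp M (fun x => f x * phi x).
  by move=> x hx; rewrite kphi ?mulr0//; exact: lt_trans hx.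
have c1 : continuous (fun x => derive1n j u x * derive1n 1 phi x) by contt.
have c2 : continuous (fun x => derive1n j.+1 u x * phi x) by contt.
rewrite (Rint_supp c1 M0 (supM _)) (Rint_supp c2 M0 (supM0 _)) exprS -mulrA mulN1r -mulrN.
congr (_ * _); rewrite (Int_parts sj sphi); first by rewrite derive1nD add1n.
by rewrite !kphi ?normrN ?ger0_norm// !mulr0.
Qed.

Lemma sobolev_Cc k u : Ccinfty u -> sobolev k u.
Proof.
move=> hu; split; first exact: Cc_L2_0.
by move=> j _; exists (derive1n j u); split; [exact: Cc_L2|exact: weak_derivative_Cc].
Qed.

Lemma weakD_spec j u : (exists v, L2 v /\ weak_derivative j u v) ->
  L2 (weakD j u) /\ weak_derivative j u (weakD j u).
Proof. by move=> [v hv]; rewrite /weakD; case: xgetP => [w _ []|/(_ v)]. Qed.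

Lemma weakD_ae j u v : L2 v -> weak_derivative j u v ->
  (\int[mu]_x (weakD j u x ^+ 2)%:E = \int[mu]_x (v x ^+ 2)%:E)%E.
Proof.
move=> hv dv; have [h1 h2] : L2 (weakD j u) /\ weak_derivative j u (weakD j u).
  by apply: weakD_spec; exists v.
by apply: ae_eq_L2norm => //; exact: weak_derivative_unique dv.
Qed.

(** The bridge between the two norms: weak derivatives are unique almost everywhere, so the one
    chosen by [weakD] may be replaced by the classical derivative. *)
Lemma sobolev_norm2_Cc K k u : smooth u -> 0 <= K -> supp K u ->
  sobolev_norm2 k u = (hnorm2 K k u)%:E.
Proof.
move=> su K0 ku; have hu := Cc_intro su K0 ku.
rewrite /sobolev_norm2 asboolT; last exact: sobolev_Cc.
rewrite /hnorm2 -sumEFin; apply: eq_bigr => j _.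
rewrite Lnorm2E (weakD_ae (Cc_L2 j hu) (weak_derivative_Cc j hu)) (int_supp _ K0)//.
  by apply: contX; exact: (smooth_continuous (n := j) su).
by move=> x /(supp_derive1n j ku) ->; rewrite expr0n.
Qed.

Lemma sobolev_norm2_lty k u : (sobolev_norm2 k u < +oo)%E -> sobolev k u.
Proof. by rewrite /sobolev_norm2; case: asboolP. Qed.

Lemma weak_derivative_ae j u v w : L2 u -> L2 v -> {ae mu, forall x, u x = v x} ->
  weak_derivative j u w -> weak_derivative j v w.
Proof.
move=> hu hv h dw phi hphi; rewrite -dw//.
by apply/esym/ae_eq_pair => //; exact: Cc_L2.
Qed.

Lemma sobolev_norm2_ae k u v : L2 u -> L2 v -> {ae mu, forall x, u x = v x} ->
  sobolev_norm2 k u = sobolev_norm2 k v.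
Proof.
move=> hu hv h.
have h' : {ae mu, forall x, v x = u x}.
  by move: h; apply: filterS; first exact: (ae_filter_ringOfSetsType mu).
have e j : weakD j u = weakD j v.
  congr xget; apply/seteqP; split=> w [hw dw]; split=> //.
    exact: weak_derivative_ae dw.
  exact: weak_derivative_ae dw.
rewrite /sobolev_norm2; have -> : sobolev k u = sobolev k v.
  apply/propext; split=> -[_ H]; split=> // j /H[w [hw dw]]; exists w; split=> //.
    exact: weak_derivative_ae dw.
  exact: weak_derivative_ae dw.
by case: ifP => [_|_]; [apply: eq_bigr => j _; rewrite (e j)|].
Qed.

(** Reduces convergence in [H^k] to convergence in [L^2]. The duality argument works at this level
    and can thus compare solutions of different orders. *)
Lemma L2_sobolev k u : (\int[mu]_x (u x ^+ 2)%:E <= sobolev_norm2 k u)%E.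
Proof.
have [hu|] := pselect (sobolev k u); last first.
  by rewrite /sobolev_norm2; case: asboolP => // *; exact: leey.
have [h0 _] := hu; rewrite /sobolev_norm2 asboolT// big_ord_recl.
rewrite -[X in (X <= _)%E]adde0; apply: leeD.
  rewrite Lnorm2E (@weakD_ae 0 u u)// => phi _.
  by rewrite expr0 mul1r.
apply: sume_ge0 => j _.
by rewrite Lnorm2E integral_ge0// => x _; rewrite lee_fin sqr_ge0.
Qed.

End Sobolev.

(** * Uniqueness by duality *)

Section Pairing.
Context {R : realType}.
Local Notation mu := (@lebesgue_measure R).
Implicit Types (p q th : R -> R -> R) (u v w f g phi : R -> R) (K L e t s x y T : R).

Lemma cvge0_near (I : Type) (F : set_system I) (h : I -> \bar R) (e : R) :
  0 < e -> h x @[x --> F] --> 0%E -> \forall x \near F, (h x < e%:E)%E.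
Proof.
move=> e0 /(_ [set y | (y < e%:E)%E]); apply.
by apply: open_nbhs_nbhs; split; [exact: open_ereal_lt_ereal|rewrite /= lte_fin].
Qed.

Lemma sobolev_lcont T k p t e : continuous_sobolev T k p -> 0 <= t <= T -> 0 < e ->
  \forall s \near t, 0 <= s <= T -> (\int[mu]_x ((p s x - p t x) ^+ 2)%:E <= (e ^+ 2)%:E)%E.
Proof.
move=> h tT e0; have [_ c] := h t tT.
have := cvge0_near (exprn_gt0 2 e0) c.
rewrite near_withinE; apply: filterS => s hs sT.
have sT' : `[0, T]%classic s by rewrite /= in_itv.
exact: le_trans (L2_sobolev k (p s \- p t)) (ltW (hs sT')).
Qed.

Lemma sobolev_ldiff T k p q t e : sobolev_derivative T k p q -> 0 < t < T -> 0 < e ->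
  \forall s \near t, (\int[mu]_x ((p s x - p t x - (s - t) * q t x) ^+ 2)%:E <= ((e * `|s - t|) ^+ 2)%:E)%E.
Proof.
move=> h /andP[t0 tT] e0; have tT' : 0 <= t <= T by rewrite !ltW.
have := cvge0_near (exprn_gt0 2 e0) (h t tT').
rewrite !near_withinE => h1; near=> s.
(* The quotient gives no information at [s = t], where both sides are 0. *)
have [->|st] := eqVneq s t.
  rewrite (_ : (fun x => _) = fun=> 0%E); first by rewrite integral0 lee_fin sqr_ge0.
  by apply/funext => x; rewrite !subrr mul0r subrr expr0n.
have hs : (sobolev_norm2 k (fun x => ((s - t)^-1 * (p s x - p t x) - q t x)%R) < (e ^+ 2)%:E)%E.
  have sT : `[0, T]%classic s.
    rewrite /= in_itv /=; apply/andP; split; apply: ltW; near: s; [exact: lt_nbhsr|exact: lt_nbhsl].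
  by move: sT; apply: (near h1 s _) => //.
have hL := sobolev_norm2_lty (lt_trans hs (ltry _)).
have mw := L2_meas hL.1.
have := le_trans (L2_sobolev k _) (ltW hs).
move=> hi; have st0 : s - t != 0 by rewrite subr_eq0.
have -> : (\int[mu]_x ((p s x - p t x - (s - t) * q t x) ^+ 2)%:E =
    ((s - t) ^+ 2)%:E * \int[mu]_x (((s - t)^-1 * (p s x - p t x) - q t x) ^+ 2)%:E)%E.
  rewrite -ge0_integralZl_EFin//; last 3 first.
  - by move=> x _; rewrite lee_fin sqr_ge0.
  - by apply/measurable_EFinP; exact: measurable_funX.
  - exact: sqr_ge0.
  apply: eq_integral => x _; rewrite -EFinM -exprMn; congr (_ ^+ 2)%:E.
  by rewrite mulrBr mulrA divff// mul1r.
rewrite exprMn real_normK ?num_real// [X in (_ <= X%:E)%E]mulrC (EFinM ((s - t) ^+ 2) (e ^+ 2)).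
by apply: lee_wpmul2l => //; rewrite lee_fin sqr_ge0.
Unshelve. all: by end_near. Qed.

Lemma L2_bound w : L2 w -> exists2 A : R, 0 <= A & (\int[mu]_x (w x ^+ 2)%:E <= (A ^+ 2)%:E)%E.
Proof.
move=> /L2P[_]; have : (0 <= \int[mu]_x (w x ^+ 2)%:E)%E.
  by apply: integral_ge0 => x _; rewrite lee_fin sqr_ge0.
case: (\int[mu]_x _)%E => [r|//|//]; rewrite lee_fin => r0 _; exists (Num.sqrt r).
  exact: sqrtr_ge0.
by rewrite sqr_sqrtr.
Qed.

Lemma pair_bound w (th : R -> R) K (A m : R) : L2 w -> continuous th -> 0 <= K -> supp K th -> 0 <= A ->
  (\int[mu]_x (w x ^+ 2)%:E <= (A ^+ 2)%:E)%E -> (forall x, `|th x| <= m) ->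
  `|\int[mu]_x (w x * th x)| <= A * (m * (2 * K + 1)).
Proof.
move=> hw ct K0 kt A0 hA hm; have m0 : 0 <= m := le_trans (normr_ge0 _) (hm 0).
apply: pair_cs => //; first exact: L2_supp kt.
  by rewrite mulr_ge0// addr_ge0// mulr_ge0.
rewrite (int_supp _ K0); [|exact: contX|by move=> x /kt ->; rewrite expr0n].
rewrite lee_fin exprMn; apply: (@le_trans _ _ (2 * K * m ^+ 2)); last first.
  by have := sqr_ge0 m; nra.
have := @Int_abs _ K (fun x => th x ^+ 2) (m ^+ 2) (contX (n := 2) ct) K0.
move=> h; apply: le_trans (ler_norm _) (h _) => x _.
by rewrite normrX ler_pXn2r ?nnegrE.
Qed.

Lemma pair_cont T K p th t : (forall s, 0 <= s <= T -> L2 (p s)) ->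
  (forall s, continuous (th s)) -> 0 <= K -> (forall s, supp K (th s)) -> 0 <= t <= T ->
  (forall e, 0 < e -> \forall s \near t, 0 <= s <= T ->
     (\int[mu]_x ((p s x - p t x) ^+ 2)%:E <= (e ^+ 2)%:E)%E) ->
  (forall e, 0 < e -> \forall s \near t, forall x, `|th s x - th t x| <= e) ->
  forall e, 0 < e -> \forall s \near t, 0 <= s <= T ->
    `|\int[mu]_x (p s x * th s x) - \int[mu]_x (p t x * th t x)| <= e.
Proof.
move=> hp ct K0 kt tT hd hth e e0.
have hpt := hp t tT; have [A A0 hA] := L2_bound hpt.
have [m hm] := cont_supp_bound (ct t) (kt t).
have hm' x : `|th t x| <= `|m| by exact: le_trans (hm x) (ler_norm _).
pose C := (A + `|m| + 1) * (2 * K + 1).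
have C0 : 0 < C by rewrite mulr_gt0//; have := normr_ge0 m; lra.
pose d := Num.min 1 (e / C); have d0 : 0 < d by rewrite lt_min ltr01 divr_gt0.
have d1 : d <= 1 by rewrite ge_min lexx.
have := hth d d0; have := hd d d0; apply: filterS2 => s h1 h2 sT.
have hps := hp s sT.
have Lt r : L2 (th r) := L2_supp (ct r) (kt r).
have -> : \int[mu]_x (p s x * th s x) - \int[mu]_x (p t x * th t x) =
   \int[mu]_x ((p s x - p t x) * th s x) + \int[mu]_x (p t x * (th s x - th t x)).
  rewrite pairB// [X in _ = _ + X]pairC pairB//.
  by rewrite [X in _ = _ + (X - _)]pairC [X in _ = _ + (_ - X)]pairC; ring.
have b1 := pair_bound (L2B hps hpt) (ct s) K0 (kt s) (ltW d0) (h1 sT) (m := `|m| + 1) _.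
have b2 := pair_bound hpt (contB (ct s) (ct t)) K0 _ A0 hA h2.
apply: le_trans (ler_normD _ _) _; apply: le_trans (lerD (b1 _) (b2 _)) _.
- move=> x; have := ler_normD (th s x - th t x) (th t x); rewrite subrK => h.
  by have := h2 x; have := hm' x; lra.
- by move=> x hx; rewrite !kt// subrr.
have : d * C <= e by rewrite -ler_pdivlMr// ge_min lexx orbT.
have -> : d * ((`|m| + 1) * (2 * K + 1)) + A * (d * (2 * K + 1)) = d * C by rewrite /C; ring.
by [].
Qed.

(** The product rule, with three errors bounded by the Cauchy-Schwarz inequality: the remainder of
    [p] against [th], that of [th] against [p], and the product of the increments, which is small
    because [p] is continuous in [L^2] and the increment of [th] is of order [s - t]. *)
Lemma pair_der T K p q th (eta : R -> R) t : (forall s, 0 <= s <= T -> L2 (p s)) -> L2 (q t) ->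
  (forall s, continuous (th s)) -> continuous eta -> 0 <= K ->
  (forall s, supp K (th s)) -> supp K eta -> 0 < t < T ->
  (forall e, 0 < e -> \forall s \near t, 0 <= s <= T ->
     (\int[mu]_x ((p s x - p t x) ^+ 2)%:E <= (e ^+ 2)%:E)%E) ->
  (forall e, 0 < e -> \forall s \near t,
     (\int[mu]_x ((p s x - p t x - (s - t) * q t x) ^+ 2)%:E <= ((e * `|s - t|) ^+ 2)%:E)%E) ->
  (forall e, 0 < e -> \forall s \near t, forall x,
     `|th s x - th t x - (s - t) * eta x| <= e * `|s - t|) ->
  der (fun s => \int[mu]_x (p s x * th s x)) t
    (\int[mu]_x (q t x * th t x) + \int[mu]_x (p t x * eta x)).
Proof.
move=> hp hq ct ce K0 kt ke /andP[t0 tT] hc hd hth.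
have tT' : 0 <= t <= T by rewrite !ltW.
have hpt := hp t tT'; have [A A0 hA] := L2_bound hpt.
have [m1 hm1] := cont_supp_bound (ct t) (kt t); have [m2 hm2] := cont_supp_bound ce ke.
pose m := `|m1| + `|m2|.
have m0 : 0 <= m by rewrite addr_ge0.
have hmt x : `|th t x| <= m by rewrite (le_trans (hm1 x))// (le_trans (ler_norm _))// lerDl.
have hme x : `|eta x| <= m by rewrite (le_trans (hm2 x))// (le_trans (ler_norm _))// lerDr.
apply/der_eps => e e0.
pose C := (2 * m + A + 1) * (2 * K + 1).
have C0 : 0 < C by rewrite mulr_gt0//; lra.
pose d := Num.min 1 (e / C); have d0 : 0 < d by rewrite lt_min ltr01 divr_gt0.
have d1 : d <= 1 by rewrite ge_min lexx.
have Lt r : L2 (th r) := L2_supp (ct r) (kt r).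
have Le : L2 eta := L2_supp ce ke.
near=> s.
have h1 : 0 <= s <= T -> (\int[mu]_x ((p s x - p t x) ^+ 2)%:E <= (d ^+ 2)%:E)%E.
  by near: s; exact: hc.
have h2 : (\int[mu]_x ((p s x - p t x - (s - t) * q t x) ^+ 2)%:E <= ((d * `|s - t|) ^+ 2)%:E)%E.
  by near: s; exact: hd.
have h3 : forall x, `|th s x - th t x - (s - t) * eta x| <= d * `|s - t|.
  by near: s; exact: hth.
have sT : 0 <= s <= T.
  by apply/andP; split; apply: ltW; near: s; [exact: lt_nbhsr|exact: lt_nbhsl].
have hps := hp s sT.
set P := \int[mu]_x _; set Q := \int[mu]_x _.
have pl u v w c : L2 u -> L2 v -> L2 w ->
    \int[mu]_x ((u x - c * v x) * w x) = \int[mu]_x (u x * w x) - c * \int[mu]_x (v x * w x).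
  move=> hu hv hw; have := pair_lin 1 (- c) hu hv hw; rewrite mul1r mulNr => <-.
  by apply: eq_Rintegral => x _; rewrite mul1r mulNr.
have e1 : \int[mu]_x ((p s x - p t x - (s - t) * q t x) * th t x) =
    \int[mu]_x (p s x * th t x) - \int[mu]_x (p t x * th t x) - (s - t) * \int[mu]_x (q t x * th t x).
  by rewrite (pl (fun x => p s x - p t x))// ?pairB//; exact: L2B.
have e2 : \int[mu]_x (p t x * (th s x - th t x - (s - t) * eta x)) =
    \int[mu]_x (p t x * th s x) - \int[mu]_x (p t x * th t x) - (s - t) * \int[mu]_x (p t x * eta x).
  rewrite pairC (pl (fun x => th s x - th t x))// ?pairB//; last exact: L2B.
  by rewrite (pairC (th s)) (pairC (th t)) (pairC eta).
have e3 : \int[mu]_x ((p s x - p t x) * (th s x - th t x)) =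
    \int[mu]_x (p s x * th s x) - \int[mu]_x (p t x * th s x) -
    (\int[mu]_x (p s x * th t x) - \int[mu]_x (p t x * th t x)).
  by rewrite pairC pairB ?(pairC (th s)) ?(pairC (th t)) ?pairB//; exact: L2B.
have ds0 : 0 <= d * `|s - t| by rewrite mulr_ge0// ltW.
have Lq : L2 (fun x => p s x - p t x - (s - t) * q t x).
  have := L2_lin 1 (- (s - t)) (L2B hps hpt) hq; congr L2.
  by apply/funext => x; rewrite mul1r mulNr.
have cts1 : continuous (fun x => th s x - th t x) by exact: contB.
have cts2 : continuous (fun x => th s x - th t x - (s - t) * eta x).
  by apply: contB => //; apply: contM => //; exact: cont_cst.
have b1 := pair_bound Lq (ct t) K0 (kt t) ds0 h2 hmt.
have b2 := pair_bound hpt cts2 K0 _ A0 hA h3.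
have b3 := pair_bound (L2B hps hpt) cts1 K0 _ (ltW d0) (h1 sT) (m := `|s - t| * (m + 1)) _.
have {}b2 := b2 _; have {}b3 := b3 _ _.
rewrite e1 in b1; rewrite e2 in b2; rewrite e3 in b3.
have z2 : supp K (fun x => th s x - th t x - (s - t) * eta x).
  by move=> x hx; rewrite !kt// ke// mulr0 !subr0.
have z3 : supp K (fun x => th s x - th t x) by move=> x hx; rewrite !kt// subr0.
have z4 x : `|th s x - th t x| <= `|s - t| * (m + 1).
  have := ler_normD (th s x - th t x - (s - t) * eta x) ((s - t) * eta x); rewrite subrK normrM => h.
  have h4 : `|s - t| * `|eta x| <= `|s - t| * m by rewrite ler_wpM2l.
  have h5 : d * `|s - t| <= `|s - t| by rewrite ler_piMl.
  by apply: (le_trans h); rewrite mulrDr mulr1 addrC lerD// (le_trans (h3 x)).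
move: (b2 z2) (b3 z3 z4) b1 => {}b2 {}b3 b1.
have -> : P - Q - (s - t) * (\int[mu]_x (q t x * th t x) + \int[mu]_x (p t x * eta x)) =
   (\int[mu]_x (p s x * th t x) - \int[mu]_x (p t x * th t x) - (s - t) * \int[mu]_x (q t x * th t x)) +
   (\int[mu]_x (p t x * th s x) - \int[mu]_x (p t x * th t x) - (s - t) * \int[mu]_x (p t x * eta x)) +
   (\int[mu]_x (p s x * th s x) - \int[mu]_x (p t x * th s x) -
    (\int[mu]_x (p s x * th t x) - \int[mu]_x (p t x * th t x))) by rewrite /P /Q; ring.
apply: le_trans (ler_normD _ _) _; apply: le_trans (lerD (ler_normD _ _) (lexx _)) _.
apply: le_trans (lerD (lerD b1 b2) b3) _.
have -> : d * `|s - t| * (m * (2 * K + 1)) + A * (d * `|s - t| * (2 * K + 1)) +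
    d * (`|s - t| * (m + 1) * (2 * K + 1)) = d * C * `|s - t| by rewrite /C; ring.
by rewrite ler_wpM2r// -ler_pdivlMr// ge_min lexx orbT.
Unshelve. all: by end_near. Qed.

End Pairing.

(** * Pairing with the adjoint problem *)

Section Uniqueness.
Context {R : realType}.
Local Notation mu := (@lebesgue_measure R).
Implicit Types (p q th : R -> R -> R) (u v w f g phi : R -> R) (K L e t s x y : R).

Lemma Rint5 f1 f2 f3 f4 f5 : mu.-integrable setT (EFin \o f1) -> mu.-integrable setT (EFin \o f2) ->
  mu.-integrable setT (EFin \o f3) -> mu.-integrable setT (EFin \o f4) ->
  mu.-integrable setT (EFin \o f5) ->
  \int[mu]_x (f1 x - f2 x - f3 x + f4 x + f5 x) =
  \int[mu]_x f1 x - \int[mu]_x f2 x - \int[mu]_x f3 x + \int[mu]_x f4 x + \int[mu]_x f5 x.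
Proof.
move=> h1 h2 h3 h4 h5.
have h12 := integrableB measurableT h1 h2; have h123 := integrableB measurableT h12 h3.
have h1234 := integrableD measurableT h123 h4.
by rewrite RintegralD// RintegralD// RintegralB// RintegralB.
Qed.

Lemma derive1n1_mul f g x : smooth f -> smooth g ->
  derive1n 1 (fun x => f x * g x) x = derive1n 1 f x * g x + f x * derive1n 1 g x.
Proof.
move=> sf sg; rewrite derive1nM// /leib !big_ord_recl big_ord0 /= !bin0 binn.
rewrite !mul1r addr0 addrC; congr (_ + _).
Qed.

Lemma derive1n2_mul f g x : smooth f -> smooth g -> derive1n 2 (fun x => f x * g x) x =
  derive1n 2 f x * g x + 2 * (derive1n 1 f x * derive1n 1 g x) + f x * derive1n 2 g x.
Proof.
move=> sf sg; rewrite -[2%N]/(1 + 1)%N -!derive1nD.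
have -> : derive1n 1 (fun x => f x * g x) = fun x => derive1n 1 f x * g x + f x * derive1n 1 g x.
  by apply/funext => y; exact: derive1n1_mul.
have sf1 : smooth (derive1n 1 f) by smt.
have sg1 : smooth (derive1n 1 g) by smt.
have s1 : smooth (fun x => derive1n 1 f x * g x) by smt.
have s2 : smooth (fun x => f x * derive1n 1 g x) by smt.
rewrite (derive1n_D 1 s1 s2) (derive1n1_mul _ sf1 sg) (derive1n1_mul _ sf sg1).
move: (derive1n 1 f x) (derive1n 1 g x) (f x) (g x) (derive1n 1 (derive1n 1 f) x) (derive1n 1 (derive1n 1 g) x).
by move=> *; ring.
Qed.

Lemma near_rev (P : R -> Prop) (t0 t : R) :
  (\forall s \near t0 - t, P s) -> \forall s \near t, P (t0 - s).
Proof.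
move=> h; have c : (fun s : R => t0 - s) s @[s --> t] --> t0 - t.
  by apply: cvgB; [exact: cvg_cst|exact: cvg_id].
exact: c _ h.
Qed.

Lemma ccurve_unear K p t e : ccurve K p -> 0 < e ->
  \forall s \near t, forall x, `|p s x - p t x| <= e.
Proof. by move=> hp e0; exact: (ccurve_near 0 t hp e0). Qed.

Lemma dcurve_rev p q (t0 t e : R) : dcurve p q -> t < t0 -> 0 < e ->
  \forall s \near t, forall x,
    `|p (t0 - s) x - p (t0 - t) x - (s - t) * - q (t0 - t) x| <= e * `|s - t|.
Proof.
move=> h tt0 e0; have t00 : 0 < t0 - t by rewrite subr_gt0.
have := near_rev (h 0%N _ e t00 e0); apply: filterS => s hs x; have := hs x.
have -> : t0 - s - (t0 - t) = - (s - t) by ring.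
by rewrite normrN mulrN mulNr.
Qed.

(** The hypothesis is the adjoint equation tested against [u]; the conclusion replaces the
    derivative of the pairing by the left side of the equation for [u]. *)
Lemma dual_alg (A B C D E F G H : R) : 0 = C - F - G + E + H ->
  A - B + (B - C) + (D - E) = A - F - G + D + H.
Proof. lra. Qed.

Lemma norm_third (x y z x' y' z' e : R) : `|x - x'| <= e / 3 -> `|y - y'| <= e / 3 ->
  `|z - z'| <= e / 3 -> `|x + y + z - (x' + y' + z')| <= e.
Proof.
by rewrite !ler_norml => /andP[? ?] /andP[? ?] /andP[? ?]; apply/andP; split; lra.
Qed.

Variables (T : R) (a b1 b2 b3 g0 g1 : R -> R) (f : R -> R -> R) (k : nat).
Hypotheses (sa : smooth a) (sb1 : smooth b1) (sb2 : smooth b2) (sb3 : smooth b3).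
Hypotheses (hg0 : Ccinfty g0) (hg1 : Ccinfty g1).
Variables (t0 K : R) (Phi Psi Psi' : R -> R -> R) (psi : R -> R).
Hypotheses (t00 : 0 < t0) (t0T : t0 <= T) (K0 : 0 <= K).
Hypotheses (hPhi : ccurve K Phi) (hPsi : ccurve K Psi) (hPsi' : ccurve K Psi').
Hypotheses (dPhi : dcurve Phi Psi) (dPsi : dcurve Psi Psi').
Hypotheses (Phi0 : Phi 0 = fun=> 0) (Psi0 : Psi 0 = psi).
(** The right side is [(a Phi)'' + (b1 Phi)' - b3 Phi - b2 Psi], expanded. The sign of the damping
    changes under transposition and again under time reversal, so [b2] stays. *)
Hypothesis eqPsi : forall t x, 0 <= t <= t0 -> Psi' t x =
  opA a (fun x => - (2 * derive1n 1 a x + b1 x)) b2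
    (fun x => b3 x - derive1n 2 a x - derive1n 1 b1 x) (Phi t) (Psi t) x.

(* Phi (t0 - t) solves the adjoint problem backwards in time, hence the derivative of the pairing
   does not involve the solution. *)
Definition dual_pairing (u ut : R -> R -> R) t : R :=
  \int[mu]_x (ut t x * Phi (t0 - t) x) + \int[mu]_x (u t x * Psi (t0 - t) x) +
  \int[mu]_x (u t x * (b2 x * Phi (t0 - t) x)).

(** The products of [u_t] with [Psi] cancel because the argument of [Phi] runs backwards, those with
    [b2 Phi] cancel through the equation, and the terms in [u] sum to the adjoint equation. The data
    [Phi 0 = 0] and [Psi 0 = psi] leave the integral of [u(t0) psi] at the final time. The
    derivative is taken on the open interval and supplemented by continuity at its ends. *)
Lemma dual_pairing_solution (u : R -> R -> R) : solution T a b1 b2 b3 g0 g1 f k u ->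
  exists ut, [/\ forall t, 0 < t < t0 ->
      der (dual_pairing u ut) t (\int[mu]_x (f t x * Phi (t0 - t) x)),
    {within `[0, t0]%classic, continuous (dual_pairing u ut)},
    dual_pairing u ut 0 = \int[mu]_x (g1 x * Phi t0 x) + \int[mu]_x (g0 x * Psi t0 x) +
      \int[mu]_x (g0 x * (b2 x * Phi t0 x)) &
    dual_pairing u ut t0 = \int[mu]_x (u t0 x * psi x)].
Proof.
move=> [ut [utt [[cu cut cutt] [du dut] pde u0 ut0]]]; exists ut.
have T0 : 0 <= T by rewrite (le_trans _ t0T)// ltW.
have inT t : 0 <= t <= t0 -> 0 <= t <= T by move=> /andP[-> /le_trans ->].
have Lu t : 0 <= t <= T -> L2 (u t) by move=> /cu[[]].
have Lut t : 0 <= t <= T -> L2 (ut t) by move=> /cut[[]].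
have Lutt t : 0 <= t <= T -> L2 (utt t) by move=> /cutt[[]].
have cPhi s : continuous (Phi s) by exact: smooth_cont (ccurve_smooth s hPhi).
have cPsi s : continuous (Psi s) by exact: smooth_cont (ccurve_smooth s hPsi).
have cPsi' s : continuous (Psi' s) by exact: smooth_cont (ccurve_smooth s hPsi').
have cb2 : continuous b2 := smooth_cont sb2.
have kPhi s : supp K (Phi s) := ccurve_supp s hPhi.
have kPsi s : supp K (Psi s) := ccurve_supp s hPsi.
have kPsi' s : supp K (Psi' s) := ccurve_supp s hPsi'.
have supr g h : supp K h -> supp K (fun x => g x * h x) by move=> kh x /kh ->; rewrite mulr0.
have cb2Phi s : continuous (fun x => b2 x * Phi s x) by exact: contM.
have [B hB] := cont_seg_bound K cb2.
have hB' x g : supp K g -> `|b2 x * g x| <= `|B| * `|g x|.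
  move=> kg; rewrite normrM; case: (leP `|x| K) => xK.
    by rewrite ler_wpM2r// (le_trans (hB x xK))// ler_norm.
  by rewrite kg// normr0 !mulr0.
split.
- move=> t /andP[t1 t2]; have tT : 0 < t < T by rewrite t1 (lt_le_trans t2).
  have tT' : 0 <= t <= T by have /andP[/ltW -> /ltW ->] := tT.
  have lc p e : continuous_sobolev T k p -> 0 < e -> \forall s \near t, 0 <= s <= T ->
      (\int[mu]_x ((p s x - p t x) ^+ 2)%:E <= (e ^+ 2)%:E)%E.
    by move=> cp e0; exact: (sobolev_lcont cp tT' e0).
  have d1 := pair_der Lut (Lutt t tT') (fun s => cPhi (t0 - s)) (contN (cPsi (t0 - t))) K0
    (fun s => kPhi (t0 - s)) _ tT (fun e => lc ut e cut) (fun e => sobolev_ldiff dut tT)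
    (fun e => dcurve_rev dPhi t2).
  have d2 := pair_der Lu (Lut t tT') (fun s => cPsi (t0 - s)) (contN (cPsi' (t0 - t))) K0
    (fun s => kPsi (t0 - s)) _ tT (fun e => lc u e cu) (fun e => sobolev_ldiff du tT)
    (fun e => dcurve_rev dPsi t2).
  have d3 := pair_der Lu (Lut t tT') (fun s => cb2Phi (t0 - s))
    (contM cb2 (contN (cPsi (t0 - t)))) K0
    (fun s => supr b2 _ (kPhi (t0 - s))) _ tT (fun e => lc u e cu) (fun e => sobolev_ldiff du tT) _.
  have kN p s : supp K (p s) -> supp K (fun x => - (p s x) : R) by move=> h x /h ->; rewrite oppr0.
  have {}d3 := d3 (supr b2 _ (kN Psi (t0 - t) (kPsi (t0 - t)))) _.
  have {}d3 := d3 _.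
  apply: der_eq (derD (derD (d1 (kN Psi (t0 - t) (kPsi _))) (d2 (kN Psi' (t0 - t) (kPsi' _)))) (d3 _)) _ _.
  + move=> e e0; have e1 : 0 < e / (`|B| + 1) by rewrite divr_gt0// ltr_wpDl.
    have := dcurve_rev dPhi t2 e1; apply: filterS => s hs x.
    have -> : b2 x * Phi (t0 - s) x - b2 x * Phi (t0 - t) x - (s - t) * (b2 x * - Psi (t0 - t) x) =
      b2 x * (Phi (t0 - s) x - Phi (t0 - t) x - (s - t) * - Psi (t0 - t) x) by ring.
    apply: (le_trans (hB' x (fun x => Phi (t0 - s) x - Phi (t0 - t) x - (s - t) * - Psi (t0 - t) x) _)).
      by move=> y hy; rewrite !(kPhi _ _ hy) (kPsi _ _ hy) !(oppr0, mulr0, subr0, addr0).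
    apply: le_trans (ler_wpM2l (normr_ge0 B) (hs x)) _.
    rewrite mulrA; apply: ler_wpM2r => //; rewrite mulrA ler_pdivrMr ?ltr_wpDl//.
    by have := normr_ge0 B; nra.
  + by [].
  have := pde t tT' (Phi (t0 - t)) (Cc_intro (ccurve_smooth (t0 - t) hPhi) K0 (kPhi (t0 - t))).
  have t3 : 0 <= t0 - t <= t0 by rewrite subr_ge0 (ltW t2) lerBlDr lerDl (ltW t1).
  have eqP x := eqPsi x t3.
  set r := t0 - t in t3 eqP *; have sP : smooth (Phi r) := ccurve_smooth r hPhi.
  have kP := kPhi r.
  have saP : smooth (fun x => a x * Phi r x) by smt.
  have sbP : smooth (fun x => b1 x * Phi r x) by smt.
  have Lf h : continuous h -> supp K h -> L2 h by move=> ch kh; exact: L2_supp kh.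
  have L_2 : L2 (derive1n 2 (a \* Phi r)).
    apply: Lf; first exact: (smooth_continuous (n := 2) saP).
    exact: (supp_derive1n 2 (supr a _ kP)).
  have L_1 : L2 (derive1n 1 (b1 \* Phi r)).
    apply: Lf; first exact: (smooth_continuous (n := 1) sbP).
    exact: (supp_derive1n 1 (supr b1 _ kP)).
  have L_b2 : L2 (fun x => b2 x * Phi r x) by apply: Lf => //; exact: supr.
  have L_b2' : L2 (fun x => b2 x * Psi r x) by apply: Lf; [exact: contM|exact: supr].
  have L_b3 : L2 (fun x => b3 x * Phi r x).
    by apply: Lf; [apply: contM => //; exact: smooth_cont sb3|exact: supr].
  have L_P : L2 (Phi r) by exact: Lf.
  have L_P1 : L2 (Psi r) by exact: Lf.
  have L_P2 : L2 (Psi' r) by exact: Lf.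
  have U := Lu t tT'; have U1 := Lut t tT'; have U2 := Lutt t tT'.
  have e1 := Rint5 (L2_mul U2 L_P) (L2_mul U L_2) (L2_mul U L_1) (L2_mul U1 L_b2) (L2_mul U L_b3).
  have e2 := Rint5 (L2_mul U L_P2) (L2_mul U L_2) (L2_mul U L_1) (L2_mul U L_b2') (L2_mul U L_b3).
  have z : \int[mu]_x (u t x * Psi' r x - u t x * derive1n 2 (a \* Phi r) x -
      u t x * derive1n 1 (b1 \* Phi r) x + u t x * (b2 x * Psi r x) + u t x * (b3 x * Phi r x)) = 0.
    rewrite (_ : (fun x => _) = fun=> 0) ?Rintegral_cst ?mul0r//.
    apply/funext => x; rewrite eqP /opA (derive1n2_mul _ sa sP) (derive1n1_mul _ sb1 sP).
    move: (derive1n 1 a x) (derive1n 2 a x) (derive1n 1 b1 x) (derive1n 1 (Phi r) x) (derive1n 2 (Phi r) x).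
    by move: (Phi r x) (Psi r x) (u t x) (a x) (b1 x) (b2 x) (b3 x); clear; move=> *; ring.
  rewrite z in e2 => <-.
  have -> : \int[mu]_x (utt t x * Phi r x - u t x * derive1n 2 (a \* Phi r) x
      - u t x * derive1n 1 (b1 \* Phi r) x + b2 x * ut t x * Phi r x + b3 x * u t x * Phi r x) =
    \int[mu]_x (utt t x * Phi r x - u t x * derive1n 2 (a \* Phi r) x
      - u t x * derive1n 1 (b1 \* Phi r) x + ut t x * (b2 x * Phi r x) + u t x * (b3 x * Phi r x)).
    by apply: eq_Rintegral => x _; ring.
  rewrite e1.
  have neg w g : L2 w -> L2 g -> \int[mu]_x (w x * - g x) = - \int[mu]_x (w x * g x).
    move=> hw hg; rewrite -mulN1r -RintegralZl//; last exact: L2_mul.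
    by apply: eq_Rintegral => x _; ring.
  have neg2 : \int[mu]_x (u t x * (b2 x * - Psi r x)) = - \int[mu]_x (u t x * (b2 x * Psi r x)).
    by rewrite -neg//; apply: eq_Rintegral => x _; ring.
  rewrite neg2 (neg (ut t) (Psi r))// (neg (u t) (Psi' r))//.
  exact: dual_alg e2.
- apply/subspace_continuousP => t; rewrite /= in_itv /= => tt0; have tT := inT t tt0.
  have lc p e : continuous_sobolev T k p -> 0 < e -> \forall s \near t, 0 <= s <= T ->
      (\int[mu]_x ((p s x - p t x) ^+ 2)%:E <= (e ^+ 2)%:E)%E.
    by move=> cp e0; exact: (sobolev_lcont cp tT e0).
  have n1 p : ccurve K p -> forall d : R, 0 < d -> \forall s \near t, forall x,
      `|p (t0 - s) x - p (t0 - t) x| <= d.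
    by move=> hp d d0; exact: near_rev (ccurve_unear (t0 - t) hp d0).
  have n2 (d : R) : 0 < d -> \forall s \near t, forall x,
      `|b2 x * Phi (t0 - s) x - b2 x * Phi (t0 - t) x| <= d.
    move=> d0; have d1 : 0 < d / (`|B| + 1) by rewrite divr_gt0// ltr_wpDl.
    have := n1 Phi hPhi _ d1; apply: filterS => s hs x.
    rewrite -mulrBr; apply: (le_trans (hB' x (fun x => Phi (t0 - s) x - Phi (t0 - t) x) _)).
      by move=> y hy; rewrite !(kPhi _ _ hy) subr0.
    apply: le_trans (ler_wpM2l (normr_ge0 B) (hs x)) _.
    by rewrite mulrA ler_pdivrMr ?ltr_wpDl//; have := normr_ge0 B; nra.
  have c1 := @pair_cont _ T K ut (fun s => Phi (t0 - s)) t Lut (fun s => cPhi (t0 - s)) K0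
    (fun s => kPhi (t0 - s)) tT (fun e => lc ut e cut) (n1 Phi hPhi).
  have c2 := @pair_cont _ T K u (fun s => Psi (t0 - s)) t Lu (fun s => cPsi (t0 - s)) K0
    (fun s => kPsi (t0 - s)) tT (fun e => lc u e cu) (n1 Psi hPsi).
  have c3 := @pair_cont _ T K u (fun s x => b2 x * Phi (t0 - s) x) t Lu (fun s => cb2Phi (t0 - s)) K0
    (fun s => supr b2 _ (kPhi (t0 - s))) tT (fun e => lc u e cu) n2.
  apply/cvgrPdist_le => e e0; rewrite near_withinE.
  have e3 : 0 < e / 3 by rewrite divr_gt0.
  move: (c1 _ e3) (c2 _ e3) (c3 _ e3); apply: filterS3 => s {}c1 {}c2 {}c3.
  rewrite /= in_itv /= => st0; have sT := inT s st0.
  rewrite distrC; exact: norm_third (c1 sT) (c2 sT) (c3 sT).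
- have z : (0 : R) <= 0 <= T by rewrite lexx.
  have Lf h : continuous h -> supp K h -> L2 h by move=> ch kh; exact: L2_supp kh.
  rewrite /dual_pairing subr0; congr (_ + _ + _); apply: ae_eq_pair => //.
  + exact: Lut.
  + exact: Cc_L2_0.
  + exact: Lf.
  + exact: Lu.
  + exact: Cc_L2_0.
  + exact: Lf.
  + exact: Lu.
  + exact: Cc_L2_0.
  + by apply: Lf => //; exact: supr.
- rewrite /dual_pairing subrr Phi0 Psi0.
  have z w : \int[mu]_x (w x * 0) = 0 :> R.
    by rewrite (_ : (fun x => _) = fun=> 0) ?Rintegral_cst ?mul0r//; apply/funext => x; rewrite mulr0.
  rewrite z add0r [X in _ + X](_ : _ = 0) ?addr0//.
  by under eq_Rintegral do rewrite mulr0; exact: z.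
Qed.
End Uniqueness.

Section UniquenessTheorem.
Context {R : realType}.
Local Notation mu := (@lebesgue_measure R).
Implicit Types (u v w f g : R -> R) (K L e t s x y : R).

(** The pairings of the two solutions have the same derivative and the same initial value, hence the
    same final value. The orders [k] and [l] may differ, which is what identifies a rough solution
    with the smooth one. *)
Theorem solution_unique (T : R) (a b1 b2 b3 g0 g1 : R -> R) (f u w : R -> R -> R) (k l : nat)
    (Ba A M2 : R) :
  smooth a -> smooth b1 -> smooth b2 -> smooth b3 ->
  (forall x, 0 <= a x) -> (forall x, a x <= Ba) -> 0 < A -> (forall x, `|derive1n 2 a x| <= A) ->
  0 <= M2 -> (forall x, b1 x ^+ 2 <= M2 * a x) -> Ccinfty g0 -> Ccinfty g1 ->
  solution T a b1 b2 b3 g0 g1 f k u -> solution T a b1 b2 b3 g0 g1 f l w ->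
  forall t, 0 <= t <= T -> {ae mu, forall x, u t x = w t x}.
Proof.
move=> sa sb1 sb2 sb3 a0 aB A0 hA M0 hb hg0 hg1 hu hw t0 /andP[t00 t0T].
move: t00; rewrite le_eqVlt => /orP[/eqP <-|t00].
  have [ut [utt [_ _ _ u0 _]]] := hu; have [wt [wtt [_ _ _ w0 _]]] := hw.
  move: u0 w0; apply: filterS2; first exact: (ae_filter_ringOfSetsType mu).
  by move=> x -> ->.
have tT : 0 <= t0 <= T by rewrite (ltW t00).
have Lu : L2 (u t0) by have [ut [utt [[cu _ _] _ _ _ _]]] := hu; have [[]] := cu t0 tT.
have Lw : L2 (w t0) by have [wt [wtt [[cw _ _] _ _ _ _]]] := hw; have [[]] := cw t0 tT.
have : {ae mu, forall x, u t0 x - w t0 x = 0}; last first.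
  apply: filterS; first exact: (ae_filter_ringOfSetsType mu).
  by move=> x /eqP; rewrite subr_eq0 => /eqP.
apply: fundamental_lemma; first exact: L2B.
move=> psi hpsi; rewrite pairB//; last exact: Cc_L2_0.
have [spsi [R0 R00 kpsi]] := (CcinftyP _).1 hpsi.
pose c1 x := - (2 * derive1n 1 a x + b1 x).
pose c3 x := b3 x - derive1n 2 a x - derive1n 1 b1 x.
have s1 : smooth c1 by rewrite /c1; smt.
have s3 : smooth c3 by rewrite /c3; smt.
(* From [(2 a' + b1)^2 <= 8 a'^2 + 2 b1^2], with [a'^2 <= 4 A a] and [b1^2 <= M2 a]. *)
pose N2 := 32 * A + 2 * M2; have N20 : 0 <= N2 by rewrite /N2; lra.
have hc1 x : c1 x ^+ 2 <= N2 * a x.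
  have h := glaeser x sa a0 A0 hA; have h1 := hb x; have h2 := a0 x.
  rewrite /c1 /N2; move: (derive1n 1 a x) h => d h; have := sqr_ge0 (2 * d - b1 x).
  move: (a x) (b1 x) h1 h2 h; clear; move=> *; nra.
have [chi [schi kchi chile chi1]] := cutoff (R0 + (Ba + 1) * t0).
have kchi' : supp (R0 + (Ba + 1) * t0 + 2) chi by apply: supp_le kchi; lra.
have z0 : smooth (fun=> 0 : R) by exact: smooth_cst.
have k0 : supp R0 (fun=> 0 : R) by [].
have cF : ccurve R0 (fun _ _ => 0 : R) by exact: (ccurve_cst z0 k0).
have [K [Phi [Psi [Psi' [K0 [hP1 hP2] hP3 [e1 e2] eq3]]]]] :=
  existence sa s1 sb2 s3 a0 aB N20 hc1 R00 (ltW t00) z0 k0 spsi kpsi cF schi kchi' chile chi1.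
have d1 : dcurve Phi Psi.
  have := dcurve_It z0 hP2; congr dcurve.
  by apply/funext => s; apply/funext => y; rewrite e1.
have d2 : dcurve Psi Psi'.
  have := dcurve_It spsi hP3; congr dcurve.
  by apply/funext => s; apply/funext => y; rewrite e2.
have Phi0 : Phi 0 = fun=> 0 by apply/funext => y; rewrite e1 It_le0// addr0.
have Psi0 : Psi 0 = psi by apply/funext => y; rewrite e2 It_le0// addr0.
have eqP t x : 0 <= t <= t0 -> Psi' t x = opA a c1 b2 c3 (Phi t) (Psi t) x.
  by move=> ht; rewrite eq3// addr0.
have [ut [u1 u2 u3 u4]] := dual_pairing_solution sa sb1 sb2 sb3 hg0 hg1 t00 t0T K0 hP1 hP2 hP3 d1 d2
  Phi0 Psi0 eqP hu.
have [wt [w1 w2 w3 w4]] := dual_pairing_solution sa sb1 sb2 sb3 hg0 hg1 t00 t0T K0 hP1 hP2 hP3 d1 d2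
  Phi0 Psi0 eqP hw.
rewrite -u4 -w4.
set Gu := dual_pairing _ _ _ _ _ _ in u1 u2 u3 *; set Gw := dual_pairing _ _ _ _ _ _ in w1 w2 w3 *.
have dG s : s \in `]0, t0[%R -> is_derive s 1 (fun s => Gu s - Gw s) 0.
  rewrite in_itv /= => hs; apply/der_is_derive.
  by apply: der_eq (derB (u1 s hs) (w1 s hs)) _ _ => //; rewrite subrr.
have cG : {within `[0, t0], continuous (fun s => Gu s - Gw s)}.
  by move=> s; apply: cvgB; [exact: u2|exact: w2].
have [z _] := MVT_segment (ltW t00) dG cG.
by rewrite mul0r u3 w3 subrr subr0.
Qed.

End UniquenessTheorem.

(** * The theorem *)

Section TimeCurve.
Context {R : realType}.
Implicit Types (f g : R -> R) (K L e t s x y T : R).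

(** If no [Q n] held near [t], counterexamples to [Q n] within [1/(n+1)] of [t] would form a
    sequence tending to [t]. Letting [Q] depend on [n] yields a support radius along with the
    neighbourhood. *)
Lemma seq_near T t (Q : nat -> R -> Prop) :
  (forall s_ : nat -> R, (forall n, 0 <= s_ n <= T) -> s_ @ \oo --> t -> exists n, Q n (s_ n)) ->
  exists n, \forall s \near t, 0 <= s <= T -> Q n s.
Proof.
move=> h; apply: contrapT => hn.
have bad n : exists s, [/\ 0 <= s <= T, `|t - s| < n.+1%:R^-1 & ~ Q n s].
  apply: contrapT => hs; apply: hn; exists n; apply/nbhs_ballP.
  exists n.+1%:R^-1 => /=; first by rewrite invr_gt0.
  move=> s hts sT; apply: contrapT => hq; apply: hs; exists s; split=> //.
pose s_ n := projT1 (cid (bad n)); have hs n := projT2 (cid (bad n)).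
have [||n] := h s_.
- by move=> n; have [] := hs n.
- apply/cvgrPdist_lt => e e0; near=> n.
  have [_ h1 _] := hs n; apply: lt_trans h1 _.
  have : e^-1 < n%:R by near: n; exact: nbhs_infty_gtr.
  move=> h2; rewrite -[e]invrK ltf_pV2 ?posrE ?invr_gt0 ?ltr0n//.
  by apply: lt_trans h2 _; rewrite ltr_nat.
by have [] := hs n.
Unshelve. all: by end_near. Qed.

(** The values of the source outside [[0, T]] are arbitrary, whereas curves live on R; clamping the
    time extends the source by its end values. *)
Definition clamp T t : R := Num.min T (Num.max 0 t).

Lemma clamp_in T t : 0 <= T -> 0 <= clamp T t <= T.
Proof. by move=> T0; rewrite /clamp ge_min lexx /= andbT le_min T0 le_max lexx. Qed.

Lemma clampE T t : 0 <= t <= T -> clamp T t = t.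
Proof. by move=> /andP[t0 tT]; rewrite /clamp max_r// min_r. Qed.

Lemma clamp_near T t (P : R -> Prop) : 0 <= T ->
  (\forall s \near clamp T t, 0 <= s <= T -> P s) -> \forall s \near t, P (clamp T s).
Proof.
move=> T0 /nbhs_ballP[d /= d0 h]; apply/nbhs_ballP; exists d => //= s hs.
apply: h; last exact: clamp_in.
rewrite /ball /= in hs *; apply: le_lt_trans hs; rewrite /clamp.
have := ler_norm (t - s); have := ler_norm (s - t); rewrite (distrC s t) => h1 h2.
rewrite ler_norml.
by case: (leP 0 t) => ?; case: (leP 0 s) => ?; rewrite ?(min_r T0); case: (leP T t) => ?;
  case: (leP T s) => ?; apply/andP; split; lra.
Qed.

(** Sequential continuity provides a common support along each convergent sequence, hence near each
    time, and then on all of [[0, T]] by compactness. *)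
Lemma continuous_Ccinfty_supp T (f : R -> R -> R) : 0 <= T -> continuous_Ccinfty T f ->
  exists2 K, 0 <= K & forall t, 0 <= t <= T -> supp K (f t).
Proof.
move=> T0 [hf hc].
have loc t : 0 <= t <= T -> exists n : nat, \forall s \near t, 0 <= s <= T -> supp n%:R (f s).
  move=> tT; apply: (@seq_near T t (fun n s => supp n%:R (f s))) => s_ sT st.
  have [[C [cC hC]] _] := hc s_ t sT tT st.
  have [M [_ hM]] := compact_bounded cC.
  pose n := (Num.trunc (`|M| + 1)).+1; exists n => x hx; apply/eqP/negPn/negP => fx.
  have := hM (`|M| + 1) _ x (hC n x fx); rewrite ltr_pwDr ?ler_norm// => /(_ isT).
  apply/negP; rewrite -ltNge; apply: lt_trans hx.
  by rewrite /n; exact: truncnS_gt.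
have /compact_near_coveringP/near_covering_withinP hcov := @segment_compact R 0 T.
have : \forall n \near \oo, forall t, `[0, T]%classic t -> supp (n : nat)%:R (f t).
  apply: (hcov nat \oo (fun n t => supp n%:R (f t))) => t; rewrite /= in_itv /= => tT.
  have [n hn] := loc t tT.
  near=> s m; rewrite /= in_itv /= => sT.
  apply: (@supp_le _ n%:R); first by rewrite ler_nat; near: m; exact: nbhs_infty_ge.
  by apply: (near hn s _).
move=> [n _ hn]; exists n%:R => // t tT.
by apply: (hn n (leqnn n)); rewrite /= in_itv.
Unshelve. all: by end_near. Qed.

Lemma continuous_Ccinfty_curve T (f : R -> R -> R) : 0 <= T -> continuous_Ccinfty T f ->
  exists2 K, 0 <= K & ccurve K (fun t => f (clamp T t)).
Proof.
move=> T0 hf; have [K K0 kf] := continuous_Ccinfty_supp T0 hf; exists K => //.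
have [hf1 hc] := hf; split.
- by move=> t; have [] := hf1 _ (clamp_in t T0).
- by move=> t; exact: kf (clamp_in t T0).
move=> j t e e0; apply: (clamp_near (P := fun s => forall x, `|derive1n j (f s) x - _ x| <= e)) => //.
have cT := clamp_in t T0; move: (clamp T t) cT => r rT.
have [|n hn] := @seq_near T r (fun _ s => forall x, `|derive1n j (f s) x - derive1n j (f r) x| <= e); last first.
  exact: hn.
move=> s_ sT sr; have [_ h] := hc s_ r sT rT sr.
have [n _ hn] := h j e e0; exists n => x; exact: ltW (hn n (leqnn n) x).
Qed.

End TimeCurve.

(** * Smooth curves as solutions in the sense of Sobolev spaces *)

Section SmoothSolutions.
Context {R : realType}.
Local Notation mu := (@lebesgue_measure R).
Implicit Types (u v w : R -> R -> R) (f g c phi : R -> R) (K L e t s x y T : R).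

(** A continuous function exceeding its essential supremum at one point would exceed it on a ball,
    which has positive measure. Thus the norms on which the constant depends bound the coefficients
    pointwise. *)
Lemma Lnorm_infty_ge c x : continuous c -> (exists M : R, forall y, `|c y| <= M) ->
  `|c x| <= fine ('N[mu]_+oo [EFin \o c])%E.
Proof.
move=> cc [M hM].
have muT : (0 < mu [set: R])%E.
  apply: (@lt_le_trans _ _ (mu (ball (0 : R) 1))).
    by rewrite lebesgue_measure_ball// lte_fin mulr2n addr_gt0.
  by apply: le_measure => //; rewrite inE//; exact: measurable_ball.
rewrite unlock /Lnorm muT; set S := ess_sup _ _.
have SM : (S <= M%:E)%E by apply/ess_supP; apply: aeW => y /=; rewrite lee_fin.
have S0 : (0 <= S)%E by apply: ess_sup_gee => //; apply: aeW => y /=; rewrite lee_fin.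
have Sfin : S \is a fin_num by rewrite ge0_fin_numE// (le_lt_trans SM) ?ltry.
rewrite leNgt; apply/negP => hx.
have : \forall y \near x, fine S < `|c y|.
  have ca : continuous (fun y => `|c y|) := cont_abs cc.
  have := ca x; move=> /cvgrPdist_lt /(_ (`|c x| - fine S)); rewrite subr_gt0 => /(_ hx).
  by apply: filterS => y; rewrite ltr_norml => /andP[]; lra.
move=> /nbhs_ballP[d /= d0 hd].
have [N [mN N0 hN]] := ess_sup_ge mu (abse \o (EFin \o c)).
have BN : ball x d `<=` N.
  move=> y /hd; rewrite ltNge => /negP hy; apply: hN => /= h; apply: hy.
  by rewrite -lee_fin fineK.
have : (mu (ball x d) <= mu N)%E.
  by apply: le_measure => //; rewrite inE//; exact: measurable_ball.
rewrite N0 lebesgue_measure_ball ?(ltW d0)// lee_fin leNgt => /negP; apply.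
by rewrite mulr2n addr_gt0.
Qed.

Lemma Linfty_norms_ge n (j : 'I_n.+1) c x : Binfty c ->
  `|derive1n j c x| <= Linfty_norms n c 0 j.
Proof.
move=> [sc bc]; rewrite mxE; apply: Lnorm_infty_ge; last exact: bc.
exact: smooth_continuous.
Qed.

Lemma ccurve_derive1n K j u : ccurve K u -> ccurve K (fun t => derive1n j (u t)).
Proof.
move=> hu; split=> [t|t|i t e e0].
- exact: (smooth_derive1n (n := j) (ccurve_smooth t hu)).
- exact: (supp_derive1n j (ccurve_supp t hu)).
- have := ccurve_near (i + j)%N t hu e0; apply: filterS => s hs x.
  by rewrite !derive1nD.
Qed.

Lemma ccurve_mul K c u : smooth c -> ccurve K u -> ccurve K (fun t x => c x * u t x).
Proof. by move=> sc hu; exact: (bop_ccurve (bop_mul K sc) hu). Qed.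

Lemma opA_curve K a b1 b2 b3 u v : smooth a -> smooth b1 -> smooth b2 -> smooth b3 ->
  ccurve K u -> ccurve K v -> ccurve K (fun t => opA a b1 b2 b3 (u t) (v t)).
Proof.
move=> sa sb1 sb2 sb3 hu hv.
exact: (ccurveB (ccurveB (ccurveB (ccurve_mul sa (ccurve_derive1n 2 hu))
  (ccurve_mul sb1 (ccurve_derive1n 1 hu))) (ccurve_mul sb2 hv)) (ccurve_mul sb3 hu)).
Qed.

Lemma hnorm2_small K k f e : smooth f -> 0 <= K -> 0 <= e ->
  (forall j x, (j <= k)%N -> `|derive1n j f x| <= e) ->
  hnorm2 K k f <= k.+1%:R * (2 * K) * e ^+ 2.
Proof.
move=> sf K0 e0 h; rewrite /hnorm2.
have -> : k.+1%:R * (2 * K) * e ^+ 2 = \sum_(j < k.+1) (2 * K * e ^+ 2).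
  by rewrite sumr_const card_ord -[RHS]mulr_natl -mulrA.
apply: ler_sum => j _.
have cj : continuous (derive1n j f) := smooth_continuous (n := j) sf.
apply: le_trans (ler_norm _) _; apply: Int_abs => //; first exact: contX.
move=> x _; rewrite normrX ler_pXn2r ?nnegrE//.
by apply: h; rewrite -ltnS.
Qed.

Lemma cvge0_sobolev (F : set_system R) {FF : Filter F} (w : R -> R -> R) k K :
  0 <= K -> (forall s, smooth (w s)) -> (forall s, supp K (w s)) ->
  (forall e, 0 < e -> \forall s \near F, forall j x, (j <= k)%N -> `|derive1n j (w s) x| <= e) ->
  sobolev_norm2 k (w s) @[s --> F] --> 0%E.
Proof.
move=> K0 sw kw h.
have E s : sobolev_norm2 k (w s) = (hnorm2 K k (w s))%:E by exact: sobolev_norm2_Cc.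
apply/fine_cvgP; split; first by apply: nearW => s; rewrite E.
apply/cvgrPdist_le => e e0; pose D := k.+1%:R * (2 * K) + 1.
have D0 : 0 < D by rewrite ltr_wpDl// mulr_ge0// mulr_ge0.
pose d := Num.min 1 (e / D); have d0 : 0 < d by rewrite lt_min ltr01 divr_gt0.
have d1 : d <= 1 by rewrite ge_min lexx.
have := h d d0; apply: filterS => s hs; rewrite /= E /= sub0r normrN.
rewrite ger0_norm; last exact: hnorm2_ge0.
apply: le_trans (hnorm2_small (sw s) K0 (ltW d0) hs) _.
have de : D * d <= e by rewrite mulrC -ler_pdivlMr// ge_min lexx orbT.
apply: le_trans de; rewrite /D mulrDl mul1r.
have dd : d ^+ 2 <= d by rewrite expr2 ler_piMl// ltW.
have DD : 0 <= k.+1%:R * (2 * K) by rewrite mulr_ge0// mulr_ge0.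
by have := ler_wpM2l DD dd; lra.
Qed.

Lemma near_leq (F : set_system R) {FF : Filter F} (P : nat -> R -> Prop) k :
  (forall j, \forall s \near F, P j s) -> \forall s \near F, forall j, (j <= k)%N -> P j s.
Proof.
move=> h; elim: k => [|k IH].
  by have := h 0%N; apply: filterS => s hs j; rewrite leqn0 => /eqP ->.
have := h k.+1; apply: filterS2 IH => s h1 h2 j; rewrite leq_eqVlt => /orP[/eqP -> //|].
by rewrite ltnS; exact: h1.
Qed.

Lemma ccurve_continuous_sobolev T K k u : 0 <= K -> ccurve K u -> continuous_sobolev T k u.
Proof.
move=> K0 hu t tT; have su s := ccurve_smooth s hu; have ku s := ccurve_supp s hu.
split; first exact: sobolev_Cc (Cc_intro (su t) K0 (ku t)).
have c : sobolev_norm2 k (u s \- u t) @[s --> nbhs t] --> 0%E.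
  apply: (@cvge0_sobolev _ _ (fun s => u s \- u t) k K K0).
  - by move=> s; exact: (smoothB (su s) (su t)).
  - by move=> s x hx; rewrite /= (ku s x hx) (ku t x hx) subrr.
  move=> e e0; have := near_leq k (fun j => ccurve_near j t hu e0) => /(_ (nbhs_filter t)).
  apply: filterS => s hs j x jk; rewrite (derive1n_B j (su s) (su t)); exact: hs.
exact: cvg_within_filter c.
Qed.

Lemma It_sobolev_derivative T K k u v g : 0 <= K -> smooth g -> ccurve K u -> ccurve K v ->
  (forall t x, u t x = g x + It v t x) -> sobolev_derivative T k u v.
Proof.
move=> K0 sg hu hv eu t /andP[t0 tT].
have su s := ccurve_smooth s hu; have ku s := ccurve_supp s hu.
have sv s := ccurve_smooth s hv; have kv s := ccurve_supp s hv.
have Du j s x : derive1n j (u s) x = derive1n j g x + derive1n j (It v s) x.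
  have -> : u s = fun x => g x + It v s x by apply/funext => y.
  by rewrite (derive1n_D j sg (It_smooth s hv)).
have sB s : smooth (fun x => u s x - u t x) by exact: smoothB (su s) (su t).
have sZ s : smooth (fun x => (s - t)^-1 * (u s x - u t x)).
  exact (@smoothZ _ _ (s - t)^-1 (sB s)).
apply: (@cvge0_sobolev _ _ (fun s x => (s - t)^-1 * (u s x - u t x) - v t x) k K K0).
- by move=> s; exact: smoothB (sZ s) (sv t).
- by move=> s x hx; rewrite (ku s x hx) (ku t x hx) (kv t x hx) subrr mulr0 subrr.
move=> e e0.
have := near_leq k (fun j => It_dt j hv t0 e0) => /(_ (nbhs_filter t)); rewrite !near_withinE.
apply: filterS => s hs st; rewrite /= in_itv /= => /andP[s0 _] j x jk.
have D0 : s - t != 0 by rewrite subr_eq0.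
rewrite (derive1n_B j (sZ s) (sv t)) (derive1nZ _ j (sB s)) (derive1n_B j (su s) (su t)).
have := hs j jk s0 x; rewrite !Du.
move: (derive1n j g x) (derive1n j (It v s) x) (derive1n j (It v t) x) (derive1n j (v t) x) => p q r z h.
have -> : (s - t)^-1 * (p + q - (p + r)) - z = (s - t)^-1 * (q - r - (s - t) * z).
  by field.
rewrite normrM normfV mulrC ler_pdivrMr ?normr_gt0//.
Qed.

Lemma L2_neg f : L2 f -> L2 (fun x => - f x).
Proof.
move=> hf; have := L2_lin (-1) 0 hf hf; congr L2.
by apply/funext => x; rewrite mulN1r mul0r addr0.
Qed.

(** The distributional form follows from the pointwise equation by moving the derivatives from
    [a phi] and [b1 phi] onto [u]. *)
Lemma smooth_solution T K k a b1 b2 b3 g0 g1 (f u v v' : R -> R -> R) : 0 <= K ->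
  smooth a -> smooth b1 -> smooth b2 -> smooth b3 -> smooth g0 -> smooth g1 ->
  ccurve K u -> ccurve K v -> ccurve K v' ->
  (forall t x, u t x = g0 x + It v t x) -> (forall t x, v t x = g1 x + It v' t x) ->
  (forall t x, 0 <= t <= T -> v' t x = opA a b1 b2 b3 (u t) (v t) x + f t x) ->
  solution T a b1 b2 b3 g0 g1 f k u.
Proof.
move=> K0 sa sb1 sb2 sb3 sg0 sg1 hu hv hv' eu ev eqv; exists v, v'; split.
- split; [exact: (@ccurve_continuous_sobolev T K k u K0 hu)|exact: (@ccurve_continuous_sobolev T K k v K0 hv)|].
  exact: (@ccurve_continuous_sobolev T K k v' K0 hv').
- by split; [exact: (@It_sobolev_derivative T K k u v g0 K0 sg0 hu hv eu)|exact: (@It_sobolev_derivative T K k v v' g1 K0 sg1 hv hv' ev)].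
- move=> t tT phi hphi; have [sphi [L L0 kphi]] := (CcinftyP _).1 hphi.
  have su := ccurve_smooth t hu; have sv := ccurve_smooth t hv; have sv' := ccurve_smooth t hv'.
  have Cu := Cc_intro su K0 (ccurve_supp t hu); have Cv := Cc_intro sv K0 (ccurve_supp t hv).
  have Cv' := Cc_intro sv' K0 (ccurve_supp t hv').
  have Cm c : smooth c -> Ccinfty (c \* phi).
    move=> sc; apply: (Cc_intro _ L0); first exact: (smoothM sc sphi).
    by move=> x /kphi e; rewrite /= e mulr0.
  have Ca := Cm a sa; have Cb1 := Cm b1 sb1; have Cb2 := Cm b2 sb2; have Cb3 := Cm b3 sb3.
  have Lp := Cc_L2_0 hphi; have Lu := Cc_L2_0 Cu; have Lv := Cc_L2_0 Cv; have Lv' := Cc_L2_0 Cv'.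
  have e1 := Rint5 (L2_mul Lv' Lp) (L2_mul Lu (Cc_L2 2 Ca)) (L2_mul Lu (Cc_L2 1 Cb1))
    (L2_mul Lv (Cc_L2_0 Cb2)) (L2_mul Lu (Cc_L2_0 Cb3)).
  have e2 := Rint5 (L2_mul Lv' Lp) (L2_mul (Cc_L2 2 Cu) (Cc_L2_0 Ca))
    (L2_mul (L2_neg (Cc_L2 1 Cu)) (Cc_L2_0 Cb1)) (L2_mul Lv (Cc_L2_0 Cb2)) (L2_mul Lu (Cc_L2_0 Cb3)).
  have w2 := weak_derivative_Cc 2 Cu Ca; have w1 := weak_derivative_Cc 1 Cu Cb1.
  have -> : \int[mu]_x (v' t x * phi x - u t x * derive1n 2 (a \* phi) x
      - u t x * derive1n 1 (b1 \* phi) x + b2 x * v t x * phi x + b3 x * u t x * phi x) =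
    \int[mu]_x (v' t x * phi x - u t x * derive1n 2 (a \* phi) x
      - u t x * derive1n 1 (b1 \* phi) x + v t x * (b2 \* phi) x + u t x * (b3 \* phi) x).
    by apply: eq_Rintegral => x _ /=; ring.
  rewrite e1 w2 w1 expr2 mulrNN !mulr1 mul1r expr1.
  have n1 : \int[mu]_x (- derive1n 1 (u t) x * (b1 \* phi) x) =
      -1 * \int[mu]_x (derive1n 1 (u t) x * (b1 \* phi) x).
    rewrite -RintegralZl//; last exact: (L2_mul (Cc_L2 1 Cu) (Cc_L2_0 Cb1)).
    by apply: eq_Rintegral => x _; ring.
  rewrite -n1 -e2; apply: eq_Rintegral => x _ /=; rewrite eqv// /opA.
  move: (derive1n 1 (u t) x) (derive1n 2 (u t) x) (u t x) (v t x) (f t x) => ? ? ? ? ?; ring.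
- by apply: aeW => x; rewrite eu It_le0// addr0.
- by apply: aeW => x; rewrite ev It_le0// addr0.
Qed.

End SmoothSolutions.

(** * The constant and the estimate *)

Section Estimate.
Context {R : realType}.
Local Notation mu := (@lebesgue_measure R).
Implicit Types (u v w : R -> R -> R) (f g c phi : R -> R) (K L e t s x y T : R).

(** Absolute values and the added 1 keep this at least 1 for arbitrary row vectors, which the
    positivity of the constant and Glaeser's inequality both use. *)
Definition coef_bound n (na nb1 nb2 nb3 : 'rV[R]_n.+1) : R :=
  \sum_(j < n.+1) (`|na 0 j| + `|nb1 0 j| + `|nb2 0 j| + `|nb3 0 j|) + 1.

(** The argument [4 * B] is the constant of Glaeser's inequality. The factor [1 + B] compares the
    initial energy, whose weighted term is at most [B |D^(j+1) g0|^2], with the Sobolev norms of the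
    data. *)
Definition energy_cst k (T M2 : R) (na nb1 nb2 nb3 : 'rV[R]_k.+2) : R :=
  let B := coef_bound na nb1 nb2 nb3 in
  expR ((ecst k.+1 B (4 * B) M2 + 2) * T) * (1 + B).

Lemma coef_bound_ge1 n (na nb1 nb2 nb3 : 'rV[R]_n.+1) : 1 <= coef_bound na nb1 nb2 nb3.
Proof. by rewrite lerDr sumr_ge0// => j _; rewrite !addr_ge0. Qed.

Lemma energy_cst_gt0 k T M2 (na nb1 nb2 nb3 : 'rV[R]_k.+2) : 0 < energy_cst T M2 na nb1 nb2 nb3.
Proof.
by rewrite mulr_gt0 ?expR_gt0// ltr_wpDl// (lt_le_trans ltr01)// coef_bound_ge1.
Qed.

Lemma coef_boundP n (na nb1 nb2 nb3 : 'rV[R]_n.+1) (j : 'I_n.+1) :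
  [/\ na 0 j <= coef_bound na nb1 nb2 nb3, nb1 0 j <= coef_bound na nb1 nb2 nb3,
      nb2 0 j <= coef_bound na nb1 nb2 nb3 & nb3 0 j <= coef_bound na nb1 nb2 nb3].
Proof.
have h : `|na 0 j| + `|nb1 0 j| + `|nb2 0 j| + `|nb3 0 j| <= coef_bound na nb1 nb2 nb3.
  rewrite /coef_bound (bigD1 j)//= -[X in _ <= X]addrA lerDl.
  by apply: addr_ge0 => //; apply: sumr_ge0 => i _; rewrite !addr_ge0.
have := ler_norm (na 0 j); have := ler_norm (nb1 0 j); have := ler_norm (nb2 0 j).
have := ler_norm (nb3 0 j); have := normr_ge0 (na 0 j); have := normr_ge0 (nb1 0 j).
have := normr_ge0 (nb2 0 j); have := normr_ge0 (nb3 0 j).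
by move: (coef_bound _ _ _ _) h => B *; split; lra.
Qed.

Lemma Binfty_coefs k a b1 b2 b3 M2 (B := coef_bound (Linfty_norms k.+1 a)
    (Linfty_norms k.+1 b1) (Linfty_norms k.+1 b2) (Linfty_norms k.+1 b3)) :
  Binfty a -> Binfty b1 -> Binfty b2 -> Binfty b3 -> (forall x, 0 <= a x) -> 0 < M2 ->
  (forall x, b1 x ^+ 2 <= M2 * a x) -> coefs a b1 b2 b3 k.+1 B (4 * B) M2.
Proof.
move=> ha hb1 hb2 hb3 a0 M20 hb.
have B1 : 1 <= B by exact: coef_bound_ge1.
have bd i x : (i <= k.+1)%N -> [/\ `|derive1n i a x| <= B, `|derive1n i b1 x| <= B,
    `|derive1n i b2 x| <= B & `|derive1n i b3 x| <= B].
  rewrite -ltnS => ik; pose j := Ordinal ik.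
  have [h1 h2 h3 h4] := coef_boundP (Linfty_norms k.+1 a) (Linfty_norms k.+1 b1)
    (Linfty_norms k.+1 b2) (Linfty_norms k.+1 b3) j.
  split.
  - exact: le_trans (Linfty_norms_ge j x ha) h1.
  - exact: le_trans (Linfty_norms_ge j x hb1) h2.
  - exact: le_trans (Linfty_norms_ge j x hb2) h3.
  - exact: le_trans (Linfty_norms_ge j x hb3) h4.
split.
- by split; [case: ha|case: hb1|case: hb2|case: hb3].
- by split => //; [rewrite (le_trans ler01)|rewrite mulr_ge0// (le_trans ler01)|exact: ltW].
- exact: bd.
- by move=> x; split.
- move=> k1 x; apply: glaeser => //; [by case: ha|exact: lt_le_trans ltr01 B1|].
  by move=> y; have [] := bd 2%N y k1.
Qed.

Lemma smooth_estimate T K N a b1 b2 b3 (B La M2 : R) g0 g1 (f u v v' : R -> R -> R) :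
  coefs a b1 b2 b3 N B La M2 -> 0 <= K -> smooth g0 -> smooth g1 ->
  ccurve K u -> ccurve K v -> ccurve K v' -> ccurve K f ->
  (forall t x, u t x = g0 x + It v t x) -> (forall t x, v t x = g1 x + It v' t x) ->
  (forall t x, 0 <= t <= T -> v' t x = opA a b1 b2 b3 (u t) (v t) x + f t x) ->
  forall t, 0 <= t <= T -> hnorm2 (K + 1) N (u t) <= expR ((ecst N B La M2 + 2) * T) * (1 + B) *
    (hnorm2 (K + 1) N.+1 g0 + hnorm2 (K + 1) N g1 + prim (fun s => hnorm2 (K + 1) N (f s)) t).
Proof.
move=> hc K0 sg0 sg1 hu hv hv' hf eu ev eqv t /andP[t0 tT].
have [[sa sb1 sb2 sb3] [_ B0 _ _] bd ha _] := hc.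
have hA := opA_curve sa sb1 sb2 sb3 hu hv.
(* The energy estimate asks for the equation at all positive times. With the residual [F] as source
   it holds trivially, and [F] equals [f] on [[0, T]]. *)
pose F s x := v' s x - opA a b1 b2 b3 (u s) (v s) x.
have hF : ccurve K F by exact: ccurveB hv' hA.
have duv : dcurve u v.
  have := dcurve_It sg0 hv; congr dcurve.
  by apply/funext => s; apply/funext => y; rewrite eu.
have dvv : dcurve v v'.
  have := dcurve_It sg1 hv'; congr dcurve.
  by apply/funext => s; apply/funext => y; rewrite ev.
have u0 : u 0 = g0 by apply/funext => y; rewrite eu It_le0// addr0.
have v0 : v 0 = g1 by apply/funext => y; rewrite ev It_le0// addr0.
set L := K + 1; have KL : K < L by rewrite /L ltrDl.
have L0 : 0 <= L by rewrite ltW// (le_lt_trans K0).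
have kA s : supp K (opA a b1 b2 b3 (u s) (v s)) by exact: (ccurve_supp s hA).
have eF s x : 0 < s -> v' s x = opA a b1 b2 b3 (u s) (v s) x + F s x.
  by move=> _; rewrite /F addrC subrK.
have := energy_estimate hc (friedrichs_id K0 KL) hu hv hv' hF duv dvv kA eF t0.
rewrite u0 v0.
have su := ccurve_smooth t hu; have sv := ccurve_smooth t hv.
have a0 x : 0 <= a x by have [] := ha x.
have ca : continuous a := smooth_cont sa.
have h1 : hnorm2 L N (u t) <= Int L (dens a N (u t) (v t) (u t)).
  rewrite (hnorm2_Int L N su); apply: Int_le => //.
  - by apply: ctsP; apply: cts_sum => j; contt.
  - exact: (cont_dens sa su sv su).
  move=> x _; rewrite /dens; apply: ler_sum => j _.
  by rewrite addrAC lerDr addr_ge0 ?sqr_ge0// mulr_ge0 ?sqr_ge0.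
have n0 f' n : smooth f' -> 0 <= hnorm2 L n f' by exact: hnorm2_ge0.
have h2 : Int L (dens a N g0 g1 g0) <= (1 + B) * (hnorm2 L N.+1 g0 + hnorm2 L N g1).
  apply: (@le_trans _ _ (hnorm2 L N g1 + hnorm2 L N g0 + B * hnorm2 L N.+1 g0)).
    have dE : hnorm2 L N.+1 g0 = Int L (fun x => g0 x ^+ 2) +
        \sum_(j < N.+1) Int L (fun x => derive1n j.+1 g0 x ^+ 2).
      by rewrite /hnorm2 big_ord_recl.
    have i0 : 0 <= Int L (fun x => g0 x ^+ 2).
      apply: Int_ge0 => //; first by contt.
      by move=> x _; exact: sqr_ge0.
    apply: (@le_trans _ _ (hnorm2 L N g1 + hnorm2 L N g0 +
       B * \sum_(j < N.+1) Int L (fun x => derive1n j.+1 g0 x ^+ 2))); last first.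
      by rewrite lerD2l dE mulrDr lerDr mulr_ge0.
    rewrite /dens (@Int_sum _ L N.+1 (fun j x => derive1n j g1 x ^+ 2 + derive1n j g0 x ^+ 2 +
      a x * derive1n j.+1 g0 x ^+ 2)); last by move=> i; contt.
    rewrite /hnorm2 mulr_sumr -!big_split /=; apply: ler_sum => j _.
    rewrite -IntZ; last by contt.
    rewrite -IntD; [|by contt|by contt]; rewrite -IntD; [|by contt|by contt].
    apply: Int_le; [by contt|by contt|exact: L0|] => x _.
    rewrite lerD2l ler_wpM2r ?sqr_ge0//.
    by have [h _ _ _] := bd 0%N x (leq0n _); apply: le_trans (ler_norm _) h.
  have h3 : hnorm2 L N g0 <= hnorm2 L N.+1 g0.
    rewrite {2}/hnorm2 big_ord_recr /= -/(hnorm2 L N g0) lerDl; apply: Int_ge0 => //; first by contt.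
    by move=> x _; exact: sqr_ge0.
  have := n0 _ N sg1; have := n0 _ N.+1 sg0.
  by move: (hnorm2 _ _ _) (hnorm2 _ _ _) (hnorm2 _ _ _) B B0 h3 {bd}hc => *; nra.
have h4 : prim (fun s => hnorm2 L N (F s)) t <= (1 + B) * prim (fun s => hnorm2 L N (f s)) t.
  have cF := hnorm2_cont (N := N) L0 hF; have cf := hnorm2_cont (N := N) L0 hf.
  have p0 : 0 <= prim (fun s => hnorm2 L N (f s)) t.
    by rewrite -(prim0 (fun s => hnorm2 L N (f s))) prim_mono// => s _; exact: n0 (ccurve_smooth s hf).
  have : prim (fun s => hnorm2 L N (F s)) t <= prim (fun s => hnorm2 L N (f s)) t.
    apply: prim_le => // s /andP[s0 st].
    have -> // : F s = f s.
    apply/funext => x; rewrite /F eqv; first by rewrite addrAC subrr add0r.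
    by rewrite s0 (le_trans st).
  by move=> /le_trans; apply; rewrite mulrDl mul1r lerDl mulr_ge0.
have ec := ecst_ge0 hc.
have ex : expR ((ecst N B La M2 + 2) * t) <= expR ((ecst N B La M2 + 2) * T).
  by rewrite ler_expR ler_wpM2l// addr_ge0.
move=> h5; apply: le_trans h1 _; apply: le_trans h5 _.
rewrite -mulrA; apply: ler_pM => //.
  apply: addr_ge0.
    apply: Int_ge0 => //; first exact: (cont_dens sa sg0 sg1 sg0).
    by move=> x _; exact: dens_ge0.
  have cF := hnorm2_cont (N := N) L0 hF.
  by rewrite -(prim0 (fun s => hnorm2 L N (F s))) prim_mono// => s _; exact: n0 (ccurve_smooth s hF).
by rewrite mulrDr; apply: lerD.
Qed.

Lemma sobolev_prim T K k (f F : R -> R -> R) t : 0 <= K -> ccurve K F -> 0 <= t <= T ->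
  (forall s, 0 <= s <= T -> f s = F s) ->
  (\int[mu]_(s in `[0%R, t]) sobolev_norm2 k (f s) = (prim (fun s => hnorm2 K k (F s)) t)%:E)%E.
Proof.
move=> K0 hF /andP[t0 tT] e.
transitivity (\int[mu]_(s in `[0%R, t]) (hnorm2 K k (F s))%:E)%E.
  apply: eq_integral => s; rewrite inE /= in_itv /= => /andP[s0 st].
  rewrite e ?s0 ?(le_trans st)//.
  exact: (sobolev_norm2_Cc k (ccurve_smooth s hF) K0 (ccurve_supp s hF)).
have c : continuous (fun s => hnorm2 K k (F s)) := hnorm2_cont (N := k) K0 hF.
by rewrite (int_seg c t0) prim0 subr0.
Qed.

End Estimate.

Theorem theorem2p3 (R : realType) :
  exists C : forall k : nat, R -> R ->
      'rV[R]_k.+2 -> 'rV[R]_k.+2 -> 'rV[R]_k.+2 -> 'rV[R]_k.+2 -> R,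
  (forall k T M2 na nb1 nb2 nb3, 0 < C k T M2 na nb1 nb2 nb3) /\
  forall (T : R) (a b1 b2 b3 : R -> R) (M2 : R)
         (g0 g1 : R -> R) (f : R -> R -> R),
    0 < T ->
    Binfty a -> Binfty b1 -> Binfty b2 -> Binfty b3 ->
    (forall x : R, 0 <= a x) ->
    0 < M2 -> (forall x : R, b1 x ^+ 2 <= M2 * a x) ->
    Ccinfty g0 -> Ccinfty g1 -> continuous_Ccinfty T f ->
    (forall k : nat, well_posed T a b1 b2 b3 g0 g1 f k) /\
    (forall (m : nat) (u : R -> R -> R),
      solution T a b1 b2 b3 g0 g1 f m u ->
      forall (k : nat) (t : R), 0 <= t <= T ->
      (sobolev_norm2 k.+1 (u t) <=
         (C k T M2 (Linfty_norms k.+1 a) (Linfty_norms k.+1 b1)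
                   (Linfty_norms k.+1 b2) (Linfty_norms k.+1 b3))%:E *
         (sobolev_norm2 k.+2 g0 + sobolev_norm2 k.+1 g1 +
          \int[@lebesgue_measure R]_(s in `[0%R, t])
             sobolev_norm2 k.+1 (f s)))%E).
Proof.
exists (@energy_cst R); split; first by move=> *; exact: energy_cst_gt0.
move=> T a b1 b2 b3 M2 g0 g1 f T0 ha hb1 hb2 hb3 a0 M20 hb hg0 hg1 hf.
have [[sa ba] [sb1 _] [sb2 _] [sb3 _]] := And4 ha hb1 hb2 hb3.
have [Ba hBa] := ba 0%N; have [A0 hA0] := ba 2%N.
have aB x : a x <= Ba by apply: le_trans (ler_norm _) (hBa x).
pose A := `|A0| + 1; have Ap : 0 < A by rewrite ltr_wpDl.
have hA x : `|derive1n 2 a x| <= A.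
  by apply: le_trans (hA0 x) _; apply: le_trans (ler_norm A0) _; rewrite lerDl.
have uniq k l u w := @solution_unique R T a b1 b2 b3 g0 g1 f u w k l Ba A M2
  sa sb1 sb2 sb3 a0 aB Ap hA (ltW M20) hb hg0 hg1.
have [sg0 [R1 R10 kg0]] := (CcinftyP _).1 hg0; have [sg1 [R2 R20 kg1]] := (CcinftyP _).1 hg1.
have [R3 R30 hF] := continuous_Ccinfty_curve (ltW T0) hf.
pose R0 := R1 + R2 + R3.
have [le1 le2 le3 R00] : [/\ R1 <= R0, R2 <= R0, R3 <= R0 & 0 <= R0].
  by rewrite /R0; split; lra.
have [chi [schi kchi chile chi1]] := cutoff (R0 + (Ba + 1) * T).
have kchi' : supp (R0 + (Ba + 1) * T + 2) chi by apply: supp_le kchi; lra.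
have [K' [U [V [V' [K'0 [hU' hV'] hW' [eU eV] eqV]]]]] :=
  existence sa sb1 sb2 sb3 a0 aB (ltW M20) hb R00 (ltW T0) sg0 (supp_le le1 kg0) sg1
    (supp_le le2 kg1) (ccurve_le le3 hF) schi kchi' chile chi1.
pose K := K' + R0; have K0 : 0 <= K by rewrite addr_ge0.
have K'K : K' <= K by rewrite lerDl.
have R0K : R0 <= K by rewrite lerDr.
have hU := ccurve_le K'K hU'; have hV := ccurve_le K'K hV'; have hW := ccurve_le K'K hW'.
have hFK : ccurve K (fun t => f (clamp T t)) by apply: ccurve_le hF; exact: le_trans R0K.
have eqV' t x : 0 <= t <= T -> V' t x = opA a b1 b2 b3 (U t) (V t) x + f t x.
  by move=> tT; rewrite eqV// clampE.
(* One and the same smooth [U] is the solution at every order [k]. *)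
have sol k : solution T a b1 b2 b3 g0 g1 f k U.
  exact: (@smooth_solution R T K k a b1 b2 b3 g0 g1 f U V V' K0 sa sb1 sb2 sb3 sg0 sg1 hU hV hW eU eV eqV').
split.
  move=> k; split; first by exists U.
  by move=> u w hu hw t tT; exact: uniq hu hw t tT.
move=> m u hu k t tT.
have Lu : L2 (u t) by have [ut [utt [[cu _ _] _ _ _ _]]] := hu; have [[]] := cu t tT.
have sUt := ccurve_smooth t hU; have kUt := ccurve_supp t hU.
(* The given solution has order [m], possibly far below [k.+1]; it agrees almost everywhere with
   [U], and so inherits its Sobolev norm. *)
rewrite (sobolev_norm2_ae k.+1 Lu (Cc_L2_0 (Cc_intro sUt K0 kUt)) (uniq _ _ _ _ hu (sol 0%N) t tT)).
have KL : K <= K + 1 by rewrite lerDl.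
have L0 : 0 <= K + 1 by exact: le_trans KL.
have kL g R' : R' <= R0 -> supp R' g -> supp (K + 1) g.
  by move=> h; apply: supp_le; rewrite (le_trans h)// (le_trans R0K).
rewrite (sobolev_norm2_Cc _ sUt L0 (supp_le KL kUt)).
rewrite (sobolev_norm2_Cc _ sg0 L0 (kL _ _ le1 kg0)) (sobolev_norm2_Cc _ sg1 L0 (kL _ _ le2 kg1)).
rewrite (sobolev_prim k.+1 L0 (ccurve_le KL hFK) tT); last by move=> s sT; rewrite clampE.
rewrite -!EFinD -EFinM lee_fin.
have hc := Binfty_coefs k ha hb1 hb2 hb3 a0 M20 hb.
apply: (smooth_estimate hc K0 sg0 sg1 hU hV hW hFK eU eV _ tT) => s x sT.
by rewrite eqV// addrC.
Qed.
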